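(* Let $\mu$ be the Gibbs measure on $\Sigma_A$ of a Hölder continuous potential that is not cohomologous to a constant. For $\varepsilon>0$ define $\psi_\varepsilon^{+},\psi_\varepsilon^{-}:\mathbb N\to\mathbb N$ by $$\psi_\varepsilon^{+}(n)=\left\lfloor\frac{\log n}{h_\mu}+\frac{1+\varepsilon}{h_\mu^{3/2}}\sqrt{2\rho_\mu\log n\,\log\log\log n}\right\rfloor,\qquad \psi_\varepsilon^{-}(n)=\left\lfloor\frac{\log n}{h_\mu}+\frac{1-\varepsilon}{h_\mu^{3/2}}\sqrt{2\rho_\mu\log n\,\log\log\log n}\right\rfloor.$$ Then for every $\varepsilon>0$ we have $\mu(R_{\psi_\varepsilon^{+}})=0$ and $\mu(R_{\psi_\varepsilon^{-}})=1$.
   Context: Let $K\ge 2$ be an integer and $\Sigma=\{1,\dots,K\}^{\mathbb N}$, with $|\mathbf i\wedge\mathbf j|=\inf\{n\ge0:i_{n+1}\ne j_{n+1}\}$ and metric $d(\mathbf i,\mathbf j)=K^{-|\mathbf i\wedge\mathbf j|}$. Let $A$ be a $K\times K$ $\{0,1\}$-matrix with $A^M$ strictly positive for some $M$, $\Sigma_A=\{\mathbf i\in\Sigma:A_{i_l,i_{l+1}}=1\ \forall l\}$, $\sigma$ the left shift. $\Sigma_{A,n}$ is the set of admissible words of length $n$, $[w]$ the cylinder in $\Sigma_A$ of a word $w$. $f:\Sigma_A\to\mathbb R$ is Hölder continuous if $|f(\mathbf i)-f(\mathbf j)|\le b\alpha^{|\mathbf i\wedge\mathbf j|}$ for some $b>0,0<\alpha<1$;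 $P(f)=\lim_n\frac1n\log\sum_{w\in\Sigma_{A,n}}\sup_{\mathbf j\in[w]}e^{\sum_{k=0}^{n-1}f(\sigma^k\mathbf j)}$. The Gibbs measure of $f$ is the unique $\sigma$-invariant ergodic probability $\mu$ on $\Sigma_A$ with $C^{-1}\le\mu([i_1\dots i_n])/\exp(-nP(f)+\sum_{k=0}^{n-1}f(\sigma^k\mathbf i))\le C$ for some $C>1$ and all $\mathbf i,n$. $h_\mu=\lim_n-\frac1n\sum_{w\in\Sigma_{A,n}}\mu([w])\log\mu([w])$, $\rho_\mu=\lim_n\frac1n\int(\sum_{k=0}^{n-1}f\circ\sigma^k-n\int f d\mu)^2d\mu$. Cohomologous to a constant: $f=g\circ\sigma-g+c$ with $g$ continuous, $c$ constant. For $\psi:\mathbb N\to\mathbb N$, $R_\psi=\{\mathbf i\in\Sigma_A:d(\sigma^n\mathbf i,\mathbf i)\le K^{-\psi(n)}\text{ for infinitely many }n\}$. Convention: $\log x=0$ for $x\le1$. *)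

(* Defs.v *)
From HB Require Import structures.
From mathcomp Require Import all_boot all_order all_algebra.
From mathcomp Require Import all_classical all_reals all_analysis.

Set Implicit Arguments.
Unset Strict Implicit.
Unset Printing Implicit Defensive.

Import Order.TTheory GRing.Theory Num.Theory.
Import numFieldNormedType.Exports.
Local Open Scope classical_set_scope.
Local Open Scope ring_scope.

(* The alphabet {1,...,K} with K = k.+2 >= 2, realised as 'I_K = {0,...,K-1}. *)
Definition alph (k : nat) := 'I_k.+2.
HB.instance Definition _ k := Finite.on (alph k).
HB.instance Definition _ k := isPointed.Build (alph k) ord0.

(* Sequence space Sigma = {1..K}^N; coordinate l (0-based) is i_{l+1}. *)
Definition seqs (k : nat) := nat -> alph k.

Definition cyl (k n : nat) (w : n.-tuple (alph k)) : set (seqs k) :=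
  [set x | forall l : 'I_n, x l = tnth w l].

Definition cylinders (k : nat) : set (set (seqs k)) :=
  [set C | exists n (w : n.-tuple (alph k)), C = cyl w].

(* Sigma with the Borel sigma-algebra of the metric d, i.e. the one generated
   by cylinders. *)
Definition Sig (k : nat) := g_sigma_algebraType (@cylinders k).

(* x and y agree on their first n coordinates, i.e. |x /\ y| >= n,
   i.e. d(x,y) <= K^-n. *)
Definition agree (k : nat) (n : nat) (x y : seqs k) : Prop :=
  forall l, (l < n)%N -> x l = y l.

Definition shift (k : nat) (x : Sig k) : Sig k := fun l => x l.+1.

Definition SigmaA (k : nat) (A : 'M[int]_k.+2) : set (Sig k) :=
  [set x | forall l, A (x l) (x l.+1) = 1].

Definition zero_one_matrix (k : nat) (A : 'M[int]_k.+2) : Prop :=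
  forall a b, A a b = 0 \/ A a b = 1.

Definition primitive_matrix (k : nat) (A : 'M[int]_k.+2) : Prop :=
  exists M : nat, forall a b, 0 < (A ^+ M) a b.

Definition admissible_word (k : nat) (A : 'M[int]_k.+2) (n : nat)
  (w : n.-tuple (alph k)) : bool :=
  [forall i : 'I_n, forall j : 'I_n,
     (nat_of_ord j == (nat_of_ord i).+1) ==> (A (tnth w i) (tnth w j) == 1)].

Definition cylA (k : nat) (A : 'M[int]_k.+2) (n : nat) (w : n.-tuple (alph k))
  : set (Sig k) := cyl w `&` SigmaA A.

Definition birkhoff (R : realType) (k : nat) (f : Sig k -> R) (n : nat)
  (x : Sig k) : R := \sum_(j < n) f (iter j (@shift k) x).

(* Hölder continuity on Sigma_A: |f i - f j| <= b alpha^{|i /\ j|}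
   (written out: whenever |i /\ j| >= n the bound b alpha^n holds). *)
Definition holder (R : realType) (k : nat) (A : 'M[int]_k.+2) (f : Sig k -> R)
  : Prop :=
  exists b alpha : R, 0 < b /\ 0 < alpha < 1 /\
    forall x y n, SigmaA A x -> SigmaA A y -> agree n x y ->
      `|f x - f y| <= b * alpha ^+ n.

Definition continuous_on_SigmaA (R : realType) (k : nat) (A : 'M[int]_k.+2)
  (g : Sig k -> R) : Prop :=
  forall x, SigmaA A x -> forall eps : R, 0 < eps ->
    exists n, forall y, SigmaA A y -> agree n x y -> `|g x - g y| < eps.

Definition cohomologous_to_constant (R : realType) (k : nat) (A : 'M[int]_k.+2)
  (f : Sig k -> R) : Prop :=
  exists (g : Sig k -> R) (c : R), continuous_on_SigmaA A g /\
    forall x, SigmaA A x -> f x = g (shift x) - g x + c.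

Definition pressure (R : realType) (k : nat) (A : 'M[int]_k.+2) (f : Sig k -> R)
  : R :=
  limn (fun n : nat => n%:R^-1 * ln (\sum_(w : n.-tuple (alph k) |
          admissible_word A w)
          sup [set expR (birkhoff f n j) | j in cylA A w])).

Definition gibbs_measure (R : realType) (k : nat) (A : 'M[int]_k.+2)
  (f : Sig k -> R) (mu : probability (Sig k) R) : Prop :=
  [/\ mu (SigmaA A) = 1%E,
      (forall E : set (Sig k), measurable E -> mu (@shift k @^-1` E) = mu E),
      (forall E : set (Sig k), measurable E -> @shift k @^-1` E = E ->
          mu E = 0%E \/ mu E = 1%E) &
      exists C : R, 1 < C /\
        forall (x : Sig k) (n : nat), SigmaA A x ->
          C^-1 <= fine (mu (cylA A [tuple x (nat_of_ord l) | l < n]))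
                  / expR (- (n%:R * pressure A f) + birkhoff f n x) <= C].

(* entropy h_mu (with the usual natural logarithm, 0 log 0 = 0) *)
Definition entropy (R : realType) (k : nat) (A : 'M[int]_k.+2)
  (mu : probability (Sig k) R) : R :=
  limn (fun n : nat => - (n%:R^-1 *
     \sum_(w : n.-tuple (alph k) | admissible_word A w)
        fine (mu (cylA A w)) * ln (fine (mu (cylA A w))))).

Definition integral_on (R : realType) (k : nat) (A : 'M[int]_k.+2)
  (mu : probability (Sig k) R) (g : Sig k -> R) : R :=
  fine (\int[mu]_(x in SigmaA A) (g x)%:E)%E.

Definition asymp_variance (R : realType) (k : nat) (A : 'M[int]_k.+2)
  (f : Sig k -> R) (mu : probability (Sig k) R) : R :=
  limn (fun n : nat => n%:R^-1 *
    integral_on A mu (fun x => (birkhoff f n x - n%:R * integral_on A mu f) ^+ 2)).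

(* R_psi : d(sigma^n i, i) <= K^{-psi(n)} for infinitely many n;
   d(sigma^n i, i) <= K^{-m} iff |sigma^n i /\ i| >= m. *)
Definition recurrence_set (k : nat) (A : 'M[int]_k.+2) (psi : nat -> nat)
  : set (Sig k) :=
  [set x | SigmaA A x /\
     forall N : nat, exists n : nat, (N <= n)%N /\
       agree (psi n) (iter n (@shift k) x) x].

Definition logc (R : realType) (x : R) : R := if x <= 1 then 0 else ln x.

(* psi^{+-}_eps(n) = floor(log n / h + s/h^{3/2} sqrt(2 rho log n logloglog n)),
   s = 1 +- eps; a negative value (only possible for finitely many n) is
   truncated to 0 since psi takes values in N. *)
Definition psi_fun (R : realType) (h rho s : R) (n : nat) : nat :=
  Num.truncn (logc (n%:R : R) / h + s / (h `^ (3%:R / 2%:R)) *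
     Num.sqrt (2%:R * rho * logc (n%:R : R) * logc (logc (logc (n%:R : R))))).

(* Main.v *)
(** Subtracting the pressure and adding a coboundary turns [f] into a potential
    whose transfer operator [P] fixes the constants and preserves [mu]; on
    log-Hölder cones [P] contracts, hence [P^n phi -> mu(phi)] exponentially fast.
    Poisson's equation then gives [f - mu(f) = xi + chi o shift - chi] with
    [P xi = 0], and perturbing [P] by [exp (t xi)] gives two-sided bounds on the
    exponential moments of [V_m = S_m f - m mu(f)], i.e. moderate deviation
    estimates with variance [rho = mu(xi^2)].  Since cylinders are quasi
    independent, these estimates yield the law of the iterated logarithm for [V].

    The Gibbs property reads [mu [x_1..x_m] ~ exp (V_m x - m h)] with [h = h_mu].
    A return at time [n] to the [m]-cylinder of [x] has conditional probability
    at most a constant times [mu [x_1..x_m]], and for [m = psi_+(n)] the upper law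
    of the iterated logarithm makes these probabilities summable.  Conversely, for
    infinitely many [m] the cylinder is so large, namely
    [V_m >= (1 - eps/4) sqrt (2 rho m ln ln m)], that the first
    [exp (m h - (1 - eps/2) sqrt (2 rho m ln ln m))] times, tried at spacing
    [m + M], almost surely contain a return; all of them satisfy [psi_-(n) <= m]. *)

Require Import Defs.
From HB Require Import structures.
From mathcomp Require Import all_boot all_order all_algebra.
From mathcomp Require Import all_classical all_reals all_analysis.
From mathcomp Require Import ring lra.
Import Order.TTheory GRing.Theory Num.Theory.
Import numFieldNormedType.Exports.
Local Open Scope classical_set_scope.
Local Open Scope ring_scope.

Set Implicit Arguments.
Unset Strict Implicit.
Unset Printing Implicit Defensive.

(** The Gibbs property holds only up to the factor [C], so what it yields directly is exact only up
    to constants, whereas the invariance of [mu] under [P] is an exact statement. The limits of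
    [P^n phi] form a functional [J], and the Gibbs bounds merely give [mu <= C' J] on nonnegative
    functions. Equality comes from growth rates: if [P xi = 0], then [n^2 mu(xi)^2 <= mu((S_n xi)^2)
    <= C' J((S_n xi)^2) = C' n J(xi^2)] for all [n], whence [mu(xi) = 0].

    For the exponential moments, the leading eigenfunction of the perturbed operator is replaced by
    the explicit function [1 + t^2 eta], an eigenfunction up to [O(t^3)]. Positivity of the operator
    turns this one-step estimate into two-sided bounds for all iterates.

    Birkhoff sums depend on all coordinates, while quasi-independence concerns unions of cylinders.
    Bounded distortion allows each event on [V_m] to be enlarged to the union of the [m]-cylinders
    meeting it, at the price of an additive constant that is negligible on the scale of the iterated
    logarithm. *)

Local Notation shift := Defs.shift.

(** * Cylinders and their quasi-independence *)

Section Symbolic.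
Variables (R : realType) (k : nat) (A : 'M[int]_k.+2).

Definition cons_seq (a : alph k) (x : Sig k) : Sig k :=
  fun l => if l is l'.+1 then x l' else a.

Lemma iter_shiftE n (x : Sig k) : iter n (@shift k) x = fun l => x (n + l)%N.
Proof.
elim: n x => [|n IH] x; first by apply/funext.
by rewrite iterSr IH; apply/funext => l; rewrite /= /Defs.shift addSn.
Qed.

Lemma shift_cons a x : shift (cons_seq a x) = x.
Proof. by []. Qed.

Lemma cons_shift (x : Sig k) : cons_seq (x 0%N) (shift x) = x.
Proof. by apply/funext => -[]. Qed.

Lemma SigmaA_shift n x : SigmaA A x -> SigmaA A (iter n (@shift k) x).
Proof. by move=> Xx l; rewrite iter_shiftE addnS; apply: Xx. Qed.

Lemma SigmaA_cons a x : SigmaA A x -> A a (x 0%N) = 1 -> SigmaA A (cons_seq a x).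
Proof. by move=> Xx Aa [|l] //=; apply: Xx. Qed.

Lemma agree_cons n a (x y : Sig k) :
  agree n x y -> agree n.+1 (cons_seq a x) (cons_seq a y).
Proof. by move=> xy [|l] //=; apply: xy. Qed.

Lemma agree_shift n m (x y : Sig k) :
  agree (n + m) x y -> agree m (iter n (@shift k) x) (iter n (@shift k) y).
Proof. by move=> xy l lm; rewrite !iter_shiftE xy// ltn_add2l. Qed.

Lemma agree_sym n (x y : Sig k) : agree n x y -> agree n y x.
Proof. by move=> xy l /xy. Qed.

Lemma agree_trans n (x y z : Sig k) : agree n x y -> agree n y z -> agree n x z.
Proof. by move=> xy yz l ln; rewrite xy// yz. Qed.

Lemma agree_leq n m (x y : Sig k) : (m <= n)%N -> agree n x y -> agree m x y.
Proof. by move=> mn xy l lm; apply: xy; apply: leq_trans mn. Qed.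

Lemma agree_refl n (x : Sig k) : agree n x x.
Proof. by []. Qed.

Definition ball_seq n (x : Sig k) : set (Sig k) :=
  [set y | SigmaA A y /\ agree n x y].

Lemma cylA_tuple n (x : Sig k) :
  cylA A [tuple x (nat_of_ord l) | l < n] = ball_seq n x.
Proof.
apply/seteqP; split => y /=.
  move=> [yx Xy]; split=> // l ln.
  by rewrite (yx (Ordinal ln)) tnth_mktuple.
move=> [Xy xy]; split=> // l.
by rewrite tnth_mktuple xy.
Qed.

Lemma exp_path (M : nat) : zero_one_matrix A -> forall a b, 0 < (A ^+ M) a b ->
  exists p : nat -> alph k, [/\ p 0%N = a, p M = b &
     forall l, (l < M)%N -> A (p l) (p l.+1) = 1].
Proof.
move=> A01; elim: M => [|M IH] a b.
  rewrite expr0 !mxE; case: eqVneq => [->|_]; last by rewrite ltxx.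
  by move=> _; exists (fun=> b).
rewrite exprS !mxE => h.
have [j hj] : exists j, 0 < A a j * (A ^+ M) j b.
  apply: contrapT => /forallNP hn; move: h; rewrite ltNge => /negP; apply.
  by apply: sumr_le0 => j _; rewrite leNgt; apply/negP/hn.
have Aaj : A a j = 1.
  by case: (A01 a j) => // A0; move: hj; rewrite A0 mul0r ltxx.
move: hj; rewrite Aaj mul1r => /IH [p [p0 pM pA]].
exists (fun l => if l is l'.+1 then p l' else a); split => //.
by case=> [|l] //= lM; rewrite ?p0 ?pA.
Qed.

(** Primitivity in the form in which it is used: the length [M] of the bridge is uniform in the
    letter and in the point. *)
Definition connecting (M : nat) := forall (a : alph k) y, SigmaA A y ->
  exists z, [/\ SigmaA A z, z 0%N = a & iter M (@shift k) z = y].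

Lemma primitive_connecting :
  zero_one_matrix A -> primitive_matrix A -> exists M, connecting M.
Proof.
move=> A01 [M AM]; exists M => a y Xy.
have [p [p0 pM pA]] := exp_path A01 (AM a (y 0%N)).
exists (fun l => if (l < M)%N then p l else y (l - M)%N); split.
- move=> l; case: (ltnP l.+1 M) => h; first by rewrite (ltnW h) pA// ltnW.
  case: (ltnP l M) => h'; last by rewrite subSn//; exact: Xy.
  have lM : l.+1 = M by apply/eqP; rewrite eqn_leq h' h.
  by rewrite lM subnn -pM -lM; apply: pA; rewrite lM.
(* For [M = 0] both ends of the path sit at index [0], so [a] is already the first letter of [y]. *)
- case: ifPn => //; rewrite -leqNgt leqn0 => /eqP M0.
  by rewrite M0 subn0 -p0 -pM M0.
- rewrite iter_shiftE; apply/funext => l.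
  by rewrite ltnNge leq_addr /= addKn.
Qed.

(** The bridge starts at the letter [x n], so the junction after the first [n] letters is a
    transition of [x] itself and hence admissible. *)
Lemma splice (M : nat) : connecting M -> forall n x y, SigmaA A x -> SigmaA A y ->
  exists z, [/\ SigmaA A z, agree n x z & iter (n + M) (@shift k) z = y].
Proof.
move=> conn n x y Xx Xy.
have [z [Xz z0 zM]] := conn (x n) y Xy.
exists (fun l => if (l < n)%N then x l else z (l - n)%N); split.
- move=> l; case: (ltnP l.+1 n) => h; first by rewrite (ltnW h); exact: Xx.
  case: (ltnP l n) => h'; last by rewrite subSn//; exact: Xz.
  have lM : l.+1 = n by apply/eqP; rewrite eqn_leq h' h.
  by rewrite lM subnn z0 -lM; exact: Xx.
- by move=> l ln; rewrite ln.
- rewrite -zM !iter_shiftE; apply/funext => l.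
  by rewrite -addnA ltnNge leq_addr /= addKn.
Qed.

End Symbolic.

Section Determined.
Variables (R : realType) (k : nat) (A : 'M[int]_k.+2) (mu : probability (Sig k) R).
Implicit Types (x y : Sig k) (E F : set (Sig k)).

Lemma measurable_cyl n (w : n.-tuple (alph k)) : measurable (cyl w : set (Sig k)).
Proof. by apply: sub_sigma_algebra; exists n, w. Qed.

Lemma measurable_coord l (a : alph k) : measurable [set x : Sig k | x l = a].
Proof.
suff -> : [set x : Sig k | x l = a] =
    \bigcup_(w in [set w : l.+1.-tuple (alph k) | tnth w ord_max = a])
      (cyl w : set (Sig k)).
  by apply: fin_bigcup_measurable => // w _; exact: measurable_cyl.
apply/seteqP; split => x /=.
  move=> xa; exists [tuple x (nat_of_ord i) | i < l.+1] => /=.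
    by rewrite tnth_mktuple.
  by move=> i; rewrite tnth_mktuple.
by move=> [w /= wa xw]; rewrite -wa -xw.
Qed.

Lemma measurable_shift : measurable_fun setT (@shift k : Sig k -> Sig k).
Proof.
apply: (@measurability _ _ (Sig k) (Sig k) setT _ (@cylinders k) erefl) => _ [_ [n [w ->]] <-].
rewrite setTI.
suff -> : @shift k @^-1` cyl w =
    \bigcap_(i in [set: 'I_n]) [set x : Sig k | x i.+1 = tnth w i].
  by apply: fin_bigcap_measurable => // i _; exact: measurable_coord.
by apply/seteqP; split => [x xw i _|x xw i]; [exact: xw|exact: (xw i I)].
Qed.

Lemma measurable_iter_shift n E :
  measurable E -> measurable (iter n (@shift k) @^-1` E).
Proof.
elim: n => [|n IH] in E * => // mE.
rewrite (_ : _ @^-1` E = iter n (@shift k) @^-1` (@shift k @^-1` E))//.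
by apply: IH; rewrite -[X in measurable X]setTI; exact: measurable_shift.
Qed.

Lemma measurable_SigmaA : measurable (SigmaA A).
Proof.
suff -> : SigmaA A = \bigcap_l \bigcup_(p in [set p : alph k * alph k | A p.1 p.2 = 1])
   ([set x : Sig k | x l = p.1] `&` [set x : Sig k | x l.+1 = p.2]).
  apply: bigcapT_measurable => l; apply: fin_bigcup_measurable => // p _.
  by apply: measurableI; exact: measurable_coord.
apply/seteqP; split => [x Xx l _|x Xx l]; first by exists (x l, x l.+1) => //; exact: Xx.
by have [[a b] /= Aab [-> ->]] := Xx l I.
Qed.

Lemma measurable_cylA n (w : n.-tuple (alph k)) : measurable (cylA A w).
Proof. by apply: measurableI; [exact: measurable_cyl|exact: measurable_SigmaA]. Qed.

(* [E] is a union of [n]-cylinders of [SigmaA A]. *)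
Definition determined n E :=
  E `<=` SigmaA A /\ forall x y, SigmaA A y -> agree n x y -> E x -> E y.

Lemma ball_seqE n x (w : n.-tuple (alph k)) : cylA A w x -> cylA A w = ball_seq A n x.
Proof.
move=> [xw Xx]; rewrite -cylA_tuple; congr (cylA A _).
by apply: eq_from_tnth => i; rewrite tnth_mktuple -xw.
Qed.

Lemma measurable_ball n x : measurable (ball_seq A n x).
Proof. by rewrite -cylA_tuple; exact: measurable_cylA. Qed.

Lemma ball_self n x : SigmaA A x -> ball_seq A n x x.
Proof. by []. Qed.

Lemma determined_ball n x : determined n (ball_seq A n x).
Proof. by split=> [y []|y z Xz yz [Xy xy]] //; split => //; exact: agree_trans yz. Qed.

Lemma determined_leq n m E : (n <= m)%N -> determined n E -> determined m E.
Proof. by move=> nm [EX dE]; split=> // x y Xy /(agree_leq nm); exact: dE. Qed.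

Lemma determined_cylA n E (w : n.-tuple (alph k)) x : determined n E ->
  E x -> cylA A w x -> E `&` cylA A w = ball_seq A n x.
Proof.
move=> [EX dE] Ex xw; rewrite (ball_seqE xw).
apply/seteqP; split => [y []//|y [Xy xy]]; split => //.
exact: dE xy Ex.
Qed.

Lemma measurable_determined n E : determined n E -> measurable E.
Proof.
move=> dE.
suff -> : E = \bigcup_(w in [set w : n.-tuple (alph k) | E `&` cylA A w !=set0]) cylA A w.
  by apply: fin_bigcup_measurable => // w _; exact: measurable_cylA.
apply/seteqP; split => [x Ex|y [w /= [x [Ex xw]] yw]].
  have xw : cylA A [tuple x (nat_of_ord l) | l < n] x.
    by rewrite cylA_tuple; apply: ball_self; exact: dE.1.
  by exists [tuple x (nat_of_ord l) | l < n] => //; exists x.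
by move: yw; rewrite (ball_seqE xw) -(determined_cylA dE Ex xw) => -[].
Qed.

Lemma determined_shift n m E : determined m E ->
  determined (n + m) (SigmaA A `&` iter n (@shift k) @^-1` E).
Proof.
move=> [EX dE]; split => [x []//|x y Xy xy [Xx Ex]]; split => //.
by apply: dE Ex; [exact: SigmaA_shift|exact: agree_shift].
Qed.

Lemma determinedD n E F : determined n E -> determined n F -> determined n (E `\` F).
Proof.
move=> [EX dE] [FX dF]; split => [x [/EX]//|x y Xy xy [Ex Fx]].
split; [exact: dE xy Ex|move=> Fy; apply: Fx].
by apply: dF Fy; [exact: EX|exact: agree_sym].
Qed.

(** The union of the [n]-cylinders meeting [E]. Level sets of Birkhoff sums are not determined by
    finitely many coordinates; their hulls are, and quasi-independence applies to them. *)
Definition hull n E : set (Sig k) :=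
  [set x | SigmaA A x /\ exists y, E y /\ agree n x y].

Lemma determined_hull n E : determined n (hull n E).
Proof.
split => [x []//|x y Xy xy [Xx [z [Ez xz]]]]; split => //.
by exists z; split => //; apply: agree_trans xz; exact: agree_sym.
Qed.

Definition pr E : R := fine (mu E).

Lemma pr_fin E : measurable E -> mu E \is a fin_num.
Proof. exact: fin_num_measure. Qed.

Lemma prE E : measurable E -> mu E = (pr E)%:E.
Proof. by move=> /pr_fin muE; rewrite /pr fineK. Qed.

Lemma pr_ge0 E : 0 <= pr E.
Proof. by rewrite /pr fine_ge0. Qed.

Lemma pr_le1 E : measurable E -> pr E <= 1.
Proof. by move=> mE; rewrite -lee_fin -prE// probability_le1. Qed.

Lemma le_pr E F : measurable E -> measurable F -> E `<=` F -> pr E <= pr F.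
Proof.
by move=> mE mF EF; rewrite -lee_fin -!prE//; apply: le_measure; rewrite ?inE.
Qed.

Lemma pr0 : pr set0 = 0.
Proof. by rewrite /pr measure0. Qed.

Lemma prDI E F : measurable E -> measurable F ->
  pr E = pr (E `\` F) + pr (E `&` F).
Proof.
move=> mE mF; apply: EFin_inj; rewrite EFinD -!prE//.
- exact: measureDI.
- exact: measurableI.
- exact: measurableD.
Qed.

Lemma pr_partition_shift i n E : measurable E -> E `<=` SigmaA A ->
  pr E = \sum_(w : n.-tuple (alph k)) pr (E `&` iter i (@shift k) @^-1` cylA A w).
Proof.
move=> mE EX.
have mEw (w : n.-tuple (alph k)) : measurable (E `&` iter i (@shift k) @^-1` cylA A w).
  by apply: measurableI => //; apply: measurable_iter_shift; exact: measurable_cylA.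
have {1}-> : E = \bigcup_(w in [set: n.-tuple (alph k)])
    (E `&` iter i (@shift k) @^-1` cylA A w).
  apply/seteqP; split => [x Ex|x [w _ []//]].
  exists [tuple iter i (@shift k) x (nat_of_ord l) | l < n] => //; split => //.
  by rewrite cylA_tuple; split => //; apply: SigmaA_shift; exact: EX.
apply: EFin_inj; rewrite -prE; last exact: fin_bigcup_measurable.
rewrite measure_fin_bigcup//.
- have -> : [set: n.-tuple (alph k)] = [set` index_enum (n.-tuple (alph k))].
    by apply/seteqP; split => // w _ /=; rewrite mem_index_enum.
  rewrite -fsbig_seq ?index_enum_uniq// -sumEFin.
  by apply: eq_bigr => w _; exact: prE.
- exact: (@finite_finset (n.-tuple (alph k) : finType)).
- move=> v w _ _ [x [[_ xv] [_ xw]]].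
  by apply: eq_from_tnth => l; rewrite -xv.1 -xw.1.
Qed.

Lemma pr_partition n E : measurable E -> E `<=` SigmaA A ->
  pr E = \sum_(w : n.-tuple (alph k)) pr (E `&` cylA A w).
Proof. exact: (@pr_partition_shift 0). Qed.

End Determined.

Section QuasiIndependence.
Variables (R : realType) (k : nat) (A : 'M[int]_k.+2) (mu : probability (Sig k) R).
Variables (G : nat -> Sig k -> R) (U C : R) (M : nat).
Hypothesis mu_inv : forall E : set (Sig k), measurable E -> mu (@shift k @^-1` E) = mu E.
Hypothesis conn : connecting A M.
Hypothesis G_add : forall n m x, G (n + m) x = G n x + G m (iter n (@shift k) x).
Hypothesis G_bnd : forall n x, SigmaA A x -> `|G n x| <= n%:R * U.
Hypothesis C_gt1 : 1 < C.
Hypothesis gibbs : forall x n, SigmaA A x ->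
  C^-1 <= pr mu (ball_seq A n x) / expR (G n x) <= C.
Implicit Types (x y : Sig k) (E F : set (Sig k)).

Let C_gt0 : 0 < C. Proof. exact: lt_trans C_gt1. Qed.

Lemma gibbs_ub n x : SigmaA A x -> pr mu (ball_seq A n x) <= C * expR (G n x).
Proof. by move=> /(gibbs n) /andP[_]; rewrite ler_pdivrMr ?expR_gt0. Qed.

Lemma gibbs_lb n x : SigmaA A x -> expR (G n x) <= C * pr mu (ball_seq A n x).
Proof.
by move=> /(gibbs n) /andP[+ _]; rewrite ler_pdivlMr ?expR_gt0// mulrC ler_pdivrMr// mulrC.
Qed.

Lemma pr_ball_gt0 n x : SigmaA A x -> 0 < pr mu (ball_seq A n x).
Proof.
move=> /(gibbs_lb n) h; have := lt_le_trans (expR_gt0 _) h.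
by rewrite pmulr_rgt0.
Qed.

Lemma ball_agree n x y : agree n x y -> ball_seq A n x = ball_seq A n y.
Proof.
move=> xy; apply/seteqP; split => z [Xz zx]; split => //.
  exact: agree_trans (agree_sym xy) zx.
exact: agree_trans xy zx.
Qed.

(** Both exponentials are compared with the measure of the one cylinder containing [x] and [y],
    which gives bounded distortion directly from the Gibbs property. *)
Lemma distortion n x y : SigmaA A x -> SigmaA A y -> agree n x y ->
  expR (G n x) <= C ^+ 2 * expR (G n y).
Proof.
move=> Xx Xy xy; apply: (le_trans (gibbs_lb n Xx)).
rewrite (ball_agree xy) expr2 -mulrA ler_pM2l//; exact: gibbs_ub.
Qed.

Lemma distortion_ln n x y : SigmaA A x -> SigmaA A y -> agree n x y ->
  `|G n x - G n y| <= 2 * ln C.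
Proof.
have D x' y' : SigmaA A x' -> SigmaA A y' -> agree n x' y' -> G n x' - G n y' <= 2 * ln C.
  move=> Xx Xy /(distortion Xx Xy).
  rewrite -[C in X in _ <= X](lnK (x := C)) ?posrE// -expRM_natl -expRD ler_expR mulr_natl.
  by rewrite -lerBlDr.
move=> Xx Xy xy; rewrite ler_norml lerNl opprB !D//; exact: agree_sym.
Qed.

(** After cutting into cylinders, one factor [C] bounds the measure of the long cylinder from above
    and two more bound the exponentials of its two pieces, [G] being additive. *)
Lemma quasi_indep_ub j l E F : determined A j E -> determined A l F ->
  pr mu (E `&` iter j (@shift k) @^-1` F) <= C ^+ 3 * pr mu E * pr mu F.
Proof.
move=> dE dF.
have mE := measurable_determined dE; have mF := measurable_determined dF.
have mW : measurable (E `&` iter j (@shift k) @^-1` F).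
  by apply: measurableI => //; exact: measurable_iter_shift.
rewrite (pr_partition (A := A) mu j mW); last by move=> x [/(dE.1)].
rewrite [pr mu E](pr_partition (A := A) mu j mE dE.1) mulr_sumr mulr_suml.
apply: ler_sum => w _.
have mWw : measurable (E `&` iter j (@shift k) @^-1` F `&` cylA A w).
  by apply: measurableI => //; exact: measurable_cylA.
rewrite (pr_partition_shift (A := A) mu j l mWw); last by move=> x [[/(dE.1)]].
rewrite [pr mu F](pr_partition (A := A) mu l mF dF.1) mulr_sumr.
apply: ler_sum => v _.
have [->|/set0P[z [[[Ez Fz] zw] zv]]] := eqVneq (E `&` iter j (shift (k:=k)) @^-1` F
   `&` cylA A w `&` iter j (shift (k:=k)) @^-1` cylA A v) set0.
  by rewrite pr0 !mulr_ge0 ?exprn_ge0 ?pr_ge0 ?ltW.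
have Xz := dE.1 _ Ez.
rewrite (determined_cylA dE Ez zw) (determined_cylA dF Fz zv).
set B := (X in pr mu X <= _).
have mB : measurable B.
  rewrite /B; apply: measurableI => //; apply: measurable_iter_shift; exact: measurable_cylA.
(* Prescribing the first [j] letters and the next [l] ones leaves at most one cylinder of length
   [j + l]. *)
apply: (@le_trans _ _ (pr mu (ball_seq A (j + l) z))).
  apply: le_pr => //; first exact: measurable_ball.
  move=> y [[[Ey Fy] yw] yv]; split; first exact: dE.1.
  move: yw; rewrite (ball_seqE zw) => -[Xy zy].
  move: yv; rewrite /preimage/= (ball_seqE zv) => -[_ zy2].
  move=> i ijl; case: (ltnP i j) => ij; first exact: zy.
  have := zy2 (i - j)%N; rewrite !iter_shiftE subnKC//; apply.
  by rewrite ltn_subLR.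
apply: (le_trans (gibbs_ub _ Xz)); rewrite G_add expRD.
rewrite exprS expr2 -!mulrA ler_pM2l// mulrA mulrCA !mulrA -mulrA.
rewrite [X in _ <= X](_ : _ = (C * pr mu (ball_seq A j z)) *
  (C * pr mu (ball_seq A l (iter j (@shift k) z)))); last by ring.
apply: ler_pM; rewrite ?expR_ge0//; first exact: gibbs_lb.
by apply: gibbs_lb; exact: SigmaA_shift.
Qed.

(** Three factors [C] come from the Gibbs bounds on the long cylinder and its two pieces; the
    exponential is the worst contribution of the [M] bridging letters. *)
Definition qi_const : R := C ^- 3 * expR (- (M%:R * U)).

Lemma qi_const_gt0 : 0 < qi_const.
Proof. by rewrite mulr_gt0 ?expR_gt0// invr_gt0 exprn_gt0. Qed.

(** For each pair of cylinders, [splice] provides a point whose cylinder of length [j + M + l] lies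
    in the intersection; the gap [M] leaves room for the bridge. *)
Lemma quasi_indep_lb j l E F : determined A j E -> determined A l F ->
  qi_const * pr mu E * pr mu F <=
  pr mu (E `&` iter (j + M) (@shift k) @^-1` F).
Proof.
move=> dE dF.
have mE := measurable_determined dE; have mF := measurable_determined dF.
have mW : measurable (E `&` iter (j + M) (@shift k) @^-1` F).
  by apply: measurableI => //; exact: measurable_iter_shift.
rewrite (pr_partition (A := A) mu j mW); last by move=> x [/(dE.1)].
rewrite [pr mu E](pr_partition (A := A) mu j mE dE.1) mulr_sumr mulr_suml.
apply: ler_sum => w _.
have mWw : measurable (E `&` iter (j + M) (@shift k) @^-1` F `&` cylA A w).
  by apply: measurableI => //; exact: measurable_cylA.
rewrite (pr_partition_shift (A := A) mu (j + M) l mWw); last by move=> x [[/(dE.1)]].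
rewrite [pr mu F](pr_partition (A := A) mu l mF dF.1) mulr_sumr.
apply: ler_sum => v _.
have [->|/set0P[x [Ex xw]]] := eqVneq (E `&` cylA A w) set0.
  by rewrite pr0 mulr0 mul0r pr_ge0.
have [->|/set0P[y [Fy yv]]] := eqVneq (F `&` cylA A v) set0.
  by rewrite pr0 mulr0 pr_ge0.
have Xx := dE.1 _ Ex; have Xy := dF.1 _ Fy.
have [z [Xz xz zy]] := splice conn j Xx Xy.
rewrite (determined_cylA dE Ex xw) (determined_cylA dF Fy yv).
rewrite (ball_agree xz) -zy.
apply: (@le_trans _ _ (pr mu (ball_seq A (j + M + l) z))); last first.
  apply: le_pr; first exact: measurable_ball.
    apply: measurableI => //; apply: measurable_iter_shift; exact: measurable_cylA.
  move=> u [Xu zu].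
  have xu : agree j x u by apply: agree_trans xz _; apply: agree_leq zu; rewrite -addnA leq_addr.
  have yu : agree l y (iter (j + M) (@shift k) u) by rewrite -zy; exact: agree_shift.
  split; last first.
    by rewrite /preimage/= (ball_seqE yv); split => //; exact: SigmaA_shift.
  split; last by rewrite (ball_seqE xw).
  split; first exact: dE.2 xu Ex.
  by apply: dF.2 yu Fy; exact: SigmaA_shift.
rewrite -(ler_pM2l C_gt0); apply: le_trans (gibbs_lb _ Xz).
rewrite !G_add !expRD /qi_const.
have h1 := gibbs_ub j Xz.
have h2 := gibbs_ub l (SigmaA_shift (j + M) Xz).
have h3 : expR (- (M%:R * U)) <= expR (G M (iter j (@shift k) z)).
  rewrite ler_expR; have := G_bnd M (SigmaA_shift j Xz).
  by rewrite ler_norml => /andP[].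
rewrite [X in X <= _](_ : _ = ((C^-1 * pr mu (ball_seq A j z)) * expR (- (M%:R * U))) *
  (C^-1 * pr mu (ball_seq A l (iter (j + M) (@shift k) z)))); last first.
  by field; rewrite gt_eqF.
apply: ler_pM.
- by rewrite !mulr_ge0 ?expR_ge0 ?invr_ge0 ?pr_ge0 ?ltW.
- by rewrite !mulr_ge0 ?invr_ge0 ?pr_ge0 ?ltW.
- apply: ler_pM; rewrite ?expR_ge0//; first by rewrite !mulr_ge0 ?invr_ge0 ?pr_ge0 ?ltW.
  by rewrite mulrC ler_pdivrMr// mulrC.
- by rewrite mulrC ler_pdivrMr// mulrC.
Qed.

End QuasiIndependence.

Section Birkhoff.
Variables (R : realType) (k : nat) (A : 'M[int]_k.+2).
Implicit Types (u : Sig k -> R) (x : Sig k).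

Lemma birkhoff0 u x : birkhoff u 0 x = 0.
Proof. by rewrite /birkhoff big_ord0. Qed.

Lemma birkhoffS u n x : birkhoff u n.+1 x = u x + birkhoff u n (shift x).
Proof.
rewrite /birkhoff big_ord_recl /=; congr (_ + _).
by apply: eq_bigr => i _; rewrite -iterSr.
Qed.

Lemma birkhoffD u n m x :
  birkhoff u (n + m) x = birkhoff u n x + birkhoff u m (iter n (@shift k) x).
Proof.
elim: n x => [|n IH] x; first by rewrite birkhoff0 add0r.
by rewrite addSn !birkhoffS IH addrA iterSr.
Qed.

Lemma birkhoff_norm u U n x : (forall y, SigmaA A y -> `|u y| <= U) ->
  SigmaA A x -> `|birkhoff u n x| <= n%:R * U.
Proof.
move=> uU; elim: n x => [|n IH] x Xx; first by rewrite birkhoff0 normr0 mul0r.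
rewrite birkhoffS -natr1 mulrDl mul1r addrC; apply: (le_trans (ler_normD _ _)).
by apply: lerD; [exact: IH (SigmaA_shift 1 Xx)|exact: uU].
Qed.
End Birkhoff.

(** * The transfer operator and its contraction of log-Hölder cones *)

Section TransferOperator.
Variables (R : realType) (k : nat) (A : 'M[int]_k.+2).
Implicit Types (w u phi psi : Sig k -> R) (x y z : Sig k).

(** Ruelle's transfer operator with weight [w]: the preimages of [x] under the shift are the
    admissible sequences [cons_seq a x]. *)
Definition transfer w phi x : R :=
  \sum_(a : alph k | A a (x 0%N) == 1) w (cons_seq a x) * phi (cons_seq a x).

Lemma SigmaA_consE a x : SigmaA A x -> A a (x 0%N) == 1 -> SigmaA A (cons_seq a x).
Proof. by move=> Xx /eqP; exact: SigmaA_cons. Qed.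

Lemma eq_transfer w phi psi : {in SigmaA A, phi =1 psi} ->
  {in SigmaA A, transfer w phi =1 transfer w psi}.
Proof.
move=> e x /set_mem Xx; apply: eq_bigr => a aA; rewrite e//.
by apply/mem_set; exact: SigmaA_consE.
Qed.

Lemma eq_iter_transfer w n phi psi : {in SigmaA A, phi =1 psi} ->
  {in SigmaA A, iter n (transfer w) phi =1 iter n (transfer w) psi}.
Proof. by move=> e; elim: n => //= n IH; exact: eq_transfer. Qed.

Lemma transfer_lin w c phi psi x :
  transfer w (fun y => c * phi y + psi y) x = c * transfer w phi x + transfer w psi x.
Proof.
by rewrite mulr_sumr -big_split/=; apply: eq_bigr => a _; rewrite mulrDr mulrCA.
Qed.

Lemma iter_transfer_lin w n c phi psi x :
  iter n (transfer w) (fun y => c * phi y + psi y) x =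
  c * iter n (transfer w) phi x + iter n (transfer w) psi x.
Proof.
elim: n x => //= n IH x; rewrite -transfer_lin.
by congr transfer; apply/funext => y.
Qed.

Lemma transfer_sum w (I : finType) (c : I -> R) (phi : I -> Sig k -> R) x :
  transfer w (fun y => \sum_i c i * phi i y) x = \sum_i c i * transfer w (phi i) x.
Proof.
rewrite /transfer; under eq_bigr do rewrite mulr_sumr.
rewrite exchange_big/=; apply: eq_bigr => i _.
by rewrite mulr_sumr; apply: eq_bigr => a _; rewrite mulrCA.
Qed.

Lemma iter_transfer_sum w n (I : finType) (c : I -> R) (phi : I -> Sig k -> R) x :
  iter n (transfer w) (fun y => \sum_i c i * phi i y) x =
  \sum_i c i * iter n (transfer w) (phi i) x.
Proof.
elim: n x => //= n IH x; rewrite -transfer_sum.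
by congr transfer; apply/funext => y.
Qed.

Section Positive.
Variable w : Sig k -> R.
Hypothesis w_ge0 : forall x, SigmaA A x -> 0 <= w x.

Lemma ler_transfer phi psi : (forall x, SigmaA A x -> phi x <= psi x) ->
  forall x, SigmaA A x -> transfer w phi x <= transfer w psi x.
Proof.
move=> le x Xx; apply: ler_sum => a aA; have Xax := SigmaA_consE Xx aA.
by apply: ler_wpM2l; [exact: w_ge0|exact: le].
Qed.

Lemma ler_iter_transfer n phi psi : (forall x, SigmaA A x -> phi x <= psi x) ->
  forall x, SigmaA A x -> iter n (transfer w) phi x <= iter n (transfer w) psi x.
Proof. by move=> le; elim: n => //= n IH; exact: ler_transfer. Qed.

Lemma iter_transfer_cst0 n x : iter n (transfer w) (fun=> 0) x = 0.
Proof.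
elim: n x => //= n IH x; rewrite /transfer big1// => a _.
by rewrite IH mulr0.
Qed.

Lemma iter_transfer_ge0 n phi : (forall x, SigmaA A x -> 0 <= phi x) ->
  forall x, SigmaA A x -> 0 <= iter n (transfer w) phi x.
Proof.
by move=> le x Xx; rewrite -(iter_transfer_cst0 n x); exact: ler_iter_transfer.
Qed.

Lemma iter_transferZ n c phi x :
  iter n (transfer w) (fun y => c * phi y) x = c * iter n (transfer w) phi x.
Proof.
rewrite -[RHS]addr0 -(iter_transfer_cst0 n x) -iter_transfer_lin.
by congr (iter n (transfer w) _ x); apply/funext => y; rewrite addr0.
Qed.

Lemma transfer_term phi z : (forall x, SigmaA A x -> 0 <= phi x) -> SigmaA A z ->
  w z * phi z <= transfer w phi (shift z).
Proof.
move=> p0 Xz; have Xs := SigmaA_shift 1 Xz.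
have z0 : A (z 0%N) (shift z 0%N) == 1 by apply/eqP; exact: Xz.
rewrite /transfer (bigD1 (z 0%N))//= cons_shift lerDl; apply: sumr_ge0 => a /andP[aA _].
by have Xax := SigmaA_consE Xs aA; apply: mulr_ge0; [exact: w_ge0|exact: p0].
Qed.

(** Only the inverse branch through [z] is kept; all other branches contribute nonnegative terms. *)
Lemma iter_transfer_term c n phi z : (forall x, SigmaA A x -> c <= w x) -> 0 <= c ->
  (forall x, SigmaA A x -> 0 <= phi x) -> SigmaA A z ->
  c ^+ n * phi z <= iter n (transfer w) phi (iter n (@shift k) z).
Proof.
move=> cw c0; elim: n phi z => [|n IH] phi z p0 Xz; first by rewrite expr0 mul1r.
rewrite !iterSr exprSr -mulrA.
apply: (le_trans _ (IH (transfer w phi) (shift z) _ (SigmaA_shift 1 Xz))).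
  apply: ler_wpM2l; first exact: exprn_ge0.
  apply: le_trans (transfer_term p0 Xz); apply: ler_wpM2r; [exact: p0|exact: cw].
by move=> x Xx; apply: (@iter_transfer_ge0 1).
Qed.

End Positive.

(** With weight [1] the iterate is the plain sum over all [n]-fold preimages, so the weights along a
    branch are collected into one exponential of a Birkhoff sum. *)
Lemma iter_transfer_exp u n phi x :
  iter n (transfer (fun y => expR (u y))) phi x =
  iter n (transfer (fun=> 1)) (fun y => expR (birkhoff u n y) * phi y) x.
Proof.
elim: n phi x => [|n IH] phi x; first by rewrite /= birkhoff0 expR0 mul1r.
rewrite !iterSr IH; congr (iter n _ _ x); apply/funext => y.
rewrite /transfer mulr_sumr; apply: eq_bigr => a _.
by rewrite birkhoffS shift_cons expRD; ring.
Qed.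

Section Additive.
Variable nu : set (Sig k) -> R.
Hypothesis nu_ge0 : forall E, measurable E -> E `<=` SigmaA A -> 0 <= nu E.
Hypothesis nu_split : forall l E, measurable E -> E `<=` SigmaA A ->
  nu E = \sum_(a : alph k) nu (E `&` [set x | x l = a]).
Let pre := transfer (fun=> 1).

Let pre_ball E j n a y : E `<=` SigmaA A ->
  E `&` iter j (@shift k) @^-1` ball_seq A n.+1 (cons_seq a y) =
  E `&` iter j.+1 (@shift k) @^-1` ball_seq A n y `&` [set x | x j = a].
Proof.
move=> EX; apply/seteqP; split => x /=.
  move=> [Ex [Xj ag]]; split; [split => //; split|].
  - exact: (SigmaA_shift j.+1 (EX _ Ex)).
  - move=> l ln; have := ag l.+1 ln.
    by rewrite /= -iterS !iter_shiftE addnS addSn.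
  - by have := ag 0%N (ltn0Sn _); rewrite !iter_shiftE addn0.
move=> [[Ex [Xj ag]] xj]; split => //; split; first exact: (SigmaA_shift j (EX _ Ex)).
move=> [|l] ln /=; first by rewrite iter_shiftE addn0.
by have := ag l ln; rewrite -iterS !iter_shiftE addnS addSn.
Qed.

Let mball E j n y : measurable E ->
  measurable (E `&` iter j (@shift k) @^-1` ball_seq A n y).
Proof.
by move=> mE; apply: measurableI => //; apply: measurable_iter_shift; exact: measurable_ball.
Qed.

(** The [n]-fold preimages of [x] differ in their first [n] letters, so their [n]-cylinders are
    disjoint and the sum is at most the total mass. The set function [nu] is abstract because both
    [mu] and [E |-> \int[mu]_E phi] are needed; the offset [j] makes the induction go through. *)
Lemma sum_preimages_ball_le E j n x : measurable E -> E `<=` SigmaA A -> SigmaA A x ->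
  iter n pre (fun y => nu (E `&` iter j (@shift k) @^-1` ball_seq A n y)) x <= nu E.
Proof.
move=> mE EX; elim: n j x => [|n IH] j x Xx.
  rewrite /= (_ : _ `&` _ = E)//; apply/seteqP; split => [y []//|y Ey]; split => //.
  by split => //; apply: SigmaA_shift; exact: EX.
rewrite iterSr; apply: le_trans (IH j.+1 x Xx).
apply: ler_iter_transfer => // y Xy.
rewrite (nu_split j (mball j.+1 n y mE)); last by move=> z [/EX].
rewrite /pre /transfer; under eq_bigr do rewrite mul1r pre_ball//.
rewrite [leRHS](bigID (fun a => A a (y 0%N) == 1))/= lerDl.
apply: sumr_ge0 => a _; apply: nu_ge0; last by move=> z [[/EX]].
by apply: measurableI; [exact: mball|exact: measurable_coord].
Qed.

(** Every admissible word of [n + 1] letters begins some [(n + M)]-fold preimage of [x], so the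
    cylinders of these preimages cover [E]. *)
Lemma sum_preimages_ball_ge M : connecting A M ->
  forall E j n x, measurable E -> E `<=` SigmaA A -> SigmaA A x ->
  nu E <= iter (n + M) pre (fun y => nu (E `&` iter j (@shift k) @^-1` ball_seq A n.+1 y)) x.
Proof.
move=> conn E j n x mE EX Xx; elim: n j => [|n IH] j.
  rewrite add0n (nu_split j mE EX).
  rewrite (_ : (fun y => nu _) =
     fun y => \sum_(a : alph k) nu (E `&` [set x | x j = a]) * (y 0%N == a)%:R); last first.
    apply/funext => y; rewrite (bigD1 (y 0%N))//= eqxx mulr1 big1 ?addr0; last first.
      by move=> a ay; rewrite eq_sym (negbTE ay) mulr0.
    congr nu; apply/seteqP; split => z /=.
      by move=> [Ez [_ /(_ 0%N (ltn0Sn _))]]; rewrite iter_shiftE addn0.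
    move=> [Ez zy]; split => //; split; first exact: (SigmaA_shift j (EX _ Ez)).
    by move=> [|//] _; rewrite iter_shiftE addn0.
  rewrite iter_transfer_sum; apply: ler_sum => a _.
  rewrite -[leLHS]mulr1; apply: ler_wpM2l.
    apply: nu_ge0; last by move=> z [/EX].
    by apply: measurableI => //; exact: measurable_coord.
  have [z [Xz z0 zM]] := conn a x Xx.
  have := @iter_transfer_term (fun=> 1) _ 1 M (fun y => (y 0%N == a)%:R) z.
  by rewrite z0 eqxx mulr1 expr1n zM; apply.
rewrite addSn iterSr; apply: (le_trans (IH j.+1)).
apply: ler_iter_transfer => // y Xy.
rewrite (nu_split j (mball j.+1 n.+1 y mE)); last by move=> z [/EX].
rewrite /pre /transfer; under [leRHS]eq_bigr do rewrite mul1r pre_ball//.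
rewrite (bigID (fun a => A a (y 0%N) == 1))/= gerDl.
rewrite big1// => a aA; rewrite (_ : _ `&` _ = set0).
  (* For the empty set [nu_split] reads [nu set0 = K * nu set0] with [K >= 2] letters, hence
     [nu set0 = 0]. *)
  have n0 := nu_split 0 (measurable0 : measurable (set0 : set (Sig k))) (@sub0set _ _).
  move: n0; under eq_bigr do rewrite set0I.
  rewrite sumr_const (_ : #|_| = k.+2); last exact: card_ord.
  by rewrite mulrS -[X in X = _ -> _]addr0 => /addrI/esym/eqP; rewrite mulrn_eq0 => /eqP.
apply/seteqP; split => // z /= [[Ez [_ ag]] za]; move/negP: aA; apply.
have := ag 0%N (ltn0Sn _); rewrite -iterS iter_shiftE addn0 => ->.
by rewrite -za; apply/eqP; exact: EX.
Qed.
End Additive.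

End TransferOperator.

Section Cones.
Variables (R : realType) (k : nat) (A : 'M[int]_k.+2) (alpha : R).
Hypothesis alpha01 : 0 < alpha < 1.
Implicit Types (phi psi u v : Sig k -> R) (x y z : Sig k).

Let a0 : 0 < alpha. Proof. by case/andP: alpha01. Qed.
Let a1 : alpha < 1. Proof. by case/andP: alpha01. Qed.
Let an0 n : 0 <= alpha ^+ n. Proof. by rewrite exprn_ge0// ltW. Qed.

(** Positive functions whose logarithm is Hölder with constant [B] at scales from [m] on. Scale [1]
    compares points with the same first letter, whose preimages correspond to each other; scale [0]
    compares all points. *)
Definition cone m B phi := (forall x, SigmaA A x -> 0 < phi x) /\
  forall n x y, SigmaA A x -> SigmaA A y -> (m <= n)%N -> agree n x y ->
    phi x <= phi y * expR (B * alpha ^+ n).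

Lemma cone_weaken m m' B B' phi : (m <= m')%N -> B <= B' -> cone m B phi -> cone m' B' phi.
Proof.
move=> mm BB [p0 c]; split => // n x y Xx Xy mn xy.
apply: (le_trans (c n x y Xx Xy (leq_trans mm mn) xy)).
by rewrite ler_wpM2l ?ler_expR ?ler_wpM2r// ltW// p0.
Qed.

Lemma cone_const m B c : 0 <= B -> 0 < c -> cone m B (fun=> c).
Proof.
move=> B0 c0; split => // n x y _ _ _ _.
by apply: ler_peMr; [exact: ltW|rewrite -expR0 ler_expR mulr_ge0].
Qed.

Lemma cone_from1 B phi : cone 1 B phi ->
  (forall x y, SigmaA A x -> SigmaA A y -> phi x <= phi y * expR B) -> cone 0 B phi.
Proof.
move=> [p0 c] c'; split => // -[|n] x y Xx Xy _ xy; last exact: c.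
by rewrite expr0 mulr1; exact: c'.
Qed.

(** Subtracting at most a third of [phi] costs no more than a doubling of the logarithmic Hölder
    constant. *)
Lemma cone_sub B t phi psi : 0 <= B -> 0 <= t -> cone 0 (B / 2) phi -> cone 0 (B / 2) psi ->
  (forall x, SigmaA A x -> 3 * (t * psi x) <= phi x) ->
  cone 0 B (fun x => phi x - t * psi x).
Proof.
move=> B0 t0 [p0 cp] [q0 cq] h; split => [x Xx|n x y Xx Xy _ xy].
  have := h x Xx; have := p0 x Xx; have : 0 <= t * psi x by rewrite mulr_ge0// ltW// q0.
  by lra.
have c1 := cp n x y Xx Xy isT xy.
have c2 := cq n y x Xy Xx isT (agree_sym xy).
have hy := h y Xy.
have -> : expR (B * alpha ^+ n) = expR (B / 2 * alpha ^+ n) ^+ 2.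
  by rewrite -expRM_natl; congr expR; field.
have r1 : 1 <= expR (B / 2 * alpha ^+ n).
  by rewrite -expR0 ler_expR !mulr_ge0// invr_ge0.
set r := expR _ in c1 c2 r1 *.
have r0 : 0 < r by apply: lt_le_trans r1.
have c3 : t * psi y / r <= t * psi x.
  by rewrite ler_pdivrMr// -mulrA ler_wpM2l.
set P := t * psi y in hy c3 *.
have P0 : 0 <= P by rewrite mulr_ge0// ltW// q0.
apply: (@le_trans _ _ (phi y * r - P / r)).
  by lra.
(* Since [phi y >= 3 P], it remains to see that [2 r^2 - 3 r + 1 / r >= 0], and this equals
   [(r - 1)^2 (2 r + 1) / r]. *)
have : 0 <= P / r * ((r - 1) ^+ 2 * (2 * r + 1)).
  apply: mulr_ge0; first by apply: mulr_ge0 => //; rewrite invr_ge0 ltW.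
  by apply: mulr_ge0; [exact: sqr_ge0|lra].
have : 0 <= (phi y - 3 * P) * (r * (r - 1)).
  by apply: mulr_ge0; [lra|apply: mulr_ge0; lra].
have -> : P / r * ((r - 1) ^+ 2 * (2 * r + 1)) = 2 * P * r ^+ 2 - 3 * P * r + P / r.
  by field; rewrite gt_eqF.
by nra.
Qed.

Section Transfer.
Variables (u : Sig k -> R) (b U c C : R) (M : nat).
Hypothesis b0 : 0 <= b.
Hypothesis u_hol : forall n x y, SigmaA A x -> SigmaA A y -> agree n x y ->
  `|u x - u y| <= b * alpha ^+ n.
Hypothesis u_bnd : forall x, SigmaA A x -> `|u x| <= U.
Hypothesis conn : connecting A M.
Let L := transfer A (fun y => expR (u y)).
Hypothesis c0 : 0 < c.
Hypothesis L1_lb : forall n x, SigmaA A x -> c <= iter n L (fun=> 1) x.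
Hypothesis L1_ub : forall n x, SigmaA A x -> iter n L (fun=> 1) x <= C.

Let w_ge0 x : SigmaA A x -> 0 <= expR (u x). Proof. by move=> _; exact: expR_ge0. Qed.

Lemma transfer_gt0 phi : (forall x, SigmaA A x -> 0 < phi x) ->
  forall x, SigmaA A x -> 0 < L phi x.
Proof.
move=> p0 x Xx; have term a : A a (x 0%N) == 1 -> 0 < expR (u (cons_seq a x)) * phi (cons_seq a x).
  by move=> aA; apply: mulr_gt0; [exact: expR_gt0|exact/p0/SigmaA_consE].
have [a aA] : exists a, A a (x 0%N) == 1.
  apply: contrapT => /forallNP h; have := L1_lb 1 Xx; rewrite /= /L /transfer big1.
    by rewrite leNgt c0.
  by move=> a aA; have := h a; rewrite aA.
rewrite /L /transfer (bigD1 a)//=; apply: ltr_wpDr; last exact: term.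
by apply: sumr_ge0 => a' /andP[a'A _]; exact/ltW/term.
Qed.

(** Points with a common first letter have the same admissible prefixes, and prefixing a letter
    gains a factor [alpha] on the distance. *)
Lemma transfer_cone B phi : cone 1 B phi -> cone 1 (alpha * (b + B)) (L phi).
Proof.
move=> [p0 cp]; split => [|n x y Xx Xy n0 xy]; first exact: transfer_gt0.
have x0 : x 0%N = y 0%N by exact: xy.
rewrite /L /transfer x0 mulr_suml; apply: ler_sum => a aA.
have Xay := SigmaA_consE Xy aA.
have Xax : SigmaA A (cons_seq a x) by apply: SigmaA_consE => //; rewrite x0.
have xy' := agree_cons a xy.
have := u_hol Xax Xay xy'; rewrite ler_norml => /andP[_ hu].
have hp := cp _ _ _ Xax Xay (ltn0Sn n) xy'.
apply: (@le_trans _ _ (expR (u (cons_seq a y) + b * alpha ^+ n.+1) *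
    (phi (cons_seq a y) * expR (B * alpha ^+ n.+1)))).
  by apply: ler_pM => //; rewrite ?expR_ge0 ?(ltW (p0 _ _))// ler_expR; lra.
rewrite expRD -!mulrA ler_pM2l ?expR_gt0// mulrCA ler_pM2l ?p0//.
rewrite -expRD ler_expR exprS.
by rewrite le_eqVlt; apply/orP; left; apply/eqP; ring.
Qed.

(** The fixed point of [B |-> alpha * (b + B)], towards which [transfer_cone] drives the
    constant. *)
Definition cone_floor : R := b * alpha / (1 - alpha).

Lemma cone_floor_ge0 : 0 <= cone_floor.
Proof. by rewrite divr_ge0 ?mulr_ge0 ?subr_ge0// ltW. Qed.

Lemma iter_transfer_cone j B phi : cone 1 B phi ->
  cone 1 (alpha ^+ j * B + cone_floor) (iter j L phi).
Proof.
move=> cp; elim: j => [|j IH].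
  by apply: cone_weaken cp; rewrite // expr0 mul1r lerDl cone_floor_ge0.
apply: cone_weaken (transfer_cone IH) => //.
rewrite exprS /cone_floor le_eqVlt; apply/orP; left; apply/eqP; field.
by rewrite subr_eq0 gt_eqF.
Qed.

(** For every [z] the point [y] has an [M]-fold preimage with the first letter of [z], so [phi z] is
    bounded by a multiple of [iter M L phi y]; applying [L] another [M] times to this constant bound
    gives the value at [x]. *)
Lemma iter_transfer_mix B phi x y : cone 1 B phi -> SigmaA A x -> SigmaA A y ->
  iter M L phi x <= iter M L phi y * (C * expR (`|B| + M%:R * U)).
Proof.
move=> [p0 cp] Xx Xy.
have pL z : SigmaA A z -> phi z <= iter M L phi y * expR (`|B| + M%:R * U).
  move=> Xz; have [z' [Xz' zz' zM]] := conn (z 0%N) Xy.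
  have ag : agree 1 z z' by move=> [|//] _; rewrite zz'.
  apply: (le_trans (cp _ _ _ Xz Xz' (leqnn 1) ag)).
  rewrite addrC expRD mulrA; apply: ler_pM; rewrite ?expR_ge0 ?(ltW (p0 _ _))//.
    have := @iter_transfer_term _ _ A (fun y => expR (u y)) w_ge0 (expR (- U)) M phi z'.
    rewrite zM -expRM_natl => h.
    have {}h : expR (M%:R * - U) * phi z' <= iter M L phi y.
      apply: h => //; last by move=> ? /p0/ltW.
      by move=> x' /u_bnd; rewrite ler_expR ler_norml => /andP[].
    rewrite -ler_pdivrMr ?expR_gt0// -expRN.
    by rewrite mulrC -mulrN.
  rewrite ler_expR expr1; apply: (le_trans (ler_norm _)); rewrite normrM.
  by rewrite (gtr0_norm a0) ler_piMr// ltW.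
set K := iter M L phi y * expR _ in pL.
have K0 : 0 <= K by rewrite mulr_ge0 ?expR_ge0// iter_transfer_ge0// => ? /p0/ltW.
apply: (@le_trans _ _ (iter M L (fun=> K * 1) x)).
  by apply: ler_iter_transfer => // z /pL; rewrite mulr1.
rewrite iter_transferZ mulrCA -/K mulrC; apply: ler_wpM2r => //; exact: L1_ub.
Qed.

Variable x0 : Sig k.
Hypothesis Xx0 : SigmaA A x0.

Let mixD := C * expR (`|1 + cone_floor| + M%:R * U).

(** Half of the width dominates the constant left after contraction at scales from [1] on and the
    logarithm of the comparison constant of distant points; the term [ln (C / c)] puts the iterates
    of [1] into the cone. *)
Definition cone_width : R := 2 * (1 + cone_floor + `|ln mixD| + `|ln (C / c)|).

Let cC : c <= C. Proof. exact: le_trans (L1_lb 0 Xx0) (L1_ub 0 Xx0). Qed.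

Let C0 : 0 < C. Proof. exact: lt_le_trans cC. Qed.

Let mixD0 : 0 < mixD. Proof. by rewrite mulr_gt0 ?expR_gt0. Qed.

Lemma cone_width_ge0 : 0 <= cone_width.
Proof. by rewrite mulr_ge0// !addr_ge0 ?cone_floor_ge0. Qed.

Lemma geometric_small B e : 0 < e ->
  exists j, forall n, (j <= n)%N -> B * alpha ^+ n <= e.
Proof.
move=> e0; have := @cvg_geometric R B alpha.
rewrite gtr0_norm// => /(_ a1)/cvgrPdist_le/(_ _ e0)[j _ h].
exists j => n jn; have := h n jn; rewrite /= sub0r normrN.
exact/le_trans/ler_norm.
Qed.

(** The first [j0 + 1] steps bring the constant at positive scales down to [1 + cone_floor], and the
    last [M] steps make values at arbitrary points comparable. *)
Lemma cone_contract : exists N, (0 < N)%N /\ forall phi, cone 0 cone_width phi ->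
  cone 0 (cone_width / 2) (iter N L phi).
Proof.
have w2 : cone_width / 2 = 1 + cone_floor + `|ln mixD| + `|ln (C / c)|.
  by rewrite /cone_width; field.
have [j0 /(_ _ (leqnSn _)) jw] := geometric_small cone_width (ltr01 : 0 < 1).
exists (M + j0.+1)%N; split; first by rewrite addnS.
move=> phi /(cone_weaken (leq0n 1) (lexx _)) cp.
have [n1 n2] : 0 <= `|ln mixD| /\ 0 <= `|ln (C / c)| by [].
have cj := iter_transfer_cone j0.+1 cp.
have cj' : cone 1 (1 + cone_floor) (iter j0.+1 L phi).
  by apply: cone_weaken cj => //; rewrite lerD2r mulrC.
apply: cone_from1.
  apply: cone_weaken (iter_transfer_cone (M + j0.+1) cp) => //; rewrite w2.
  have : alpha ^+ (M + j0.+1) * cone_width <= 1.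
    apply: le_trans jw; rewrite mulrC ler_wpM2l ?cone_width_ge0// exprD.
    by rewrite ler_piMl// exprn_ile1// ltW.
  by lra.
move=> x y Xx Xy; rewrite iterD; apply: (le_trans (iter_transfer_mix cj' Xx Xy)).
apply: ler_wpM2l; first by apply: iter_transfer_ge0 => // z /(cj'.1)/ltW.
rewrite -/mixD -[mixD](lnK (x := _)) ?posrE// ler_expR w2.
have := ler_norm (ln mixD); have := cone_floor_ge0; by lra.
Qed.

Lemma cone_iter1 p : cone 0 cone_width (iter p L (fun=> 1)).
Proof.
have [n1 n2] : 0 <= `|ln mixD| /\ 0 <= `|ln (C / c)| by [].
have f0 := cone_floor_ge0; have w0 := cone_width_ge0.
have h := iter_transfer_cone p (cone_const 1 (lexx 0) ltr01).
apply: cone_from1; first by apply: cone_weaken h => //; rewrite /cone_width; lra.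
move=> x y Xx Xy; apply: (le_trans (L1_ub p Xx)).
rewrite -ler_pdivrMr ?expR_gt0//; apply: le_trans (L1_lb p Xy).
rewrite ler_pdivrMr ?expR_gt0// mulrC -ler_pdivrMr//.
have Cc : 0 < C / c by rewrite divr_gt0.
rewrite -[C / c](lnK (x := _)) ?posrE// ler_expR.
by have := ler_norm (ln (C / c)); rewrite /cone_width; lra.
Qed.

(** With [r = expR cone_width], the multiple of [v] removed in [cone_step] is at least the fraction
    [r^-4 / 3] of [phi]. *)
Definition cone_rate : R := 1 - expR (- (4 * cone_width)) / 3.

Lemma cone_rate01 : 0 < cone_rate < 1.
Proof.
rewrite /cone_rate; set e := expR _.
have e0 : 0 < e by exact: expR_gt0.
have e1 : e <= 1 by rewrite -expR0 ler_expR; have := cone_width_ge0; lra.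
by apply/andP; split; lra.
Qed.

Lemma cone_step N phi v : (forall phi, cone 0 cone_width phi ->
  cone 0 (cone_width / 2) (iter N L phi)) ->
  cone 0 cone_width phi -> cone 0 cone_width v ->
  exists t, [/\ 0 <= t, cone 0 cone_width (iter N L (fun x => phi x - t * v x)) &
    forall x, SigmaA A x ->
      iter N L (fun x => phi x - t * v x) x <= cone_rate * iter N L phi x].
Proof.
move=> HN cp cv; have [p0 cp'] := cp; have [v0 cv'] := cv.
(* Ratios of values of a cone element are at most [r], so [a * v] agrees with [phi] up to the factor
   [r^2]. Hence [3 * t * v <= phi], as [cone_sub] demands, and [phi <= 3 * r^4 * t * v]. *)
pose r := expR cone_width; pose a := phi x0 / v x0; pose t := a / r ^+ 2 / 3.
have r0 : 0 < r by exact: expR_gt0.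
have a_gt0 : 0 < a by rewrite divr_gt0 ?p0 ?v0.
have t0 : 0 <= t by apply: ltW; do 2?apply: divr_gt0 => //; exact: exprn_gt0.
have lin x : iter N L (fun x => phi x - t * v x) x = iter N L phi x - t * iter N L v x.
  rewrite -mulNr addrC -iter_transfer_lin.
  by congr (iter _ _ _ x); apply/funext => z; rewrite addrC mulNr.
have linf : iter N L (fun x => phi x - t * v x) = fun x => iter N L phi x - t * iter N L v x.
  by apply/funext.
have c0' f x y : cone 0 cone_width f -> SigmaA A x -> SigmaA A y -> f x <= f y * r.
  move=> [_ cf] Xx Xy; have := cf 0%N x y Xx Xy isT.
  by rewrite expr0 mulr1; apply => -[].
have av_ub x : SigmaA A x -> a * v x <= r ^+ 2 * phi x.
  move=> Xx; have h1 := c0' _ _ _ cv Xx Xx0; have h2 := c0' _ _ _ cp Xx0 Xx.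
  rewrite /a mulrAC ler_pdivrMr ?v0// expr2.
  apply: (@le_trans _ _ (phi x * r * (v x0 * r))).
    by apply: ler_pM => //; rewrite ltW ?p0 ?v0.
  by rewrite le_eqVlt; apply/orP; left; apply/eqP; ring.
have av_lb x : SigmaA A x -> phi x <= r ^+ 2 * (a * v x).
  move=> Xx; have h1 := c0' _ _ _ cv Xx0 Xx; have h2 := c0' _ _ _ cp Xx Xx0.
  rewrite /a [_ / _ * _]mulrAC mulrA ler_pdivlMr ?v0// expr2.
  apply: (@le_trans _ _ (phi x0 * r * (v x * r))).
    by apply: ler_pM => //; rewrite ltW ?p0 ?v0.
  by rewrite le_eqVlt; apply/orP; left; apply/eqP; ring.
clearbody a; exists t; split => //.
  rewrite linf; apply: cone_sub => //; [exact: cone_width_ge0|exact: HN|exact: HN|].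
  move=> x Xx; rewrite mulrA -iter_transferZ.
  apply: ler_iter_transfer => // y Xy; rewrite /t.
  rewrite (_ : 3 * _ * _ = a * v y / r ^+ 2); last by field; rewrite gt_eqF.
  by rewrite ler_pdivrMr ?exprn_gt0// [leRHS]mulrC av_ub.
move=> x Xx; rewrite -iter_transferZ; apply: ler_iter_transfer => // y Xy.
rewrite /cone_rate mulrBl mul1r lerD2l lerN2.
have -> : expR (- (4 * cone_width)) = (r ^+ 2)^-1 ^+ 2.
  by rewrite -exprVn -exprM /r -expRN -expRM_natl; congr expR; rewrite mulrN.
rewrite (_ : t * v y = (a * v y) * ((r ^+ 2)^-1 / 3)); last by rewrite /t; ring.
rewrite (_ : _ / 3 * phi y = (phi y / r ^+ 2) * ((r ^+ 2)^-1 / 3)); last by ring.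
apply: ler_wpM2r; first by rewrite divr_ge0 ?invr_ge0 ?exprn_ge0// ltW.
by rewrite ler_pdivrMr ?exprn_gt0// [leRHS]mulrC av_lb.
Qed.

(* Birkhoff's contraction argument: after [N] steps a fixed fraction of any cone
   element can be matched by a multiple of [v] while the remainder [psi] stays in
   the cone, so the unmatched part decays geometrically. *)
Theorem cone_contraction : exists N, (0 < N)%N /\ forall phi v,
  cone 0 cone_width phi -> cone 0 cone_width v -> forall m, exists s psi,
  [/\ 0 <= s, cone 0 cone_width psi &
   forall x, SigmaA A x -> iter (m * N) L phi x = s * iter (m * N) L v x + psi x /\
     psi x <= cone_rate ^+ m * iter (m * N) L phi x].
Proof.
have [N [N0 HN]] := cone_contract; exists N; split => // phi v cp cv.
have w0 := cone_width_ge0.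
have cLN m : cone 0 cone_width (iter (m * N) L v).
  elim: m => [//|m IH]; rewrite mulSn iterD.
  by apply: cone_weaken (HN _ IH) => //; lra.
elim=> [|m [s [psi [s0 cpsi IH]]]].
  exists 0, phi; split => // x Xx; rewrite mul0n /= mul0r add0r expr0 mul1r.
  by split.
have [t [t0 ct ht]] := cone_step HN cpsi (cLN m).
exists (s + t), (iter N L (fun x => psi x - t * iter (m * N) L v x)).
have eqL x : SigmaA A x -> iter (m.+1 * N) L phi x =
    s * iter (m.+1 * N) L v x + iter N L psi x.
  move=> Xx; rewrite mulSn !iterD -iter_transfer_lin.
  by apply: eq_iter_transfer; rewrite ?inE// => y /set_mem Xy; rewrite (IH y Xy).1.
split; [exact: addr_ge0|exact: ct|move=> x Xx; split].
  rewrite eqL// mulrDl -addrA; congr (_ + _).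
  rewrite [in t * _]mulSn iterD -iter_transfer_lin.
  by congr (iter N L _ x); apply/funext => y; rewrite addrC subrK.
apply: (le_trans (ht x Xx)); rewrite exprS -mulrA; apply: ler_wpM2l.
  by case/andP: cone_rate01 => /ltW.
rewrite mulSn iterD -iter_transferZ; apply: ler_iter_transfer => // y Xy.
by case: (IH y Xy).
Qed.

End Transfer.
End Cones.

Lemma cauchy_seq_cvg (R : realType) (a : nat -> R) :
  (forall e : R, 0 < e -> exists m, forall n, (m <= n)%N -> `|a n - a m| <= e) ->
  cvgn a.
Proof.
move=> h; apply: cauchy_cvg; apply: cauchy_exP => e e0.
have e2 : 0 < e / 2 by rewrite divr_gt0.
have [m hm] := h _ e2; exists (a m); exists m => // n /= /hm am.
rewrite -ball_normE /= distrC; apply: le_lt_trans am _.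
by rewrite gtr_pMr// invf_lt1 ?ltr0n// ltr1n.
Qed.

(** * The positive eigenfunction of the transfer operator *)

Section Eigenfunction.
Variables (R : realType) (k : nat) (A : 'M[int]_k.+2) (alpha : R).
Hypothesis alpha01 : 0 < alpha < 1.
Variables (u : Sig k -> R) (b U c C : R) (M : nat).
Hypothesis b0 : 0 <= b.
Hypothesis u_hol : forall n x y, SigmaA A x -> SigmaA A y -> agree n x y ->
  `|u x - u y| <= b * alpha ^+ n.
Hypothesis u_bnd : forall x, SigmaA A x -> `|u x| <= U.
Hypothesis conn : connecting A M.
Let L := transfer A (fun y => expR (u y)).
Hypothesis c0 : 0 < c.
Hypothesis L1_lb : forall n x, SigmaA A x -> c <= iter n L (fun=> 1) x.
Hypothesis L1_ub : forall n x, SigmaA A x -> iter n L (fun=> 1) x <= C.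
Variable x0 : Sig k.
Hypothesis Xx0 : SigmaA A x0.

Let W := cone_width alpha b U c C M.
Let th := cone_rate alpha b U c C M.
Let C0 : 0 < C. Proof. exact: lt_le_trans c0 (le_trans (L1_lb 0 Xx0) (L1_ub 0 Xx0)). Qed.
Let L1_gt0 n x : SigmaA A x -> 0 < iter n L (fun=> 1) x.
Proof. by move=> Xx; exact: lt_le_trans (L1_lb n Xx). Qed.
Let w_ge0 x : SigmaA A x -> 0 <= expR (u x). Proof. by move=> _; exact: expR_ge0. Qed.

(** Dividing by the value at [x0] cancels the multiplier [s] of [cone_contraction], which carries no
    convergence information. *)
Definition normalized_iterate n x : R := iter n L (fun=> 1) x / iter n L (fun=> 1) x0.
Let hn := normalized_iterate.

Let hn_bnd n x : SigmaA A x -> c / C <= hn n x <= C / c.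
Proof.
move=> Xx; rewrite /hn /normalized_iterate ler_pdivlMr ?L1_gt0// ler_pdivrMr ?L1_gt0//.
apply/andP; split.
  rewrite mulrAC ler_pdivrMr//; apply: ler_pM; rewrite ?(ltW c0) ?(ltW (L1_gt0 _ _))//.
    exact: L1_lb.
  exact: L1_ub.
rewrite mulrAC ler_pdivlMr//; apply: ler_pM; rewrite ?(ltW c0) ?(ltW (L1_gt0 _ _))//.
  exact: L1_ub.
exact: L1_lb.
Qed.

(** Contraction applied to [L^(n - m N) 1] and [1] gives [L^n 1 = s * L^(m N) 1 + psi] with the same
    [s] at [x] and [x0]. The ratios at times [n] and [m N] therefore differ only through [psi]. *)
Let hn_cauchy : exists N, forall m n x, (m * N <= n)%N -> SigmaA A x ->
  `|hn n x - hn (m * N) x| <= (2 * C ^+ 2 / c ^+ 2) * th ^+ m.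
Proof.
have [N [N0 HN]] := cone_contraction alpha01 b0 u_hol u_bnd conn c0 L1_lb L1_ub Xx0.
have th01 := cone_rate01 alpha01 U c C M b0.
exists N => m n x mn Xx.
have cp := cone_iter1 alpha01 U M b0 u_hol c0 L1_lb L1_ub Xx0.
have [s [psi [s0 [psi0 _] H]]] := HN _ _ (cp (n - m * N)%N) (cp 0%N) m.
have t0 : 0 <= th ^+ m by rewrite exprn_ge0//; case/andP: th01 => /ltW.
have [e1 p1] := H x Xx; have [e2 p2] := H x0 Xx0.
rewrite -!iterD !subnKC// ?addn0 -/L /= -/th in e1 p1 e2 p2.
rewrite /hn /normalized_iterate.
have q1 := psi0 _ Xx; have q2 := psi0 _ Xx0.
have [V1 V2 V3 V4] : [/\ 0 < iter n L (fun=> 1) x0, c <= iter n L (fun=> 1) x0,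
   iter n L (fun=> 1) x <= C & iter n L (fun=> 1) x0 <= C] by split; auto.
have [U1 U2 U3 U4] : [/\ 0 < iter (m * N) L (fun=> 1) x0, c <= iter (m * N) L (fun=> 1) x0,
   iter (m * N) L (fun=> 1) x <= C & iter (m * N) L (fun=> 1) x0 <= C] by split; auto.
have U5 := L1_gt0 (m * N) Xx.
move: (iter n L _ x) (iter n L _ x0) (iter (m * N) L _ x) (iter (m * N) L _ x0)
  e1 p1 e2 p2 V1 V2 V3 V4 U1 U2 U3 U4 U5 => V V0 u1 u0 e1 p1 e2 p2 V1 V2 V3 V4 U1 U2 U3 U4 U5.
move: (psi x) (psi x0) q1 q2 e1 p1 e2 p2 => p q q1 q2 e1 p1 e2 p2.
move: (th ^+ m) t0 p1 p2 => t t0 p1 p2.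
have -> : V / V0 - u1 / u0 = (p * u0 - u1 * q) / (V0 * u0).
  by rewrite e1 e2; field; rewrite -e2 !gt_eqF.
have VU : 0 < V0 * u0 by exact: mulr_gt0.
rewrite normrM normfV (gtr0_norm VU) ler_pdivrMr//.
have pC : p <= t * C by apply: le_trans p1 _; exact: ler_wpM2l.
have qC : q <= t * C by apply: le_trans p2 _; exact: ler_wpM2l.
have b1 : p * u0 <= t * C * C by apply: ler_pM => //; exact: ltW.
have b2 : u1 * q <= C * (t * C) by apply: ler_pM => //; exact: ltW.
have b3 : 0 <= p * u0 by rewrite mulr_ge0 ?ltW.
have b4 : 0 <= u1 * q by rewrite mulr_ge0 ?ltW.
apply: (@le_trans _ _ (2 * C ^+ 2 * t)).
  have e : 2 * C ^+ 2 * t = t * C * C + C * (t * C) by ring.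
  rewrite ler_norml; apply/andP; split; lra.
rewrite [leRHS](_ : _ = 2 * C ^+ 2 * t * (V0 * u0 / c ^+ 2)); last by ring.
apply: ler_peMr; first by rewrite !mulr_ge0// ltW.
rewrite ler_pdivlMr ?exprn_gt0// mul1r expr2.
by apply: ler_pM => //; exact: ltW.
Qed.

Definition eigenfunction x : R := limn (fun n => hn n x).
Let h := eigenfunction.

Let hn_cvg x : SigmaA A x -> hn n x @[n --> \oo] --> h x.
Proof.
move=> Xx; apply: cauchy_seq_cvg => e e0.
have [N HN] := hn_cauchy.
have th01 := cone_rate01 alpha01 U c C M b0.
have [j hj] := geometric_small th01 (2 * C ^+ 2 / c ^+ 2) e0.
by exists (j * N)%N => n jn; apply: le_trans (HN _ _ _ jn Xx) (hj _ (leqnn j)).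
Qed.

Lemma eigenfunction_bnd x : SigmaA A x -> c / C <= h x <= C / c.
Proof.
move=> Xx; apply/andP; split.
  by apply: limr_ge; [exact: hn_cvg|apply: nearW => n; have /andP[] := hn_bnd n Xx].
by apply: limr_le; [exact: hn_cvg|apply: nearW => n; have /andP[] := hn_bnd n Xx].
Qed.

Lemma eigenfunction_cone : cone A alpha 0 W h.
Proof.
split=> [x Xx|n x y Xx Xy _ xy].
  by have /andP[+ _] := eigenfunction_bnd Xx; apply: lt_le_trans; rewrite divr_gt0.
apply: (@ler_cvg_to _ (\oo) _ _ (fun j => hn j x) (fun j => hn j y * expR (W * alpha ^+ n))).
- exact: hn_cvg.
- by apply: cvgMl; exact: hn_cvg.
- apply: nearW => j; rewrite /hn /normalized_iterate mulrAC; apply: ler_wpM2r.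
    by rewrite invr_ge0 ltW// L1_gt0.
  have cp := cone_iter1 alpha01 U M b0 u_hol c0 L1_lb L1_ub Xx0 j.
  exact: cp.2 xy.
Qed.

(** Passing to the limit in [L h_n = (L h_n)(x0) * h_(n+1)] gives [L h = l * h]. The bounds
    [c <= L^n 1 <= C] keep all powers [l^n] between two positive constants, so [l = 1]. *)
Lemma transfer_eigenfunction x : SigmaA A x -> L h x = h x.
Proof.
have Lhn n y : L (hn n) y = iter n.+1 L (fun=> 1) y / iter n L (fun=> 1) x0.
  rewrite [RHS]mulrC -(@iter_transferZ _ _ _ _ 1); congr (transfer _ _ _ _).
  by apply/funext => z; rewrite mulrC.
have Lh y : SigmaA A y -> L (hn n) y @[n --> \oo] --> L h y.
  move=> Xy; apply: cvg_big; first exact: add_continuous.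
  by move=> a aA; apply: cvgMr; apply: hn_cvg; exact: SigmaA_consE.
pose l := L h x0.
have Lhl y : SigmaA A y -> L h y = l * h y.
  move=> Xy; apply: (@cvg_unique _ (@Rhausdorff R) (L (hn n) y @[n --> \oo])).
    exact: Lh.
  have -> : (fun n => L (hn n) y) = (fun n => L (hn n) x0 * hn n.+1 y).
    apply/funext => n; rewrite !Lhn /hn /normalized_iterate.
    by field; rewrite !gt_eqF// L1_gt0.
  apply: (@cvgM _ _ _ _ (fun n => L (hn n) x0) (fun n => hn n.+1 y)); first exact: Lh.
  by rewrite (cvg_shiftS (fun n => hn n y)); exact: hn_cvg.
have itL n y : SigmaA A y -> iter n L h y = l ^+ n * h y.
  elim: n y => [|n IH] y Xy; first by rewrite expr0 mul1r.
  rewrite iterS {1}/L (@eq_transfer _ _ _ _ _ (fun y => l ^+ n * h y)) ?inE//; last first.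
    by move=> z /set_mem; exact: IH.
  have -> : transfer A (fun y => expR (u y)) (fun y => l ^+ n * h y) y = l ^+ n * L h y.
    exact: (@iter_transferZ _ _ _ _ 1).
  by rewrite Lhl// exprS; ring.
have cC : 0 < c / C by rewrite divr_gt0.
have Cc : 0 < C / c by rewrite divr_gt0.
have hl n : c / C * c / (C / c) <= l ^+ n <= C / c * C / (c / C).
  have h0 := itL n x0 Xx0.
  have /andP[h1 h2] := eigenfunction_bnd Xx0.
  have h3 : c / C * c <= iter n L h x0.
    apply: (@le_trans _ _ (iter n L (fun=> c / C * 1) x0)).
      by rewrite iter_transferZ ler_pM2l//; exact: L1_lb.
    by apply: ler_iter_transfer => // z /eigenfunction_bnd/andP[]; rewrite mulr1.
  have h4 : iter n L h x0 <= C / c * C.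
    apply: (@le_trans _ _ (iter n L (fun=> C / c * 1) x0)).
      by apply: ler_iter_transfer => // z /eigenfunction_bnd/andP[]; rewrite mulr1.
    by rewrite iter_transferZ ler_pM2l//; exact: L1_ub.
  have hx0 : 0 < h x0 by exact: lt_le_trans h1.
  have -> : l ^+ n = iter n L h x0 / h x0 by rewrite h0 mulfK// gt_eqF.
  apply/andP; split.
    apply: ler_pM => //; [|by rewrite invr_ge0 ltW|by rewrite lef_pV2 ?posrE].
    by apply: mulr_ge0; exact: ltW.
  apply: ler_pM => //; [|by rewrite invr_ge0 ltW|by rewrite lef_pV2 ?posrE].
  by apply: le_trans h3; apply: mulr_ge0; exact: ltW.
have d1 : 0 < c / C * c / (C / c) by apply: divr_gt0 => //; exact: mulr_gt0.
have l0 : 0 < l by have /andP[+ _] := hl 1%N; rewrite expr1; exact: lt_le_trans.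
suff l1 : l = 1 by move=> Xx; rewrite Lhl// l1 mul1r.
apply/eqP; rewrite eq_le; apply/andP; split; rewrite leNgt; apply/negP => lt1.
  have l01 : 0 < l^-1 < 1 by rewrite invr_gt0 l0 invf_lt1.
  have := geometric_small l01 (C / c * C / (c / C)).
  move=> /(_ (1 / 2))[|j /(_ _ (leqnn j))]; first by rewrite divr_gt0.
  rewrite exprVn ler_pdivrMr ?exprn_gt0// => hj.
  have /andP[_ h2] := hl j.
  have : 0 < l ^+ j by rewrite exprn_gt0.
  lra.
have l01 : 0 < l < 1 by rewrite l0.
have := geometric_small l01 1.
move=> /(_ (c / C * c / (C / c) / 2))[|j /(_ _ (leqnn j))]; first by rewrite divr_gt0.
by have /andP[h1 _] := hl j; lra.
Qed.
End Eigenfunction.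

(** * Hölder functions and exponential mixing of a normalized operator *)

Section HolderNorm.
Variables (R : realType) (k : nat) (A : 'M[int]_k.+2) (alpha : R).
Hypothesis alpha01 : 0 < alpha < 1.
Implicit Types (phi psi : Sig k -> R) (x y z : Sig k) (H : R).

Let a0 : 0 < alpha. Proof. by case/andP: alpha01. Qed.
Let a1 : alpha < 1. Proof. by case/andP: alpha01. Qed.
Let an0 n : 0 <= alpha ^+ n. Proof. by rewrite exprn_ge0// ltW. Qed.

Definition hnorm H phi := (forall x, SigmaA A x -> `|phi x| <= H) /\
  forall n x y, SigmaA A x -> SigmaA A y -> agree n x y ->
    `|phi x - phi y| <= H * alpha ^+ n.

Lemma hnorm_weaken H H' phi : H <= H' -> hnorm H phi -> hnorm H' phi.
Proof.
move=> HH [b c]; split => [x /b h|n x y Xx Xy /(c _ _ _ Xx Xy) h]; apply: le_trans h _ => //.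
exact: ler_wpM2r.
Qed.

Lemma eq_hnorm H phi psi : {in SigmaA A, phi =1 psi} -> hnorm H phi -> hnorm H psi.
Proof.
move=> e [b c]; split => [x Xx|n x y Xx Xy]; rewrite -?e ?inE//; [exact: b|exact: c].
Qed.

Lemma hnorm_cst c : hnorm `|c| (fun=> c).
Proof. by split => // n x y _ _ _; rewrite subrr normr0 mulr_ge0. Qed.

Lemma hnormD H H' phi psi : hnorm H phi -> hnorm H' psi ->
  hnorm (H + H') (fun x => phi x + psi x).
Proof.
move=> [b c] [b' c']; split => [x Xx|n x y Xx Xy xy].
  by apply: (le_trans (ler_normD _ _)); apply: lerD; [exact: b|exact: b'].
rewrite opprD addrACA mulrDl; apply: (le_trans (ler_normD _ _)).
by apply: lerD; [exact: c|exact: c'].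
Qed.

Lemma hnormZ H c phi : hnorm H phi -> hnorm (`|c| * H) (fun x => c * phi x).
Proof.
move=> [b h]; split => [x Xx|n x y Xx Xy xy]; rewrite -?mulrBr normrM.
  by apply: ler_wpM2l => //; exact: b.
by rewrite -mulrA; apply: ler_wpM2l => //; exact: h.
Qed.

Lemma hnormN H phi : hnorm H phi -> hnorm H (fun x => - phi x).
Proof.
move=> /(hnormZ (-1)); rewrite normrN1 mul1r; apply: eq_hnorm => x _.
by rewrite mulN1r.
Qed.

Lemma hnormM H H' phi psi : 0 <= H -> 0 <= H' -> hnorm H phi -> hnorm H' psi ->
  hnorm (2 * H * H') (fun x => phi x * psi x).
Proof.
move=> H0 H0' [b c] [b' c']; split => [x Xx|n x y Xx Xy xy].
  rewrite normrM; apply: (@le_trans _ _ (H * H')).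
    by apply: ler_pM => //; [exact: b|exact: b'].
  by rewrite -mulrA ler_peMl ?mulr_ge0// ler1n.
have -> : phi x * psi x - phi y * psi y = phi x * (psi x - psi y) + (phi x - phi y) * psi y.
  by ring.
rewrite (_ : 2 * H * H' * _ = H * (H' * alpha ^+ n) + (H * alpha ^+ n) * H'); last by ring.
apply: (le_trans (ler_normD _ _)); rewrite !normrM; apply: lerD; apply: ler_pM => //.
- exact: b.
- exact: c'.
- exact: c.
- exact: b'.
Qed.

Lemma hnorm_shift n H phi : 0 <= H -> hnorm H phi ->
  hnorm (H / alpha ^+ n) (fun x => phi (iter n (@shift k) x)).
Proof.
move=> H0 [b c]; split => [x Xx|m x y Xx Xy xy].
  apply: (le_trans (b _ (SigmaA_shift n Xx))); rewrite ler_peMr//.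
  by rewrite invf_ge1 ?exprn_gt0// exprn_ile1// ltW.
case: (leqP n m) => nm.
  apply: (le_trans (c (m - n)%N _ _ (SigmaA_shift n Xx) (SigmaA_shift n Xy) _)).
    by apply: agree_shift; rewrite subnKC.
  by rewrite -{2}(subnKC nm) exprD -mulrA ler_wpM2l// mulKf// expf_neq0// gt_eqF.
apply: (le_trans (c 0%N _ _ (SigmaA_shift n Xx) (SigmaA_shift n Xy) _)) => //.
rewrite expr0 -mulrA ler_wpM2l// mulrC ler_pdivlMr ?exprn_gt0// mul1r.
by rewrite -(subnKC (ltnW nm)) exprD ler_piMr// exprn_ile1// ltW.
Qed.

Lemma hnorm_expR H phi : 0 <= H -> hnorm H phi ->
  hnorm (expR H * (1 + H)) (fun x => expR (phi x)).
Proof.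
move=> H0 [b c].
have eb x : SigmaA A x -> expR (phi x) <= expR H.
  by move=> /b; rewrite ler_expR ler_norml => /andP[].
split => [x Xx|].
  rewrite gtr0_norm ?expR_gt0//; apply: (le_trans (eb _ Xx)).
  by rewrite ler_peMr ?expR_ge0// lerDl.
have half n x y : SigmaA A x -> SigmaA A y -> agree n x y ->
    expR (phi x) - expR (phi y) <= expR H * (1 + H) * alpha ^+ n.
  move=> Xx Xy xy.
  have h1 : 1 - (phi x - phi y) <= expR (- (phi x - phi y)) by exact: expR_ge1Dx.
  have e : expR (phi x) - expR (phi y) = expR (phi x) * (1 - expR (- (phi x - phi y))).
    by rewrite mulrBr mulr1 -expRD; congr (_ - expR _); ring.
  rewrite e -mulrA; apply: (@le_trans _ _ (expR (phi x) * (H * alpha ^+ n))).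
    apply: ler_wpM2l; first exact: expR_ge0.
    by have := c n x y Xx Xy xy; rewrite ler_norml => /andP[_]; lra.
  apply: ler_pM; rewrite ?expR_ge0 ?mulr_ge0//; first exact: eb.
  by rewrite ler_wpM2r// lerDr.
move=> n x y Xx Xy xy; rewrite ler_norml half// andbT lerNl opprB half//.
exact: agree_sym.
Qed.

(** In a cone of fixed width a bound on the values also controls the Hölder constant, so a uniformly
    small remainder is small in Hölder norm. *)
Lemma cone_hnorm B t psi : 0 <= B -> (forall x, SigmaA A x -> psi x <= t) ->
  cone A alpha 0 B psi -> hnorm (t * (1 + B * expR B)) psi.
Proof.
move=> B0 pt [p0 c].
have c1 : 1 <= 1 + B * expR B by rewrite lerDl mulr_ge0 ?expR_ge0.
split => [x Xx|].
  have t0 : 0 <= t by rewrite (le_trans (ltW (p0 _ Xx)))// pt.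
  by rewrite gtr0_norm ?p0//; apply: (le_trans (pt _ Xx)); rewrite ler_peMr.
have half n x y : SigmaA A x -> SigmaA A y -> agree n x y ->
    psi x - psi y <= t * (1 + B * expR B) * alpha ^+ n.
  move=> Xx Xy xy; have h := c n x y Xx Xy isT xy.
  have t0 : 0 <= t by rewrite (le_trans (ltW (p0 _ Xx)))// pt.
  set s := B * alpha ^+ n in h.
  have s0 : 0 <= s by rewrite mulr_ge0.
  have sB : s <= B by rewrite ler_piMr// exprn_ile1// ltW.
  have h1 : 1 - s <= expR (- s) by exact: expR_ge1Dx.
  have h2 : expR s - 1 <= s * expR B.
    have h3 : expR s - 1 = expR s * (1 - expR (- s)) by rewrite mulrBr mulr1 -expRD subrr expR0.
    rewrite h3 mulrC; apply: ler_pM; rewrite ?expR_ge0 ?ler_expR//; last by lra.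
    by rewrite subr_ge0 -expR0 ler_expR oppr_le0.
  apply: (@le_trans _ _ (psi y * (s * expR B))).
    by have := ler_wpM2l (ltW (p0 _ Xy)) h2; lra.
  apply: (@le_trans _ _ (t * (s * expR B))).
    by apply: ler_wpM2r; [rewrite mulr_ge0 ?expR_ge0|exact: pt].
  rewrite -mulrA; apply: ler_wpM2l => //; rewrite mulrDl mul1r /s.
  by rewrite [B * _ * _]mulrAC lerDr.
move=> n x y Xx Xy xy; rewrite ler_norml half// andbT lerNl opprB half//.
exact: agree_sym.
Qed.

(** After adding [2 * H] the function is at least [H], so its variation [H * alpha ^+ n] becomes a
    relative one. This brings signed functions into the reach of cone contraction. *)
Lemma hnorm_cone B H phi : 1 <= B -> 0 < H -> hnorm H phi ->
  cone A alpha 0 B (fun x => phi x + 2 * H).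
Proof.
move=> B1 H0 [b c]; have lo x : SigmaA A x -> H <= phi x + 2 * H.
  by move=> /b; rewrite ler_norml => /andP[]; lra.
split => [x /lo|n x y Xx Xy _ xy]; first exact: lt_le_trans.
have := c n x y Xx Xy xy; rewrite ler_norml => /andP[_ h].
have h1 : 1 + B * alpha ^+ n <= expR (B * alpha ^+ n) by exact: expR_ge1Dx.
apply: (@le_trans _ _ ((phi y + 2 * H) * (1 + B * alpha ^+ n))); last first.
  by apply: ler_wpM2l => //; apply: le_trans (lo _ Xy); exact: ltW.
rewrite mulrDr mulr1 -lerBlDl; apply: (@le_trans _ _ (H * alpha ^+ n)); first by lra.
rewrite mulrA; apply: ler_wpM2r => //.
by apply: (@le_trans _ _ (H * B)); [rewrite ler_peMr// ltW|apply: ler_wpM2r; [lra|exact: lo]].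
Qed.
End HolderNorm.

Lemma bernoulli_ge (R : realType) (x : R) n : 0 <= x <= 1 -> 1 - n%:R * x <= (1 - x) ^+ n.
Proof.
move=> /andP[x0 x1]; elim: n => [|n IH]; first by rewrite mul0r subr0 expr0.
rewrite exprS; apply: (@le_trans _ _ ((1 - x) * (1 - n%:R * x))).
  rewrite -natr1; have : 0 <= n%:R * x * x by rewrite !mulr_ge0.
  lra.
by apply: ler_wpM2l => //; lra.
Qed.

Section Mixing.
Variables (R : realType) (k : nat) (A : 'M[int]_k.+2) (alpha : R).
Hypothesis alpha01 : 0 < alpha < 1.
Variables (u : Sig k -> R) (b U : R) (M : nat).
Hypothesis b0 : 0 <= b.
Hypothesis u_hol : forall n x y, SigmaA A x -> SigmaA A y -> agree n x y ->
  `|u x - u y| <= b * alpha ^+ n.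
Hypothesis u_bnd : forall x, SigmaA A x -> `|u x| <= U.
Hypothesis conn : connecting A M.
Let P := transfer A (fun y => expR (u y)).
Hypothesis P1 : forall x, SigmaA A x -> P (fun=> 1) x = 1.
Variable x0 : Sig k.
Hypothesis Xx0 : SigmaA A x0.

Let w_ge0 x : SigmaA A x -> 0 <= expR (u x). Proof. by move=> _; exact: expR_ge0. Qed.

Lemma iter_transfer1 n x : SigmaA A x -> iter n P (fun=> 1) x = 1.
Proof.
elim: n x => // n IH x Xx; rewrite iterS -[RHS](P1 Xx).
by apply: eq_transfer; rewrite ?inE// => y /set_mem/IH.
Qed.

Lemma iter_transfer_cst n c x : SigmaA A x -> iter n P (fun=> c) x = c.
Proof.
move=> Xx; rewrite (_ : (fun=> c) = (fun=> c * 1)); last by apply/funext => y; rewrite mulr1.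
by rewrite iter_transferZ iter_transfer1// mulr1.
Qed.

Lemma iter_transferDc n c phi x : SigmaA A x ->
  iter n P (fun y => phi y + c) x = iter n P phi x + c.
Proof.
move=> Xx; rewrite -{2}(@iter_transfer_cst n c x)// -[in RHS](mul1r (iter n P phi x)).
by rewrite -iter_transfer_lin; congr (iter n P _ x); apply/funext => y; rewrite mul1r.
Qed.

Lemma iter_transfer_le n phi t x : (forall y, SigmaA A y -> phi y <= t) ->
  SigmaA A x -> iter n P phi x <= t.
Proof. by move=> h Xx; rewrite -(@iter_transfer_cst n t x)//; exact: ler_iter_transfer. Qed.

Lemma iter_transfer_ge n phi t x : (forall y, SigmaA A y -> t <= phi y) ->
  SigmaA A x -> t <= iter n P phi x.
Proof. by move=> h Xx; rewrite -(@iter_transfer_cst n t x)//; exact: ler_iter_transfer. Qed.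

Let lb1 n x : SigmaA A x -> 1 <= iter n P (fun=> 1) x.
Proof. by move=> Xx; rewrite iter_transfer1. Qed.
Let ub1 n x : SigmaA A x -> iter n P (fun=> 1) x <= 1.
Proof. by move=> Xx; rewrite iter_transfer1. Qed.

(** As [P] averages, it does not increase the ratio of the extreme values of [phi], so the new
    constant does not depend on [r]. *)
Lemma iter_transfer_cone_prob B r phi : 0 <= B -> cone A alpha 0 B phi ->
  cone A alpha 0 (B + cone_floor alpha b) (iter r P phi).
Proof.
have f0 := cone_floor_ge0 alpha01 b0.
move=> B0 cp; apply: cone_from1.
  apply: cone_weaken (iter_transfer_cone alpha01 b0 u_hol ltr01 lb1 r
    (cone_weaken alpha01 (leq0n 1) (lexx B) cp)) => //.
  by rewrite lerD2r ler_piMl// exprn_ile1//; case/andP: alpha01 => /ltW h /ltW.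
move=> x y Xx Xy; apply: (@le_trans _ _ (iter r P phi y * expR B)); last first.
  apply: ler_wpM2l; last by rewrite ler_expR lerDl.
  by apply: iter_transfer_ge0 => // z /(cp.1)/ltW.
apply: iter_transfer_le => // z Xz; rewrite -ler_pdivrMr ?expR_gt0//.
apply: iter_transfer_ge => // z' Xz'; rewrite ler_pdivrMr ?expR_gt0//.
by have := cp.2 0%N z z' Xz Xz' isT; rewrite expr0 mulr1; apply => -[].
Qed.

(** Cone contraction is applied to [phi + 2 * H] with the fixed function [1] as reference: after
    [m N] steps the iterate is a constant plus a cone element of size [3 * H * t^m]. *)
Theorem transfer_mixing : exists K th : R, [/\ 0 < K, 0 < th < 1 &
  forall H phi, 0 < H -> hnorm A alpha H phi -> exists c, forall n,
    hnorm A alpha (K * H * th ^+ n) (fun x => iter n P phi x - c)].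
Proof.
have [N [N0 HN]] := cone_contraction alpha01 b0 u_hol u_bnd conn ltr01 lb1 ub1 Xx0.
set W := cone_width _ _ _ _ _ _ in HN; set t := cone_rate _ _ _ _ _ _ in HN.
have t01 : 0 < t < 1 := cone_rate01 alpha01 U 1 1 M b0.
have W1 : 1 <= W.
  have f0 := cone_floor_ge0 alpha01 b0.
  rewrite /W /cone_width; apply: (@le_trans _ _ (2 * (1 + cone_floor alpha b))); first by lra.
  by rewrite ler_pM2l// -addrA lerDl addr_ge0.
have f0 := cone_floor_ge0 alpha01 b0.
pose W' := W + cone_floor alpha b.
pose K0 := 3 * (1 + W' * expR W').
have W'0 : 0 <= W' by rewrite addr_ge0//; lra.
have K00 : 0 < K0 by rewrite mulr_gt0// ltr_pwDl// mulr_ge0 ?expR_ge0.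
have main H phi m r : 0 < H -> hnorm A alpha H phi -> exists s,
    hnorm A alpha (K0 * H * t ^+ m) (fun x => iter (m * N + r) P phi x - s).
  move=> H0 hp.
  have W0 : 0 < W by lra.
  have [s [psi [s0 cpsi HH]]] := HN _ _ (hnorm_cone alpha01 W1 H0 hp)
    (cone_const A alpha01 0 (ltW W0) ltr01) m.
  exists (s - 2 * H).
  have psib x : SigmaA A x -> psi x <= 3 * H * t ^+ m.
    move=> Xx; have [_ h] := HH x Xx; apply: (le_trans h); rewrite mulrC.
    apply: ler_wpM2r; first by rewrite exprn_ge0//; case/andP: t01 => /ltW.
    by apply: iter_transfer_le => // y /hp.1; rewrite ler_norml => /andP[_]; lra.
  have W0' : 0 <= W by lra.
  have := cone_hnorm alpha01 W'0 _ (iter_transfer_cone_prob r W0' cpsi).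
  move=> /(_ (3 * H * t ^+ m))[|hb hh].
    by move=> x Xx; apply: iter_transfer_le.
  rewrite (_ : K0 * H * _ = 3 * H * t ^+ m * (1 + W' * expR W')); last by rewrite /K0; ring.
  apply: (@eq_hnorm _ _ _ _ _ (iter r P psi)); last by split.
  move=> x /set_mem Xx; rewrite addnC iterD.
  have e y : SigmaA A y -> psi y = iter (m * N) P phi y + (2 * H - s).
    move=> Xy; have [] := HH y Xy; rewrite iter_transferDc// iter_transfer1//.
    by move=> + _; lra.
  rewrite (@eq_iter_transfer _ _ _ _ r psi (fun y => iter (m * N) P phi y + (2 * H - s))) ?inE//.
    by rewrite iter_transferDc//; ring.
  by move=> y /set_mem; exact: e.
(* By Bernoulli's inequality [th^N >= t], so the rate per block of [N] steps becomes a rate per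
   step. *)
pose th := 1 - (1 - t) / N%:R.
have NR : 0 < N%:R :> R by rewrite ltr0n.
have N1 : 1 <= N%:R :> R by rewrite ler1n.
have d0 : 0 < (1 - t) / N%:R by rewrite divr_gt0//; case/andP: t01; lra.
have d1 : (1 - t) / N%:R < 1 by rewrite ltr_pdivrMr//; case/andP: t01; lra.
have th01 : 0 < th < 1 by rewrite /th; apply/andP; split; lra.
have [th0 th1] := andP th01.
have tth m r : (r < N)%N -> t ^+ m <= th ^- N * th ^+ (m * N + r).
  move=> rN; rewrite mulrC ler_pdivlMr ?exprn_gt0//.
  apply: (@le_trans _ _ (th ^+ (m * N) * th ^+ N)).
    rewrite ler_wpM2r ?exprn_ge0 ?(ltW th0)// mulnC exprM lerXn2r ?nnegrE ?exprn_ge0 ?(ltW th0)//.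
      by case/andP: t01 => /ltW.
    have := @bernoulli_ge R ((1 - t) / N%:R) N; rewrite -/th mulrCA divff ?gt_eqF// mulr1.
    by rewrite (ltW d0) (ltW d1) => /(_ isT); lra.
  rewrite exprD; apply: ler_wpM2l; first by rewrite exprn_ge0// ltW.
  by apply: ler_wiXn2l; rewrite ?(ltW th0) ?(ltW th1)// ltnW.
clearbody K0 th.
exists (2 * K0 * th ^- N), th; split => //; first by apply: mulr_gt0; [exact: mulr_gt0|rewrite invr_gt0 exprn_gt0].
move=> H phi H0 hp; exists (limn (fun n => iter n P phi x0)) => n.
have cv : cvgn (fun n => iter n P phi x0).
  apply: cauchy_seq_cvg => e e0.
  have [j hj] := geometric_small t01 (2 * K0 * H) e0.
  have [s hs] := main H phi j 0%N H0 hp; exists (j * N)%N => l jl.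
  have [s' hs'] := main H phi j 0%N H0 hp.
  have hb l' : (j * N <= l')%N -> `|iter l' P phi x0 - s| <= K0 * H * t ^+ j.
    move=> jl'; rewrite -(subnK jl') iterD -iter_transferDc//; rewrite ler_norml.
    rewrite addn0 in hs.
    apply/andP; split; [apply: iter_transfer_ge|apply: iter_transfer_le] => // y /(hs.1);
      by rewrite ler_norml => /andP[].
  have h1 := hb _ jl; have h2 := hb _ (leqnn (j * N)%N).
  apply: le_trans (hj _ (leqnn j)).
  move: h1 h2; rewrite !ler_norml => /andP[h1 h2] /andP[h3 h4].
  by apply/andP; split; lra.
set c := limn _.
pose m := (n %/ N)%N; pose r := (n %% N)%N.
have nE : n = (m * N + r)%N by exact: divn_eq.
have rN : (r < N)%N by exact: ltn_pmod.
have [s hs] := main H phi m r H0 hp.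
have K1 : K0 * H * t ^+ m <= K0 * H * (th ^- N * th ^+ n).
  apply: ler_wpM2l; first by apply: ltW; exact: mulr_gt0.
  by have := tth m r rN; rewrite -nE.
have sc : `|s - c| <= K0 * H * t ^+ m.
  have hb l : (n <= l)%N -> `|iter l P phi x0 - s| <= K0 * H * t ^+ m.
    move=> jl'; rewrite -(subnK jl') iterD -iter_transferDc//; rewrite ler_norml.
    rewrite -nE in hs.
    apply/andP; split; [apply: iter_transfer_ge|apply: iter_transfer_le] => // y /(hs.1);
      by rewrite ler_norml => /andP[].
  rewrite ler_norml; apply/andP; split.
    rewrite lerNl opprB lerBlDr; apply: limr_le => //; near=> l.
    have : (n <= l)%N by near: l; exact: nbhs_infty_ge.
    by move=> /hb; rewrite ler_norml => /andP[_]; lra.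
  rewrite lerBlDr -lerBlDl; apply: limr_ge => //; near=> l.
  have : (n <= l)%N by near: l; exact: nbhs_infty_ge.
  by move=> /hb; rewrite ler_norml => /andP[+ _]; lra.
have hh := hnormD hs (hnorm_cst A alpha01 (s - c)).
rewrite -nE in hh.
apply: (@eq_hnorm _ _ _ _ _ (fun x => iter n P phi x - s + (s - c))).
  by move=> x _ /=; rewrite addrA subrK.
apply: hnorm_weaken hh => //.
by rewrite (_ : 2 * K0 * _ * _ * _ = K0 * H * (th ^- N * th ^+ n) + K0 * H * (th ^- N * th ^+ n));
  [apply: lerD => //; exact: le_trans sc K1|ring].
Unshelve. all: by end_near. Qed.
End Mixing.

Section Integral.
Variables (R : realType) (k : nat) (A : 'M[int]_k.+2) (mu : probability (Sig k) R).
Variable alpha : R.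
Hypothesis alpha01 : 0 < alpha < 1.
Hypothesis muX : mu (SigmaA A) = 1%E.
Hypothesis mu_inv : forall E : set (Sig k), measurable E -> mu (@shift k @^-1` E) = mu E.
Implicit Types (phi psi : Sig k -> R) (x y z : Sig k) (H : R) (E : set (Sig k)).
Let X := SigmaA A.
Let mX : measurable X. Proof. exact: measurable_SigmaA. Qed.
Local Notation I := (integral_on A mu).

Lemma hnorm_measurable H phi : hnorm A alpha H phi -> measurable_fun X phi.
Proof.
move=> [_ c] _; apply: (measurability _ (measurable_realfun.RGenOInfty.measurableE R)) => // _ [_ [a ->] <-].
rewrite ?setIid.
(* The points whose whole [n]-cylinder lies in the superlevel set; by continuity of [phi] these sets
   exhaust it. *)
pose E n := [set x | X x /\ forall y, X y -> agree n x y -> a < phi y].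
have dE n : determined A n (E n).
  split => [x []//|x y Xy xy [Xx h]]; split => // z Xz yz.
  exact/h/(agree_trans xy yz).
suff -> : X `&` phi @^-1` [set` `]a, +oo[] = \bigcup_n E n.
  by apply: bigcupT_measurable => n; exact: measurable_determined (dE n).
apply/seteqP; split => [x [Xx]|x [n _ [Xx h]]]; last first.
  by split => //=; rewrite in_itv/= andbT; exact: h.
rewrite /= in_itv/= andbT => ax.
have [||n /(_ n (leqnn n)) hn] := @geometric_small R alpha _ H ((phi x - a) / 2) => //.
  by rewrite divr_gt0// subr_gt0.
exists n => //; split => // y Xy xy.
by have := c n x y Xx Xy xy; rewrite ler_norml => /andP[_]; lra.
Qed.

Lemma hnorm_integrable H phi E : hnorm A alpha H phi -> measurable E -> E `<=` X ->
  mu.-integrable E (EFin \o phi).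
Proof.
move=> hp mE EX; apply: measurable_bounded_integrable => //.
- by rewrite (le_lt_trans (probability_le1 mu mE))// ltry.
- by apply: measurable_funS (hnorm_measurable hp).
- exists H; split; first exact: num_real.
  by move=> t Ht x /EX Xx; apply: le_trans (hp.1 x Xx) (ltW Ht).
Qed.

Lemma integral_linear H H' c phi psi : hnorm A alpha H phi -> hnorm A alpha H' psi ->
  I (fun x => c * phi x + psi x) = c * I phi + I psi.
Proof.
move=> hp hq; have ip := hnorm_integrable hp mX (@subset_refl _ _).
have iq := hnorm_integrable hq mX (@subset_refl _ _).
have hcp := hnorm_integrable (hnormZ c hp) mX (@subset_refl _ _).
by rewrite /integral_on -!/(Rintegral _ _ _) RintegralD// RintegralZl.
Qed.

Lemma integral_cst c : I (fun=> c) = c.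
Proof.
have -> : I (fun=> c) = c * fine (mu (SigmaA A)) by exact: Rintegral_cst.
by rewrite muX mulr1.
Qed.

Lemma le_integral_on H H' phi psi : hnorm A alpha H phi -> hnorm A alpha H' psi ->
  (forall x, X x -> phi x <= psi x) -> I phi <= I psi.
Proof.
move=> hp hq le; apply: le_Rintegral => //; first exact: hnorm_integrable hp _ _.
exact: hnorm_integrable hq _ _.
Qed.

Lemma eq_integral_on phi psi : {in X, phi =1 psi} -> I phi = I psi.
Proof. exact: eq_Rintegral. Qed.

Lemma integralD H H' phi psi : hnorm A alpha H phi -> hnorm A alpha H' psi ->
  I (fun x => phi x + psi x) = I phi + I psi.
Proof.
move=> hp hq; rewrite -[I phi]mul1r -(integral_linear 1 hp hq).
by apply: eq_integral_on => x _; rewrite mul1r.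
Qed.

Lemma integralDc H phi c : hnorm A alpha H phi -> I (fun x => phi x + c) = I phi + c.
Proof. by move=> hp; rewrite (integralD hp (hnorm_cst A alpha01 c)) integral_cst. Qed.

Lemma integralZ H phi c : hnorm A alpha H phi -> I (fun x => c * phi x) = c * I phi.
Proof.
move=> hp; rewrite -[RHS]addr0 -[X in _ + X](integral_cst 0).
rewrite -(integral_linear c hp (hnorm_cst A alpha01 0)).
by apply: eq_integral_on => x _; rewrite addr0.
Qed.

Lemma integral_shift H phi : hnorm A alpha H phi -> I (fun x => phi (shift x)) = I phi.
Proof.
move=> hp.
have H0 : 0 <= H.
  have [x Xx] : exists x, X x.
    apply: contrapT => /forallNP h; have X0 : X = set0 by apply/seteqP; split => // x /h.
    by move: muX; rewrite -/X X0 measure0 => /eqP; rewrite eqe eq_sym oner_eq0.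
  by apply: le_trans (hp.1 x Xx).
(* Adding [H] makes the integrand nonnegative, as the change of variables for image measures
   requires. *)
have hq := hnormD hp (hnorm_cst A alpha01 H).
have hqs := hnorm_shift alpha01 1 (addr_ge0 H0 (normr_ge0 H)) hq.
have hps := hnorm_shift alpha01 1 H0 hp.
suff : I (fun x => phi (shift x) + H) = I (fun x => phi x + H).
  by rewrite (integralDc _ hps) (integralDc _ hp) => /addIr.
rewrite /integral_on; congr fine.
pose g := EFin \o (fun y => phi y + H).
have /measurable_realfun.measurable_EFinP mg := hnorm_measurable hq.
have g0 y : X y -> (0 <= g y)%E.
  by move=> /hp.1; rewrite lee_fin ler_norml => /andP[]; lra.
have mS := @measurable_shift k.
transitivity (\int[pushforward mu (@shift k)]_(y in X) g y)%E; last first.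
  by apply: eq_measure_integral => E mE _; exact: mu_inv.
rewrite ge0_integral_pushforward//; last by move=> y /set_mem; exact: g0.
have mSX : measurable (@shift k @^-1` X) by rewrite -[X in measurable X]setTI; exact: mS.
have XS : X `<=` @shift k @^-1` X by move=> x; exact: (SigmaA_shift 1).
(* [X] is only contained in its preimage under the shift; the difference is null by invariance. *)
rewrite [RHS](@ge0_negligible_integral _ _ _ _ _ (@shift k @^-1` X `\` X)).
- by rewrite setDD setIC (setIidl XS).
- exact: measurableD.
- by [].
- by apply: (measurable_comp mX _ mg); [move=> _ [x Sx <-]|exact: measurable_funS mS].
- by move=> x; exact: g0.
- rewrite measureD// ?(le_lt_trans (probability_le1 mu mSX)) ?ltry//.
  rewrite setIC (setIidl XS); transitivity (mu (@shift k @^-1` X) - mu (SigmaA A))%E => //.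
  by rewrite mu_inv// muX subee.
Qed.

Lemma integral_split H phi l E : hnorm A alpha H phi -> measurable E -> E `<=` X ->
  \int[mu]_(x in E) phi x =
  \sum_(a : alph k) \int[mu]_(x in E `&` [set x | x l = a]) phi x.
Proof.
move=> hp mE EX; have mEa (a : alph k) : measurable (E `&` [set x : Sig k | x l = a]).
  by apply: measurableI => //; exact: measurable_coord.
have ip := hnorm_integrable hp.
have finE F : measurable F -> F `<=` X -> (\int[mu]_(x in F) (phi x)%:E)%E \is a fin_num.
  by move=> mF FX; exact: integrable_fin_num mF _ (ip _ mF FX).
rewrite /Rintegral; apply: EFin_inj; rewrite -sumEFin fineK; last exact: finE.
under eq_bigr => a _ do rewrite fineK ?(finE _ (mEa a) (subset_trans (@subIsetl _ _ _) EX))//.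
have EE : E = \big[setU/set0]_(a <- index_enum (alph k)) (E `&` [set x : Sig k | x l = a]).
  rewrite -bigcup_seq; apply/seteqP; split => [x Ex|x [a _ []//]].
  by exists (x l) => //=; rewrite mem_index_enum.
rewrite {1}EE integral_bigsetU_EFin//.
- exact: index_enum_uniq.
- by move=> a a' _ _ [x [[_ /= <-] [_ /= <-]]].
- by rewrite -EE; apply/measurable_realfun.measurable_EFinP; apply: measurable_funS (hnorm_measurable hp).
Qed.

Lemma integral_ball_le H phi n y E : hnorm A alpha H phi -> X y ->
  E = ball_seq A n y ->
  \int[mu]_(x in E) phi x <= (phi y + H * alpha ^+ n) * pr mu E.
Proof.
move=> hp Xy ->; have mB := @measurable_ball k A n y.
have BX : ball_seq A n y `<=` X by move=> x [].
have ip := hnorm_integrable hp mB BX.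
rewrite /pr -(Rintegral_cst mu mB); apply: le_Rintegral => //.
  exact: hnorm_integrable (hnorm_cst A alpha01 _) mB BX.
move=> x [Xx xy]; have := hp.2 n y x Xy Xx xy; rewrite ler_norml => /andP[+ _].
lra.
Qed.
End Integral.

Section Regular.
Variables (R : realType) (k : nat) (A : 'M[int]_k.+2) (alpha : R).
Hypothesis alpha01 : 0 < alpha < 1.
Implicit Types (phi psi : Sig k -> R) (x y z : Sig k) (H : R).

Definition regular phi := exists2 H, 0 < H & hnorm A alpha H phi.

Lemma hnorm_regular H phi : hnorm A alpha H phi -> regular phi.
Proof.
move=> h; exists (1 + `|H|); first by rewrite ltr_pwDl.
by apply: hnorm_weaken h => //; rewrite (le_trans (ler_norm H))// lerDr.
Qed.

Lemma regular_cst c : regular (fun=> c).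
Proof. exact: hnorm_regular (hnorm_cst A alpha01 c). Qed.

Lemma regularD phi psi : regular phi -> regular psi -> regular (fun x => phi x + psi x).
Proof. by move=> [H _ h] [H' _ h']; exact: hnorm_regular (hnormD h h'). Qed.

Lemma regularN phi : regular phi -> regular (fun x => - phi x).
Proof. by move=> [H _ h]; exact: hnorm_regular (hnormN h). Qed.

Lemma regularB phi psi : regular phi -> regular psi -> regular (fun x => phi x - psi x).
Proof. by move=> h /regularN h'; exact: regularD. Qed.

Lemma regularZ c phi : regular phi -> regular (fun x => c * phi x).
Proof. by move=> [H _ h]; exact: hnorm_regular (hnormZ c h). Qed.

Lemma regularM phi psi : regular phi -> regular psi -> regular (fun x => phi x * psi x).
Proof.
by move=> [H H0 h] [H' H0' h']; exact: hnorm_regular (hnormM (ltW H0) (ltW H0') h h').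
Qed.

Lemma regularX phi n : regular phi -> regular (fun x => phi x ^+ n).
Proof.
move=> h; elim: n => [|n IH]; first exact: regular_cst.
rewrite (_ : (fun x => _) = fun x => phi x * phi x ^+ n); first exact: regularM.
by apply/funext => x; rewrite exprS.
Qed.

Lemma regular_shift n phi : regular phi -> regular (fun x => phi (iter n (@shift k) x)).
Proof. by move=> [H H0 h]; exact: hnorm_regular (hnorm_shift alpha01 n (ltW H0) h). Qed.

Lemma regular_expR phi : regular phi -> regular (fun x => expR (phi x)).
Proof. by move=> [H H0 h]; exact: hnorm_regular (hnorm_expR alpha01 (ltW H0) h). Qed.

Lemma eq_regular phi psi : {in SigmaA A, phi =1 psi} -> regular phi -> regular psi.
Proof. by move=> e [H H0 h]; exists H => //; apply: eq_hnorm h. Qed.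

Lemma regular_birkhoff n phi : regular phi -> regular (birkhoff phi n).
Proof.
move=> h; elim: n => [|n IH].
  by rewrite (_ : birkhoff _ _ = fun=> 0); [exact: regular_cst|apply/funext => x; rewrite birkhoff0].
rewrite (_ : birkhoff _ _ = fun x => phi x + birkhoff phi n (shift x)).
  by apply: regularD => //; exact: (@regular_shift 1).
by apply/funext => x; rewrite birkhoffS.
Qed.

Lemma geometric_series_limit th K (psi : nat -> Sig k -> R) : 0 < th < 1 -> 0 <= K ->
  (forall n, hnorm A alpha (K * th ^+ n) (psi n)) ->
  exists chi, forall n, hnorm A alpha (K * th ^+ n / (1 - th))
    (fun x => chi x - \sum_(i < n) psi i x).
Proof.
move=> th01 K0 hpsi; have [th0 th1] := andP th01.
have d0 : 0 < 1 - th by rewrite subr_gt0.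
pose S n x := \sum_(i < n) psi i x.
have hS n m : (n <= m)%N -> hnorm A alpha (K * th ^+ n / (1 - th)) (fun x => S m x - S n x).
  move=> nm; rewrite -(subnKC nm); move: (m - n)%N => p {nm m}.
  apply: (@hnorm_weaken _ _ _ _ alpha01 (K * th ^+ n * (1 - th ^+ p) / (1 - th))).
    rewrite ler_pM2r ?invr_gt0// ler_piMr ?mulr_ge0 ?exprn_ge0 ?(ltW th0)//.
    by rewrite lerBlDr lerDl exprn_ge0 ?(ltW th0).
  elim: p => [|p IH].
    rewrite expr0 subrr mulr0 mul0r; apply: (@eq_hnorm _ _ _ _ _ (fun=> 0)).
      by move=> x _; rewrite addn0 subrr.
    by have := hnorm_cst A alpha01 (0 : R); rewrite normr0.
  have := hnormD IH (hpsi (n + p)%N).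
  rewrite (_ : _ + _ = K * th ^+ n * (1 - th ^+ p.+1) / (1 - th)); last first.
    by rewrite exprD exprS; field; rewrite gt_eqF.
  by apply: eq_hnorm => x _; rewrite addnS /S big_ord_recr/=; ring.
have cv x : SigmaA A x -> cvgn (fun n => S n x).
  move=> Xx; apply: cauchy_seq_cvg => e e0.
  have [j hj] := geometric_small th01 (K / (1 - th)) e0.
  exists j => n jn; apply: le_trans ((hS j n jn).1 x Xx) _.
  by rewrite mulrAC; exact: hj.
exists (fun x => limn (fun n => S n x)) => n.
have bnd m (a : nat -> R) (l c e : R) : a i @[i --> \oo] --> l ->
    (forall i, (m <= i)%N -> `|a i - c| <= e) -> `|l - c| <= e.
  move=> al h; have : `|a i - c| @[i --> \oo] --> `|l - c|.
    by apply: cvg_norm; apply: cvgB => //; exact: cvg_cst.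
  move=> hc; apply: (cvgr_to_le hc); exists m => // i; exact: h.
split => [x Xx|m x y Xx Xy xy].
  by apply: (bnd n (fun i => S i x)) => [|i ni]; [exact: cv|exact: (hS n i ni).1].
rewrite (_ : _ - _ - _ = limn (S^~ x) - limn (S^~ y) - (S n x - S n y)); last by rewrite /S; ring.
apply: (bnd n (fun i => S i x - S i y)) => [|i ni]; first by apply: cvgB; exact: cv.
have := (hS n i ni).2 m x y Xx Xy xy.
by rewrite (_ : S i x - S i y - _ = S i x - S n x - (S i y - S n y)); last by ring.
Qed.
End Regular.

(** * Martingale approximation *)

Section MartingaleApproximation.
Variables (R : realType) (k : nat) (A : 'M[int]_k.+2) (alpha : R).
Hypothesis alpha01 : 0 < alpha < 1.
Variable u : Sig k -> R.
Implicit Types (phi psi xi chi : Sig k -> R) (x y z : Sig k).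
Let P := transfer A (fun y => expR (u y)).
Hypothesis P1 : forall x, SigmaA A x -> P (fun=> 1) x = 1.
Hypothesis P_regular : forall phi, regular A alpha phi -> regular A alpha (P phi).
Local Notation regular := (regular A alpha).

Lemma transferD phi psi x : P (fun y => phi y + psi y) x = P phi x + P psi x.
Proof.
rewrite -[P phi x]mul1r -transfer_lin; congr (P _ x).
by apply/funext => y; rewrite mul1r.
Qed.

Lemma transferN phi x : P (fun y => - phi y) x = - P phi x.
Proof.
rewrite -sumrN; apply: eq_bigr => a _; exact: mulrN.
Qed.

Lemma transferB phi psi x : P (fun y => phi y - psi y) x = P phi x - P psi x.
Proof. by rewrite transferD transferN. Qed.

(** On the preimages of [x] the function [psi o shift] takes the single value [psi x]: the pull-out
    rule of conditional expectations. *)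
Lemma transfer_mul_shift phi psi x : P (fun y => phi y * psi (shift y)) x = P phi x * psi x.
Proof. by rewrite /P /transfer mulr_suml; apply: eq_bigr => a _; rewrite mulrA. Qed.

Lemma transfer_shift phi x : SigmaA A x -> P (fun y => phi (shift y)) x = phi x.
Proof.
move=> Xx; rewrite -[RHS]mul1r -(P1 Xx) -transfer_mul_shift; congr (P _ x).
by apply/funext => y; rewrite mul1r.
Qed.

Lemma transfer_norm_le phi t x : (forall y, SigmaA A y -> `|phi y| <= t) ->
  SigmaA A x -> `|P phi x| <= t.
Proof.
move=> h Xx; rewrite ler_norml; apply/andP; split.
  by apply: (@iter_transfer_ge _ _ _ _ P1 1) => // y /h; rewrite ler_norml => /andP[].
by apply: (@iter_transfer_le _ _ _ _ P1 1) => // y /h; rewrite ler_norml => /andP[].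
Qed.

(** The solution is [chi = sum_i P^i psi]. Cutting at [n] leaves the tails of [chi] and of [P chi]
    and the boundary term [P^n psi], each at most [K * th^n / (1 - th)]. *)
Lemma transfer_poisson K th psi : 0 < th < 1 -> 0 <= K ->
  (forall n, hnorm A alpha (K * th ^+ n) (iter n P psi)) ->
  exists chi, regular chi /\ forall x, SigmaA A x -> chi x - P chi x = psi x.
Proof.
move=> th01 K0 h; have [th0 th1] := andP th01.
have [chi hchi] := geometric_series_limit alpha01 th01 K0 h.
exists chi; split.
  apply: (@hnorm_regular _ _ _ _ alpha01 (K * th ^+ 0 / (1 - th))).
  by apply: eq_hnorm (hchi 0%N) => x _; rewrite big_ord0 subr0.
move=> x Xx; apply/eqP; rewrite -subr_eq0 -normr_eq0 eq_le normr_ge0 andbT.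
apply/ler_addgt0Pr => e e0; rewrite add0r.
have [n /(_ n (leqnn n)) hn] := geometric_small th01 (3 * (K / (1 - th))) e0.
apply: le_trans hn.
have PS : P (fun y => \sum_(i < n) iter i P psi y) x = \sum_(i < n) iter i.+1 P psi x.
  rewrite (_ : (fun y => _) = fun y => \sum_(i < n) 1 * iter i P psi y).
    by rewrite /P transfer_sum; apply: eq_bigr => i _; rewrite mul1r.
  by apply/funext => y; apply: eq_bigr => i _; rewrite mul1r.
have e1 := (hchi n).1 x Xx.
have e2 := transfer_norm_le (hchi n).1 Xx.
have e3 := (h n).1 x Xx.
have T : \sum_(i < n) iter i P psi x + iter n P psi x =
    psi x + \sum_(i < n) iter i.+1 P psi x.
  transitivity (\sum_(i < n.+1) iter i P psi x); first by rewrite big_ord_recr.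
  by rewrite big_ord_recl.
rewrite transferB PS in e2.
set S := \sum_(i < n) iter i P psi x in e1 T.
set S' := \sum_(i < n) iter i.+1 P psi x in e2 T.
have e4 : K * th ^+ n <= K * th ^+ n / (1 - th).
  rewrite ler_peMr ?mulr_ge0 ?exprn_ge0 ?(ltW th0)// invf_ge1 ?subr_gt0//.
  by rewrite lerBlDr lerDl ltW.
have e5 : K / (1 - th) * th ^+ n = K * th ^+ n / (1 - th) by rewrite mulrAC.
rewrite -[leRHS]mulrA e5 {e5}.
set q := K * th ^+ n / (1 - th) in e1 e2 e4 *.
move: e1 e2 e3; rewrite !ler_norml => /andP[a1 b1] /andP[a2 b2] /andP[a3 b3].
by apply/andP; split; lra.
Qed.

(** Gordin's construction: if [chi0 - P chi0 = psi] and [chi = P chi0], then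
    [xi = chi0 - chi o shift], and [P xi = P chi0 - chi = 0]. *)
Lemma martingale_decomposition K th psi : 0 < th < 1 -> 0 <= K -> regular psi ->
  (forall n, hnorm A alpha (K * th ^+ n) (iter n P psi)) ->
  exists xi chi, [/\ regular xi, regular chi, forall x, SigmaA A x -> P xi x = 0 &
    forall x, SigmaA A x -> psi x = xi x + chi (shift x) - chi x].
Proof.
move=> th01 K0 rpsi h; have [chi0 [rchi pchi]] := transfer_poisson th01 K0 h.
pose chi := P chi0; have rc : regular chi by exact: P_regular.
exists (fun x => psi x + chi x - chi (shift x)), chi; split => //.
- by apply: (regularB alpha01); [exact: (regularD alpha01)|exact: (regular_shift alpha01 1)].
- move=> x Xx; rewrite transferB transfer_shift//.
  have -> : P (fun y => psi y + chi y) x = P chi0 x; last exact: subrr.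
  apply: eq_transfer; rewrite ?inE// => y /set_mem Xy.
  by rewrite -pchi// subrK.
- by move=> x Xx; ring.
Qed.

Lemma birkhoff_cobound psi xi chi n x :
  (forall x, SigmaA A x -> psi x = xi x + chi (shift x) - chi x) -> SigmaA A x ->
  birkhoff psi n x = birkhoff xi n x + chi (iter n (@shift k) x) - chi x.
Proof.
move=> h; elim: n x => [|n IH] x Xx; first by rewrite !birkhoff0 /=; ring.
rewrite !birkhoffS IH; last exact: (SigmaA_shift 1).
by rewrite h// -iterSr; ring.
Qed.

Section Functional.
Variable J : (Sig k -> R) -> R.
Hypothesis J_lin : forall c phi psi, regular phi -> regular psi ->
  J (fun x => c * phi x + psi x) = c * J phi + J psi.
Hypothesis J_P : forall phi, regular phi -> J (P phi) = J phi.
Hypothesis J_eq : forall phi psi, {in SigmaA A, phi =1 psi} -> J phi = J psi.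

Lemma functional0 : J (fun=> 0) = 0.
Proof.
have r0 := regular_cst A alpha01 0.
have h := J_lin 1 r0 r0.
have e : J (fun=> 1 * 0 + 0) = J (fun=> 0) by apply: J_eq => x _; rewrite mulr0 addr0.
by move: h; rewrite e; lra.
Qed.

Lemma functional_shift phi : regular phi -> J (fun x => phi (shift x)) = J phi.
Proof.
move=> rp; rewrite -(J_P (regular_shift alpha01 1 rp)); apply: J_eq => x /set_mem Xx.
exact: transfer_shift.
Qed.

Lemma functional_orth xi phi : regular xi -> regular phi ->
  (forall x, SigmaA A x -> P xi x = 0) -> J (fun x => xi x * phi (shift x)) = 0.
Proof.
move=> rx rp Pxi; rewrite -J_P; last exact: (regularM alpha01) rx (regular_shift alpha01 1 rp).
rewrite -functional0; apply: J_eq => x /set_mem Xx.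
by rewrite transfer_mul_shift Pxi// mul0r.
Qed.

(** Orthogonality of martingale increments. [J] is abstract because it is first the limit of [P^n],
    not yet known to be [mu], and later the integral itself. *)
Lemma functional_birkhoff_sq xi n : regular xi -> (forall x, SigmaA A x -> P xi x = 0) ->
  J (fun x => birkhoff xi n x ^+ 2) = n%:R * J (fun x => xi x ^+ 2).
Proof.
move=> rx Pxi; elim: n => [|n IH].
  by rewrite mul0r -functional0; apply: J_eq => x _; rewrite birkhoff0 expr0n.
have rS := regular_birkhoff alpha01 n rx.
have rSs := regular_shift alpha01 1 rS.
have r1 := regularX alpha01 2 rx.
have r2 := regularX alpha01 2 rSs.
have r3 := regularM alpha01 rx rSs.
transitivity (J (fun x => 2 * (xi x * birkhoff xi n (shift x)) +
   (1 * xi x ^+ 2 + birkhoff xi n (shift x) ^+ 2))).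
  by apply: J_eq => x _; rewrite birkhoffS; ring.
have r4 : regular (fun x => 1 * xi x ^+ 2 + birkhoff xi n (shift x) ^+ 2).
  by apply: (regularD alpha01) => //; exact: (regularZ alpha01).
rewrite (J_lin 2 r3 r4) (J_lin 1 r1 r2) functional_orth// mulr0 add0r mul1r.
rewrite (functional_shift (regularX alpha01 2 rS)) IH -natr1; ring.
Qed.
End Functional.
End MartingaleApproximation.

(** A coboundary in the potential conjugates the operator by multiplication with [expR v]. *)
Lemma iter_transfer_conj (R : realType) (k : nat) (A : 'M[int]_k.+2) (u v phi : Sig k -> R) n x :
  iter n (transfer A (fun y => expR (u y + v y - v (shift y)))) phi x =
  expR (- v x) * iter n (transfer A (fun y => expR (u y))) (fun y => expR (v y) * phi y) x.
Proof.
elim: n x => [|n IH] x; first by rewrite /= mulrA -expRD addNr expR0 mul1r.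
rewrite !iterS /transfer mulr_sumr; apply: eq_bigr => a _.
rewrite IH shift_cons !expRD !expRN; field.
by rewrite !gt_eqF ?expR_gt0.
Qed.

(** * From the Gibbs property to exponential mixing for [mu] *)

Section SpectralGap.
Variables (R : realType) (k : nat) (A : 'M[int]_k.+2) (mu : probability (Sig k) R).
Variables (alpha C : R) (u : Sig k -> R) (Hu : R) (M : nat).
Hypothesis alpha01 : 0 < alpha < 1.
Hypothesis muX : mu (SigmaA A) = 1%E.
Hypothesis mu_inv : forall E : set (Sig k), measurable E -> mu (@shift k @^-1` E) = mu E.
Hypothesis conn : connecting A M.
Hypothesis Hu0 : 0 < Hu.
Hypothesis u_hol : hnorm A alpha Hu u.
Hypothesis C_gt1 : 1 < C.
Hypothesis gibbs : forall x n, SigmaA A x ->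
  C^-1 <= pr mu (ball_seq A n x) / expR (birkhoff u n x) <= C.
Implicit Types (phi psi : Sig k -> R) (x y z : Sig k) (H : R) (E : set (Sig k)).
Local Notation X := (SigmaA A).
Local Notation I := (integral_on A mu).
Let mX : measurable X. Proof. exact: measurable_SigmaA. Qed.
Let L := transfer A (fun y => expR (u y)).
Let C0 : 0 < C. Proof. exact: lt_trans C_gt1. Qed.

Lemma SigmaA_nonempty : exists x, X x.
Proof.
apply: contrapT => /forallNP h; have X0 : X = set0 by apply/seteqP; split => // x /h.
by move: muX; rewrite X0 measure0 => /eqP; rewrite eqe eq_sym oner_eq0.
Qed.

Lemma pr_split l E : measurable E -> E `<=` X ->
  pr mu E = \sum_(a : alph k) pr mu (E `&` [set x | x l = a]).
Proof.
move=> mE EX.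
have e F : measurable F -> \int[mu]_(x in F) (1 : R) = pr mu F.
  by move=> mF; rewrite Rintegral_cst// mul1r.
rewrite -e// (integral_split mu alpha01 l (hnorm_cst A alpha01 1) mE EX).
apply: eq_bigr => a _; apply: e; apply: measurableI => //; exact: measurable_coord.
Qed.

Let XB n y : X `&` iter 0 (@shift k) @^-1` ball_seq A n y = ball_seq A n y.
Proof. by apply/seteqP; split => [x [_]//|x [Xx xy]]; split. Qed.

(** By the Gibbs property each term of the sum is at most [C] times the measure of an [n]-cylinder,
    and these cylinders are disjoint. *)
Lemma transfer_iter_ub n x : X x -> iter n L (fun=> 1) x <= C.
Proof.
move=> Xx; rewrite iter_transfer_exp.
apply: (@le_trans _ _ (iter n (transfer A (fun=> 1)) (fun y => C * pr mu (ball_seq A n y)) x)).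
  apply: ler_iter_transfer => // y Xy; rewrite mulr1.
  exact: (gibbs_lb C_gt1 gibbs).
rewrite iter_transferZ ler_piMr ?(ltW C0)//.
have h := @sum_preimages_ball_le R k A (pr mu) _ pr_split X 0 n x mX (@subset_refl _ _) Xx.
have -> : (fun y => pr mu (ball_seq A n y)) =
    fun y => pr mu (X `&` iter 0 (@shift k) @^-1` ball_seq A n y).
  by apply/funext => y; rewrite XB.
 apply: (le_trans (h _)); first by move=> *; exact: pr_ge0.
exact: pr_le1.
Qed.

Definition lower_const : R := C^-1 * expR (- (M%:R * Hu)).

Lemma lower_const_gt0 : 0 < lower_const.
Proof. by rewrite mulr_gt0 ?invr_gt0 ?expR_gt0. Qed.

(** On the [(n + 1)]-cylinder of [y] the integral of [phi] is at most [phi y + H * alpha ^+ n.+1]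
    times its measure. Summing over the [(n + M)]-fold preimages of [x] recovers the whole integral
    of [phi]. *)
Lemma transfer_iter_lb H phi n x : 0 <= H -> hnorm A alpha H phi ->
  (forall x, X x -> 0 <= phi x) -> X x ->
  lower_const * I phi - C * (H * alpha ^+ n.+1) <= iter (n + M) L phi x.
Proof.
move=> H0 hp p0 Xx; rewrite lerBlDr.
have e0 : 0 <= H * alpha ^+ n.+1.
  by rewrite mulr_ge0// exprn_ge0//; case/andP: alpha01 => /ltW.
apply: (@le_trans _ _ (iter (n + M) L (fun y => H * alpha ^+ n.+1 * 1 + phi y) x)); last first.
  rewrite iter_transfer_lin addrC lerD2l mulrC ler_wpM2r//.
  exact: transfer_iter_ub.
rewrite iter_transfer_exp.
apply: (@le_trans _ _ (iter (n + M) (transfer A (fun=> 1))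
   (fun y => lower_const * \int[mu]_(z in ball_seq A n.+1 y) phi z) x)).
  rewrite iter_transferZ ler_wpM2l ?(ltW lower_const_gt0)//.
  have -> : (fun y => \int[mu]_(z in ball_seq A n.+1 y) phi z) =
      fun y => \int[mu]_(z in X `&` iter 0 (@shift k) @^-1` ball_seq A n.+1 y) phi z.
    by apply/funext => y; rewrite XB.
  have := @sum_preimages_ball_ge R k A (fun E => \int[mu]_(z in E) phi z) _ _ M conn X 0 n x mX
    (@subset_refl _ _) Xx.
  apply.
    by move=> E mE EX; apply: Rintegral_ge0 => z /EX; exact: p0.
  by move=> l E mE EX; exact: (integral_split mu alpha01 l hp).
apply: ler_iter_transfer => // y Xy; rewrite mulr1.
have h1 := integral_ball_le (n := n.+1) mu alpha01 hp Xy (erefl _).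
have gn := gibbs_ub gibbs n Xy.
have pB : pr mu (ball_seq A n.+1 y) <= pr mu (ball_seq A n y).
  apply: le_pr; [exact: measurable_ball|exact: measurable_ball|].
  by move=> z [Xz yz]; split => //; exact: agree_leq yz.
have GM : expR (- (M%:R * Hu)) <= expR (birkhoff u M (iter n (@shift k) y)).
  rewrite ler_expR; have := birkhoff_norm M u_hol.1 (SigmaA_shift n Xy).
  by rewrite ler_norml => /andP[].
rewrite birkhoffD expRD /lower_const.
have q0 : 0 <= phi y + H * alpha ^+ n.+1 by rewrite addr_ge0// p0.
apply: (@le_trans _ _ (C^-1 * expR (- (M%:R * Hu)) *
   ((phi y + H * alpha ^+ n.+1) * pr mu (ball_seq A n.+1 y)))).
  by rewrite ler_wpM2l ?(ltW lower_const_gt0).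
rewrite [H * _ + _]addrC; set q := phi y + _; set p := pr mu _; set E0 := expR (- _).
rewrite (_ : C^-1 * E0 * (q * p) = q * ((C^-1 * p) * E0)); last by ring.
rewrite [leRHS]mulrC; apply: ler_wpM2l => //; apply: ler_pM => //.
- by apply: mulr_ge0; [rewrite invr_ge0 ltW|exact: pr_ge0].
- exact: expR_ge0.
- by rewrite mulrC ler_pdivrMr// mulrC (le_trans pB gn).
Qed.

Lemma transfer_iter1_lb : exists2 c, 0 < c & forall n x, X x -> c <= iter n L (fun=> 1) x.
Proof.
have l0 := lower_const_gt0.
have [j hj] := geometric_small alpha01 C (divr_gt0 l0 (ltr0Sn _ 1)).
exists (lower_const / 2 / C); first by rewrite !divr_gt0.
move=> n x Xx; rewrite ler_pdivrMr//.
pose m := (n + j)%N.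
have := @transfer_iter_lb 1 (fun=> 1) m x ler01 _ (fun _ _ => ler01) Xx.
rewrite (integral_cst muX) mulr1 mul1r => h.
have {}h : lower_const / 2 <= iter (m + M) L (fun=> 1) x.
  have h' := hj m.+1 (leqW (leq_addl _ _)).
  have h1 : hnorm A alpha 1 (fun=> 1) by have := hnorm_cst A alpha01 (1 : R); rewrite normr1.
  by have := h h1; lra.
(* The lower bound at the later time [n + (j + M)] descends to time [n], because
   [L^(j + M) 1 <= C]. *)
apply: (le_trans h); rewrite (_ : m + M = n + (j + M))%N; last by rewrite addnA.
rewrite iterD mulrC -iter_transferZ; apply: ler_iter_transfer => [y _|y Xy|//].
  exact: expR_ge0.
by rewrite mulr1; exact: transfer_iter_ub.
Qed.
End SpectralGap.

Section SpectralGapTheorem.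
Variables (R : realType) (k : nat) (A : 'M[int]_k.+2) (mu : probability (Sig k) R).
Variables (alpha C : R) (u : Sig k -> R) (Hu : R) (M : nat).
Hypothesis alpha01 : 0 < alpha < 1.
Hypothesis muX : mu (SigmaA A) = 1%E.
Hypothesis mu_inv : forall E : set (Sig k), measurable E -> mu (@shift k @^-1` E) = mu E.
Hypothesis conn : connecting A M.
Hypothesis Hu0 : 0 < Hu.
Hypothesis u_hol : hnorm A alpha Hu u.
Hypothesis C_gt1 : 1 < C.
Hypothesis gibbs : forall x n, SigmaA A x ->
  C^-1 <= pr mu (ball_seq A n x) / expR (birkhoff u n x) <= C.
Implicit Types (phi psi : Sig k -> R) (x y z : Sig k) (H : R) (E : set (Sig k)).
Local Notation X := (SigmaA A).
Local Notation I := (integral_on A mu).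
Local Notation reg := (regular A alpha).
Let L := transfer A (fun y => expR (u y)).
Let C0 : 0 < C. Proof. exact: lt_trans C_gt1. Qed.
Let a0 : 0 < alpha. Proof. by case/andP: alpha01. Qed.

(** Take [v = ln h] for the eigenfunction [h]: the new weights of the preimages of [x] sum to
    [L h x / h x = 1]. *)
Lemma normalized_potential : exists v, reg v /\ forall x, X x ->
  transfer A (fun y => expR (u y + v y - v (shift y))) (fun=> 1) x = 1.
Proof.
have [x0 Xx0] := SigmaA_nonempty muX.
have [c c0 Lc] := transfer_iter1_lb alpha01 muX conn u_hol C_gt1 gibbs.
have LC := transfer_iter_ub alpha01 C_gt1 gibbs.
have hol := u_hol.2; have bnd := u_hol.1.
have hb := eigenfunction_bnd alpha01 (ltW Hu0) hol bnd conn c0 Lc LC Xx0.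
have hc := eigenfunction_cone alpha01 (ltW Hu0) hol bnd conn c0 Lc LC Xx0.
have he := transfer_eigenfunction alpha01 (ltW Hu0) hol bnd conn c0 Lc LC Xx0.
set h := eigenfunction A u x0 in hb hc he.
set W := cone_width _ _ _ _ _ _ in hc.
have h0 x : X x -> 0 < h x by exact: hc.1.
have cC : 0 < c / C by rewrite divr_gt0.
have Cc : 0 < C / c by rewrite divr_gt0.
have W0 : 0 <= W by rewrite /W; apply: cone_width_ge0 => //; exact: ltW.
exists (fun x => ln (h x)); split.
  apply: (@hnorm_regular _ _ _ _ alpha01 (ln (C / c) + W)); split.
    move=> x Xx; have /andP[h1 h2] := hb x Xx.
    have e1 : ln (h x) <= ln (C / c) by rewrite ler_ln ?posrE// h0.
    have e2 : ln (c / C) <= ln (h x) by rewrite ler_ln ?posrE// h0.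
    have e3 : ln (c / C) = - ln (C / c) by rewrite -lnV ?posrE// invf_div.
    by rewrite ler_norml; apply/andP; split; lra.
  have half n x y : X x -> X y -> agree n x y -> ln (h x) - ln (h y) <= W * alpha ^+ n.
    move=> Xx Xy xy; have := hc.2 n x y Xx Xy isT xy.
    rewrite -ler_ln ?posrE ?mulr_gt0 ?expR_gt0 ?h0// lnM ?posrE ?expR_gt0 ?h0// expRK.
    by rewrite lerBlDl.
  have lCc : 0 <= ln (C / c).
    have /andP[h1 h2] := hb x0 Xx0; apply: ln_ge0.
    rewrite ler_pdivlMr// mul1r; exact: le_trans (Lc 0%N x0 Xx0) (LC 0%N x0 Xx0).
  have ap n : 0 <= alpha ^+ n by rewrite exprn_ge0// ltW.
  move=> n x y Xx Xy xy; apply: (@le_trans _ _ (W * alpha ^+ n)).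
    by rewrite ler_norml half// andbT lerNl opprB half//; exact: agree_sym.
  by rewrite ler_wpM2r// lerDr.
move=> x Xx; have hx := h0 x Xx.
transitivity (transfer A (fun y => expR (u y)) h x / h x); last by rewrite he// divff// gt_eqF.
rewrite /transfer mulr_suml.
apply: eq_bigr => a aA; have hax := h0 _ (SigmaA_consE Xx aA).
by rewrite mulr1 shift_cons !expRD expRN !lnK ?posrE.
Qed.

Variable v : Sig k -> R.
Hypothesis rv : reg v.
Let g x := u x + v x - v (shift x).
Let P := transfer A (fun y => expR (g y)).
Hypothesis P1 : forall x, X x -> P (fun=> 1) x = 1.

Let rg : reg g.
Proof.
apply: (regularB alpha01); last exact: (regular_shift alpha01 1).
by apply: (regularD alpha01) => //; exact: hnorm_regular u_hol.
Qed.

Let Mix : exists K th : R, [/\ 0 < K, 0 < th < 1 &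
  forall H phi, 0 < H -> hnorm A alpha H phi -> exists c, forall n,
    hnorm A alpha (K * H * th ^+ n) (fun x => iter n P phi x - c)].
Proof.
have [x0 Xx0] := SigmaA_nonempty muX.
have [Hg Hg0 hg] := rg.
exact: (transfer_mixing alpha01 (ltW Hg0) hg.2 hg.1 conn P1 Xx0).
Qed.

Let P_reg phi : reg phi -> reg (P phi).
Proof.
have [K [th [K0 th01 mix]]] := Mix.
move=> [H H0 hp]; have [c hc] := mix H phi H0 hp.
apply: (@eq_regular _ _ _ _ (fun x => (iter 1 P phi x - c) + c)).
  by move=> x _; rewrite subrK.
by apply: (regularD alpha01); [exact: (hnorm_regular alpha01 (hc 1%N))|exact: (regular_cst A alpha01)].
Qed.

(** One-sided comparison of [mu] with the limit functional: [transfer_iter_lb] is transported to [P]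
    through the bounded factor [expR v], and its error term vanishes as [n] grows. *)
Let I_le_mean : exists2 C' : R, 0 < C' & forall phi (c : R) x, reg phi -> (forall x, X x -> 0 <= phi x) ->
  X x -> iter n P phi x @[n --> \oo] --> c -> I phi <= C' * c.
Proof.
have [Hv Hv0 [vb _]] := rv.
have l0 := lower_const_gt0 Hu M C_gt1.
pose D := expR (- (2 * Hv)) * lower_const C Hu M.
have D0 : 0 < D by rewrite mulr_gt0 ?expR_gt0.
exists D^-1; first by rewrite invr_gt0.
move=> phi c x [H H0 hp] p0 Xx cvc.
rewrite mulrC ler_pdivlMr// mulrC; apply/ler_addgt0Pr => e e0.
have e0' : 0 < expR (- (2 * Hv)) by exact: expR_gt0.
have [j hj] := geometric_small alpha01 (expR (- (2 * Hv)) * C * H) e0.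
rewrite -lerBlDr; apply: (cvgr_to_ge cvc); exists (j + M)%N => // n /= jn.
have jM : (M <= n)%N by apply: leq_trans jn; rewrite leq_addl.
have jn' : (j <= n - M)%N by rewrite leq_subRL// addnC.
rewrite /P /g iter_transfer_conj.
have h1 := transfer_iter_lb alpha01 conn u_hol C_gt1 gibbs (n - M) (ltW H0) hp p0 Xx.
rewrite subnK// in h1.
have h2 : expR (- Hv) * iter n L phi x <= iter n L (fun y => expR (v y) * phi y) x.
  rewrite -iter_transferZ; apply: ler_iter_transfer => // y Xy.
  apply: ler_wpM2r; first exact: p0.
  by rewrite ler_expR; have := vb y Xy; rewrite ler_norml => /andP[].
have h3 : expR (- Hv) <= expR (- v x).
  by rewrite ler_expR lerN2; have := vb x Xx; rewrite ler_norml => /andP[].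
have h4 := hj (n - M).+1 (leqW jn').
apply: (@le_trans _ _ (expR (- (2 * Hv)) * iter n L phi x)).
  rewrite /D -mulrA; apply: (@le_trans _ _ (expR (- (2 * Hv)) *
    (lower_const C Hu M * I phi - C * (H * alpha ^+ (n - M).+1)))).
    by rewrite mulrBr !mulrA; lra.
  by rewrite ler_wpM2l// ltW.
have -> : expR (- (2 * Hv)) = expR (- Hv) * expR (- Hv) by rewrite -expRD; congr expR; ring.
rewrite -mulrA; apply: ler_pM; rewrite ?expR_ge0//.
by rewrite mulr_ge0 ?expR_ge0//; apply: iter_transfer_ge0 => // y _; exact: expR_ge0.
Qed.

(** Up to a coboundary [phi - c] is a function [xi] with [P xi = 0], so it suffices that [I xi = 0].
    Jensen's inequality, [I_le_mean] and orthogonality give [(n * I xi)^2 <= C' * n * J (xi^2)] for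
    every [n], which a nonzero [I xi] violates. *)
Let integral_mean phi (c : R) : reg phi ->
  (forall x, X x -> iter n P phi x @[n --> \oo] --> c) -> I phi = c.
Proof.
move=> rphi cphi; have [x0 Xx0] := SigmaA_nonempty muX.
have [K [th [K0 th01 mix]]] := Mix.
pose J f := limn (fun n => iter n P f x0).
have mix_cvg f : reg f -> exists c' K', [/\ 0 <= K',
    forall n, hnorm A alpha (K' * th ^+ n) (fun x => iter n P f x - c') &
    forall x, X x -> iter n P f x @[n --> \oo] --> c'].
  move=> [H H0 hf]; have [c' hc'] := mix H f H0 hf.
  exists c', (K * H); split => //; first by rewrite mulr_ge0 ?ltW.
  move=> x Xx; apply/cvgrPdist_le => e e0.
  have [j hj] := geometric_small th01 (K * H) e0.
  exists j => // m jm; rewrite distrC; apply: le_trans (hj m jm); exact: (hc' m).1.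
have Jcvg f x : reg f -> X x -> iter n P f x @[n --> \oo] --> J f.
  move=> /mix_cvg[c' [K' [_ _ hc']]] Xx.
  by rewrite /J (cvg_lim _ (hc' x0 Xx0))//; exact: hc'.
have J_eq f f' : {in X, f =1 f'} -> J f = J f'.
  move=> e; congr (limn _); apply/funext => n.
  by apply: eq_iter_transfer => //; apply/mem_set.
have J_lin c' f f' : reg f -> reg f' -> J (fun x => c' * f x + f' x) = c' * J f + J f'.
  move=> rf rf'; apply: cvg_lim => //.
  under eq_fun do rewrite iter_transfer_lin.
  by apply: cvgD; [apply: cvgMr; exact: Jcvg|exact: Jcvg].
have J_P f : reg f -> J (P f) = J f.
  move=> rf; apply: cvg_lim => //.
  rewrite (_ : (fun n => _) = [sequence iter n.+1 P f x0]_n).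
    by rewrite (cvg_shiftS (fun n => iter n P f x0)); exact: Jcvg.
  by apply/funext => n; rewrite -iterSr.
have [c' [K' [K'0 hc' cvc']]] := mix_cvg _ rphi.
have cc' : c' = c by exact: cvg_unique (cvc' x0 Xx0) (cphi x0 Xx0).
rewrite {c'}cc' in hc' cvc'.
have [xi [chi [rxi rchi Pxi dec]]] : exists xi chi, [/\ reg xi, reg chi,
    forall x, X x -> P xi x = 0 &
    forall x, X x -> phi x + - c = xi x + chi (shift x) - chi x].
  apply: (martingale_decomposition alpha01 P1 P_reg th01 K'0).
    by apply: (regularD alpha01) => //; exact: (regular_cst A alpha01).
  move=> n; apply: eq_hnorm (hc' n) => x /set_mem Xx.
  by rewrite /P iter_transferDc.
have hn f : reg f -> exists H, hnorm A alpha H f by move=> [H]; exists H.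
have ID f f' : reg f -> reg f' -> I (fun x => f x + f' x) = I f + I f'.
  by move=> /hn[H hf] /hn[H' hf']; rewrite (integralD mu alpha01 hf hf').
have IZ a f : reg f -> I (fun x => a * f x) = a * I f.
  by move=> /hn[H hf]; rewrite (integralZ alpha01 muX a hf).
have IS f : reg f -> I (fun x => f (shift x)) = I f.
  by move=> /hn[H hf]; rewrite (integral_shift alpha01 muX mu_inv hf).
have rS := regular_shift alpha01 1 rchi.
suff Ixi : I xi = 0.
  have := ID _ _ rphi (regular_cst A alpha01 (- c)).
  rewrite (integral_cst muX) (@eq_integral_on _ _ _ _ _ (fun x => xi x + (chi (shift x) + - 1 * chi x))).
    rewrite ID ?ID ?IZ ?IS ?Ixi//; first by lra.
    - exact: (regularZ alpha01).
    - by apply: (regularD alpha01) => //; exact: (regularZ alpha01).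
  by move=> x /set_mem Xx; rewrite dec//; ring.
have Ibirk n : I (birkhoff xi n) = n%:R * I xi.
  elim: n => [|n IH].
    rewrite mul0r (@eq_integral_on _ _ _ _ _ (fun=> 0)) ?(integral_cst muX)//.
    by move=> x _; rewrite birkhoff0.
  rewrite (@eq_integral_on _ _ _ _ _ (fun x => xi x + birkhoff xi n (shift x))).
    have rb := regular_birkhoff alpha01 n rxi.
    by rewrite ID//; [rewrite IS// IH -natr1; ring|exact: (regular_shift alpha01 1)].
  by move=> x _; rewrite birkhoffS.
have jensen f : reg f -> I f ^+ 2 <= I (fun x => f x ^+ 2).
  move=> rf; have rf2 := regularX alpha01 2 rf.
  have r1 := regularZ alpha01 (- (2 * I f)) rf.
  have rc := regular_cst A alpha01 (I f ^+ 2).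
  have r2 : reg (fun x => - (2 * I f) * f x + I f ^+ 2) by exact: (regularD alpha01).
  have r3 : reg (fun x => f x ^+ 2 + (- (2 * I f) * f x + I f ^+ 2)) by exact: (regularD alpha01).
  have [H hH] := hn _ r3.
  have := le_integral_on mu alpha01 (hnorm_cst A alpha01 (0 : R)) hH.
  rewrite (integral_cst muX) ID// ID// IZ// (integral_cst muX) => h.
  have : 0 <= I (fun x => f x ^+ 2) + (- (2 * I f) * I f + I f ^+ 2).
    apply: h => x _; rewrite (_ : _ + _ = (f x - I f) ^+ 2) ?sqr_ge0//; ring.
  by move=> h'; rewrite expr2 in h' *; lra.
have [C' C'0 hC'] := I_le_mean.
have main n : (n%:R * I xi) ^+ 2 <= C' * (n%:R * J (fun x => xi x ^+ 2)).
  have rb := regular_birkhoff alpha01 n rxi.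
  rewrite -Ibirk; apply: le_trans (jensen _ rb) _.
  rewrite -(functional_birkhoff_sq alpha01 P1 J_lin J_P J_eq n rxi Pxi).
  apply: (hC' _ _ x0 (regularX alpha01 2 rb)) => //.
    by move=> x _; rewrite sqr_ge0.
  exact: Jcvg (regularX alpha01 2 rb) Xx0.
apply/eqP; rewrite -sqrf_eq0 eq_le sqr_ge0 andbT leNgt; apply/negP => I0.
set s := J _ in main.
have [n n0] : exists n : nat, C' * s / I xi ^+ 2 < n.+1%:R.
  exists (Num.truncn `|C' * s / I xi ^+ 2|).
  exact: le_lt_trans (ler_norm _) (truncnS_gt _).
have := main n.+1; move: n0; rewrite ltr_pdivrMr// => n0.
have N0 : 0 < n.+1%:R :> R by rewrite ltr0n.
by rewrite -(ltr_pM2l N0) in n0; lra.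
Qed.

Theorem gibbs_mixing : exists K th : R, [/\ 0 < K, 0 < th < 1 &
  forall H phi, 0 < H -> hnorm A alpha H phi -> forall n,
    hnorm A alpha (K * H * th ^+ n) (fun x => iter n P phi x - I phi)].
Proof.
have [K [th [K0 th01 mix]]] := Mix; exists K, th; split => // H phi H0 hp n.
have [c hc] := mix H phi H0 hp.
rewrite (@integral_mean phi c)//; first by exists H.
move=> x Xx; apply/cvgrPdist_le => e e0.
have [j hj] := geometric_small th01 (K * H) e0.
exists j => // m jm; rewrite distrC; apply: le_trans (hj m jm); exact: (hc m).1.
Qed.
End SpectralGapTheorem.

Section InvariantIntegral.
Variables (R : realType) (k : nat) (A : 'M[int]_k.+2) (mu : probability (Sig k) R).
Variables (alpha K th : R) (g : Sig k -> R).
Hypothesis alpha01 : 0 < alpha < 1.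
Hypothesis muX : mu (SigmaA A) = 1%E.
Hypothesis mu_inv : forall E : set (Sig k), measurable E -> mu (@shift k @^-1` E) = mu E.
Implicit Types (phi psi xi chi : Sig k -> R) (x y z : Sig k) (H : R) (E : set (Sig k)).
Local Notation X := (SigmaA A).
Local Notation I := (integral_on A mu).
Local Notation reg := (regular A alpha).

Lemma regular_integralD phi psi : reg phi -> reg psi ->
  I (fun x => phi x + psi x) = I phi + I psi.
Proof. by move=> [H _ hf] [H' _ hf']; rewrite (integralD mu alpha01 hf hf'). Qed.

Lemma regular_integralZ c phi : reg phi -> I (fun x => c * phi x) = c * I phi.
Proof. by move=> [H _ hf]; rewrite (integralZ alpha01 muX c hf). Qed.

Lemma regular_integralN phi : reg phi -> I (fun x => - phi x) = - I phi.
Proof.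
move=> rp; rewrite -mulN1r -regular_integralZ//.
by apply: eq_integral_on => x _; rewrite mulN1r.
Qed.

Lemma regular_integralB phi psi : reg phi -> reg psi ->
  I (fun x => phi x - psi x) = I phi - I psi.
Proof.
move=> rp rq; rewrite regular_integralD// ?regular_integralN//.
exact: (regularN alpha01).
Qed.

Lemma regular_integral_shift phi : reg phi -> I (fun x => phi (shift x)) = I phi.
Proof. by move=> [H _ hf]; rewrite (integral_shift alpha01 muX mu_inv hf). Qed.

Lemma regular_integral_le phi psi : reg phi -> reg psi ->
  (forall x, X x -> phi x <= psi x) -> I phi <= I psi.
Proof. by move=> [H _ hf] [H' _ hf']; exact: (le_integral_on mu alpha01 hf hf'). Qed.

Lemma regular_integral_birkhoff phi n : reg phi -> I (birkhoff phi n) = n%:R * I phi.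
Proof.
move=> rp; elim: n => [|n IH].
  rewrite mul0r (@eq_integral_on _ _ _ _ _ (fun=> 0)) ?(integral_cst muX)//.
  by move=> x _; rewrite birkhoff0.
rewrite (@eq_integral_on _ _ _ _ _ (fun x => phi x + birkhoff phi n (shift x))).
  have rb := regular_birkhoff alpha01 n rp.
  rewrite regular_integralD//; last exact: (regular_shift alpha01 1).
  by rewrite regular_integral_shift// IH -natr1; ring.
by move=> x _; rewrite birkhoffS.
Qed.

(** Indicators of finitely determined events are Hölder, so probabilities are covered by the
    calculus of integrals of regular functions. *)
Lemma regular_indic n E : determined A n E -> reg (\1_E : Sig k -> R).
Proof.
have [a0 a1] := andP alpha01.
move=> dE; apply: (@hnorm_regular _ _ _ _ alpha01 (alpha ^- n)); split.
  move=> x Xx; rewrite indicE; case: (_ \in _); rewrite ?normr1 ?normr0 ?invr_ge0 ?exprn_ge0 ?(ltW a0)//.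
  by rewrite invf_ge1 ?exprn_gt0// exprn_ile1// ltW.
move=> m x y Xx Xy xy; rewrite mulrC; case: (leqP n m) => nm.
  have -> : \1_E x = \1_E y :> R.
    rewrite !indicE; congr ((_ : bool)%:R); apply/idP/idP; rewrite !inE.
      by apply: dE.2 => //; exact: agree_leq xy.
    by apply: dE.2 => //; apply: agree_sym; exact: agree_leq xy.
  by rewrite subrr normr0 mulr_ge0 ?invr_ge0 ?exprn_ge0 ?(ltW a0).
apply: (@le_trans _ _ 1).
  rewrite !indicE; case: (_ \in _); case: (_ \in _);
    by rewrite ?subrr ?subr0 ?sub0r ?normrN ?normr1 ?normr0.
rewrite ler_pdivlMr ?exprn_gt0// mul1r; apply: ler_wiXn2l; rewrite ?(ltW a0) ?(ltW a1)//.
exact: ltnW.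
Qed.

Lemma integral_indic_determined n E : determined A n E -> I (\1_E) = pr mu E.
Proof.
move=> dE; rewrite /integral_on integral_indic.
- by rewrite (_ : E `&` X = E)//; apply/seteqP; split => [x []//|x Ex]; split => //; exact: dE.1.
- exact: measurable_SigmaA.
- exact: measurable_determined dE.
Qed.

Lemma determined_markov n E phi t : determined A n E -> reg phi ->
  (forall x, X x -> 0 <= phi x) -> (forall x, E x -> t <= phi x) ->
  t * pr mu E <= I phi.
Proof.
move=> dE rp p0 tE; rewrite -(integral_indic_determined dE) -regular_integralZ; last first.
  exact: regular_indic dE.
apply: regular_integral_le => //.
  by apply: (regularZ alpha01); exact: regular_indic dE.
move=> x Xx; rewrite indicE; case: (boolP (x \in E)) => [/set_mem/tE|_].
  by rewrite mulr1.
by rewrite mulr0 p0.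
Qed.

Let P := transfer A (fun y => expR (g y)).
Hypothesis P1 : forall x, X x -> P (fun=> 1) x = 1.
Hypothesis th01 : 0 < th < 1.
Hypothesis K0 : 0 < K.
Hypothesis mix : forall H phi, 0 < H -> hnorm A alpha H phi -> forall n,
    hnorm A alpha (K * H * th ^+ n) (fun x => iter n P phi x - I phi).

Lemma transfer_regular phi : reg phi -> reg (P phi).
Proof.
move=> [H H0 hp]; apply: (@eq_regular _ _ _ _ (fun x => (iter 1 P phi x - I phi) + I phi)).
  by move=> x _; rewrite subrK.
apply: (regularD alpha01); last exact: (regular_cst A alpha01).
exact: (hnorm_regular alpha01 (mix H0 hp 1%N)).
Qed.

(** Both integrals are limits of the same sequence [P^n phi x0]. *)
Lemma integral_transfer phi : reg phi -> I (P phi) = I phi.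
Proof.
move=> rp; have [x0 Xx0] := SigmaA_nonempty muX.
have cv f : reg f -> iter n P f x0 @[n --> \oo] --> I f.
  move=> [H H0 hp]; apply/cvgrPdist_le => e e0.
  have [j hj] := geometric_small th01 (K * H) e0.
  by exists j => // m jm; rewrite distrC; apply: le_trans (hj m jm); exact: (mix H0 hp m).1.
have c1 := cv _ (transfer_regular rp).
rewrite (_ : (fun n => _) = [sequence iter n.+1 P phi x0]_n) in c1; last first.
  by apply/funext => n; rewrite -iterSr.
rewrite (cvg_shiftS (fun n => iter n P phi x0)) in c1.
exact: cvg_unique c1 (cv _ rp).
Qed.

Lemma integral_iter_transfer phi n : reg phi -> I (iter n P phi) = I phi.
Proof.
elim: n phi => // n IH phi rp; rewrite iterSr IH; last exact: transfer_regular.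
exact: integral_transfer.
Qed.

Lemma iter_transfer_regular phi n : reg phi -> reg (iter n P phi).
Proof. by move=> rp; elim: n => //= n; exact: transfer_regular. Qed.

Lemma mix_centered phi : reg phi -> I phi = 0 -> exists2 K', 0 <= K' &
  forall n, hnorm A alpha (K' * th ^+ n) (iter n P phi).
Proof.
move=> [H H0 hp] I0; exists (K * H); first by rewrite mulr_ge0// ltW.
by move=> n; have := mix H0 hp n; rewrite I0; apply: eq_hnorm => x _; rewrite subr0.
Qed.

Lemma integral_birkhoff_sq xi n : reg xi -> (forall x, X x -> P xi x = 0) ->
  I (fun x => birkhoff xi n x ^+ 2) = n%:R * I (fun x => xi x ^+ 2).
Proof.
apply: (functional_birkhoff_sq alpha01 P1).
- by move=> c f f' rf rf'; rewrite regular_integralD ?regular_integralZ//; exact: (regularZ alpha01).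
- exact: integral_transfer.
- by move=> f f' e; exact: eq_integral_on.
Qed.

Lemma gibbs_martingale_decomposition phi : reg phi -> I phi = 0 ->
  exists xi chi, [/\ reg xi, reg chi, forall x, X x -> P xi x = 0 &
    forall x, X x -> phi x = xi x + chi (shift x) - chi x].
Proof.
move=> rp I0; have [K' K'0 hK'] := mix_centered rp I0.
exact: (martingale_decomposition alpha01 P1 transfer_regular th01 K'0 rp hK').
Qed.
End InvariantIntegral.

Lemma expR_order1 (R : realType) (s : R) : `|expR s - 1 - s| <= s ^+ 2 * expR `|s|.
Proof.
have h0 : 1 + s <= expR s by exact: expR_ge1Dx.
have h1 : 1 - s <= expR (- s) by exact: expR_ge1Dx.
have e : expR s * expR (- s) = 1 by rewrite -expRD subrr expR0.
have p : 0 < expR s by exact: expR_gt0.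
have q : 1 <= expR `|s| by rewrite -expR0 ler_expR.
have h2 : expR s - 1 <= s * expR s.
  by have := ler_wpM2l (ltW p) h1; rewrite e; lra.
rewrite ger0_norm; last by lra.
case: (lerP 0 s) => s0.
  rewrite ger0_norm//; have := ler_wpM2l s0 h2.
  by rewrite expr2; lra.
have s2 : 0 <= s ^+ 2 by exact: sqr_ge0.
apply: (@le_trans _ _ (s ^+ 2)); last by rewrite ler_peMr.
have : (- s) * (1 - expR s) <= (- s) * (- s) by rewrite ler_wpM2l//; lra.
by rewrite expr2; lra.
Qed.

(** The derivative of the second-order remainder is the first-order one, so the mean value theorem
    reduces to [expR_order1]. *)
Lemma expR_order2 (R : realType) (s : R) :
  `|expR s - 1 - s - s ^+ 2 / 2| <= `|s| ^+ 3 * expR `|s|.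
Proof.
pose f (t : R) : R := expR t - 1 - t - t ^+ 2 / 2.
have df (t : R) : is_derive t 1 f (expR t - 1 - t).
  by apply: is_derive_eq; rewrite /GRing.scale/=; field.
have cf : continuous f.
  by move=> t; apply: differentiable_continuous; exact/derivable1_diffP/(@ex_derive _ _ _ _ _ _ _ (df t)).
have f0 : f 0 = 0 by rewrite /f expR0; ring.
have bnd c : `|c| <= `|s| -> `|(expR c - 1 - c) * s| <= `|s| ^+ 3 * expR `|s|.
  move=> cs; rewrite normrM exprSr mulrAC; apply: ler_wpM2r => //.
  apply: (le_trans (expR_order1 c)); apply: ler_pM; rewrite ?sqr_ge0 ?expR_ge0 ?ler_expR//.
  by rewrite -[c ^+ 2]real_normK ?num_real// lerXn2r ?nnegrE.
rewrite -/(f s).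
case: (lerP 0 s) => s0.
  have [c cI] := MVT_segment s0 (fun t _ => df t) (continuous_subspaceT cf).
  move: cI; rewrite in_itv/= => /andP[c0 cs].
  rewrite f0 !subr0 => ->; apply: bnd.
  by rewrite !ger0_norm.
have [c cI] := MVT_segment (ltW s0) (fun t _ => df t) (continuous_subspaceT cf).
move: cI; rewrite in_itv/= => /andP[cs c0].
rewrite f0 !sub0r => e; rewrite -normrN e mulrN normrN; apply: bnd.
by rewrite !ler0_norm ?(ltW s0)// lerN2.
Qed.

(** * Exponential moments and moderate deviations *)

Section Perturbation.
Variable R : realType.

(** [T] and [s] stand for the second and third powers of the tilt, [w] for the approximate
    eigenfunction and [p] for the Taylor remainder; [1 / 2 <= w] is what turns additive errors into
    relative ones. *)
Lemma perturbation_ub (r K2 e1 T s w p : R) : 0 <= r -> 0 <= K2 -> 0 <= e1 -> 0 <= s ->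
  1 / 2 <= w -> - s <= T * (w - 1) -> p <= K2 * s ->
  w + T * r / 2 + p <= (1 + (r * T / 2 + (e1 + r + 2 * K2) * s)) * w.
Proof.
move=> r0 k0 e0 s0 w1 q2 p2.
have sw : 0 <= s * (w - 1 / 2) by rewrite mulr_ge0//; lra.
have f1 := mulr_ge0 r0 sw; have f2 := mulr_ge0 k0 sw; have f3 := mulr_ge0 e0 sw.
have f4 := mulr_ge0 e0 s0; have q4 := ler_wpM2l r0 q2.
lra.
Qed.

Lemma perturbation_lb (r K2 e1 T s w p : R) : 0 <= r -> 0 <= K2 -> 0 <= s ->
  1 / 2 <= w -> T * (w - 1) <= s -> - (K2 * s) <= p ->
  (1 + (r * T / 2 - (e1 + r + 2 * K2) * s) + e1 * s) * w <= w + T * r / 2 + p.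
Proof.
move=> r0 k0 s0 w1 q1 p1.
have sw : 0 <= s * (w - 1 / 2) by rewrite mulr_ge0//; lra.
have f1 := mulr_ge0 r0 sw; have f2 := mulr_ge0 k0 sw.
have q3 := ler_wpM2l r0 q1.
lra.
Qed.

(** In [K1] the summand [expR 1] pays for the quadratic error of [expR] on [[-1, 1]], [rho] for the
    deviation of [1 + s^2 * h] from [1], and [2 * K2] for the remainder [p]. *)
Lemma perturbation_bounds (rho B K2 s h p : R) : let K1 := expR 1 + rho + 2 * K2 in
  0 <= rho -> 0 <= K2 -> 0 <= s -> s <= 1 / 2 -> s * B <= 1 / 2 ->
  s * (rho / 2 + K1) ^+ 2 <= 1 / 2 -> `|h| <= B -> `|p| <= K2 * s ^+ 3 -> 1 / 2 <= 1 + s ^+ 2 * h ->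
  1 + s ^+ 2 * h + s ^+ 2 * rho / 2 + p <=
    expR (rho * s ^+ 2 / 2 + K1 * s ^+ 3) * (1 + s ^+ 2 * h) /\
  expR (rho * s ^+ 2 / 2 - K1 * s ^+ 3) * (1 + s ^+ 2 * h) <=
    1 + s ^+ 2 * h + s ^+ 2 * rho / 2 + p.
Proof.
move=> K1 rho0 K20 s0 s1 sB sQ; rewrite !ler_norml => /andP[ex1 ex2] /andP[p1 p2].
have e1_ge1 : 1 <= expR 1 :> R by rewrite -[leLHS]expR0 ler_expR.
have K1E : K1 = expR 1 + rho + 2 * K2 by [].
clearbody K1; set e1 := expR 1 in e1_ge1 K1E *.
set w := 1 + s ^+ 2 * h => w1.
have w0 : 0 <= w by lra.
have s2 : 0 <= s ^+ 2 by rewrite exprn_ge0.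
have s3 : 0 <= s ^+ 3 by rewrite exprn_ge0.
have wE : s ^+ 2 * (w - 1) = s ^+ 3 * (s * h) by rewrite /w; ring.
have q1 : s ^+ 2 * (w - 1) <= s ^+ 3.
  by rewrite wE ler_piMr//; have := ler_wpM2l s0 ex2; lra.
have q2 : - s ^+ 3 <= s ^+ 2 * (w - 1).
  rewrite wE -[X in - X]mulr1 -mulrN ler_wpM2l//.
  by have := ler_wpM2l s0 ex1; lra.
clearbody w; clear wE ex1 ex2 sB.
have e10 : 0 <= e1 by lra.
have K10 : 0 <= K1 by lra.
split.
  have h1 := expR_ge1Dx (rho * s ^+ 2 / 2 + K1 * s ^+ 3).
  by apply: le_trans (ler_wpM2r w0 h1); rewrite K1E; exact: perturbation_ub.
pose z := rho * s ^+ 2 / 2 - K1 * s ^+ 3.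
have K1s : K1 * s ^+ 3 <= K1 * s ^+ 2 by rewrite ler_wpM2l// exprS ler_piMl//; lra.
have z1 : `|z| <= s ^+ 2 * (rho / 2 + K1).
  have a1 : 0 <= K1 * s ^+ 3 by exact: mulr_ge0.
  have a2 : 0 <= rho * s ^+ 2 / 2 by rewrite divr_ge0// mulr_ge0.
  by rewrite /z (le_trans (ler_normB _ _))// (ger0_norm a1) (ger0_norm a2); lra.
set Q := (rho / 2 + K1) ^+ 2 in sQ *.
have Q0 : 0 <= Q by exact: sqr_ge0.
have Q2 : rho / 2 + K1 <= Q by rewrite /Q expr2 ler_peMl//; lra.
have z2 : `|z| <= 1.
  have h1 := ler_wpM2l s2 Q2.
  have h2 : s ^+ 2 * Q <= s * Q by rewrite ler_wpM2r// expr2 ler_piMr//; lra.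
  by apply: (le_trans z1); apply: (le_trans h1); lra.
have z3 : z ^+ 2 <= s ^+ 3.
  rewrite -[z ^+ 2]real_normK ?num_real//.
  apply: (@le_trans _ _ ((s ^+ 2 * (rho / 2 + K1)) ^+ 2)).
    by rewrite lerXn2r ?nnegrE// (le_trans (normr_ge0 z)).
  rewrite exprMn -/Q (_ : (s ^+ 2) ^+ 2 * Q = s ^+ 3 * (s * Q)); last by ring.
  by rewrite ler_piMr//; lra.
have z4 : expR z <= 1 + z + e1 * s ^+ 3.
  have := expR_order1 z; rewrite ler_norml => /andP[_].
  have : z ^+ 2 * expR `|z| <= s ^+ 3 * e1.
    by apply: ler_pM; rewrite ?sqr_ge0 ?expR_ge0// ler_expR.
  by move=> h1 h2; have := le_trans h2 h1; lra.
rewrite -/z; apply: (le_trans (ler_wpM2r w0 z4)); rewrite /z K1E; exact: perturbation_lb.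
Qed.
End Perturbation.

Lemma compare_bounds (R : realType) (D K a b p p' q q' : R) : p' <= p -> q <= q' ->
  p / 4 <= b -> b <= 4 * q -> a <= D * b -> b <= D * a -> 0 <= a -> 0 <= q -> 1 <= D -> 0 < K ->
  p' / (4 * D + K) <= a <= (4 * D + K) * q'.
Proof.
move=> pp qq pb bq ab ba a0 q0 D1 K0; have D0 : 0 <= D by lra.
apply/andP; split.
  have h1 : 0 <= K * a by rewrite mulr_ge0// ltW.
  by rewrite ler_pdivrMr; lra.
have h1 := ler_wpM2l D0 bq.
have KD : 0 <= 4 * D + K by lra.
have h2 := ler_wpM2l KD qq.
have h3 : 0 <= K * q by rewrite mulr_ge0// ltW.
by lra.
Qed.

Section MomentGeneratingFunction.
Variables (R : realType) (k : nat) (A : 'M[int]_k.+2) (mu : probability (Sig k) R).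
Variables (alpha K th : R) (g : Sig k -> R).
Hypothesis alpha01 : 0 < alpha < 1.
Hypothesis muX : mu (SigmaA A) = 1%E.
Hypothesis mu_inv : forall E : set (Sig k), measurable E -> mu (@shift k @^-1` E) = mu E.
Implicit Types (phi psi chi : Sig k -> R) (x y z : Sig k) (H : R) (E : set (Sig k)).
Local Notation X := (SigmaA A).
Local Notation I := (integral_on A mu).
Local Notation reg := (regular A alpha).
Let P := transfer A (fun y => expR (g y)).
Hypothesis P1 : forall x, X x -> P (fun=> 1) x = 1.
Hypothesis th01 : 0 < th < 1.
Hypothesis K0 : 0 < K.
Hypothesis mix : forall H phi, 0 < H -> hnorm A alpha H phi -> forall n,
    hnorm A alpha (K * H * th ^+ n) (fun x => iter n P phi x - I phi).
Variable xi : Sig k -> R.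
Hypothesis rxi : reg xi.
Hypothesis Pxi : forall x, X x -> P xi x = 0.
Let rho := I (fun x => xi x ^+ 2).

Lemma tilted_iterate t n phi x :
  iter n P (fun y => expR (t * birkhoff xi n y) * phi y) x =
  iter n (transfer A (fun y => expR (g y + t * xi y))) phi x.
Proof.
rewrite /P !iter_transfer_exp; congr (iter n _ _ x); apply/funext => y.
rewrite mulrA -expRD; congr (expR _ * _).
by rewrite /birkhoff mulr_sumr -big_split.
Qed.

Lemma variance_ge0 : 0 <= rho.
Proof.
rewrite -(integral_cst (A := A) muX 0); apply: (regular_integral_le mu alpha01).
- exact: (regular_cst A alpha01).
- exact: (regularX alpha01 2 rxi).
- by move=> x _; exact: sqr_ge0.
Qed.

(* [1 + t^2 eta] is the second-order expansion of the leading eigenfunction of the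
   operator with weight [exp (g + t xi)], whose eigenvalue is
   [1 + rho t^2 / 2 + O(t^3)]. *)
Lemma corrector : exists2 eta, reg eta &
  forall x, X x -> eta x - P eta x = (P (fun y => xi y ^+ 2) x - rho) / 2.
Proof.
have r2 := regularX alpha01 2 rxi.
have rP := transfer_regular alpha01 mix r2.
pose psi x := 1 / 2 * (P (fun y => xi y ^+ 2) x - rho).
have rpsi : reg psi.
  apply: (regularZ alpha01); apply: (regularB alpha01) => //; exact: (regular_cst A alpha01).
have I0 : I psi = 0.
  rewrite (regular_integralZ alpha01 muX); last first.
    by apply: (regularB alpha01) => //; exact: (regular_cst A alpha01).
  rewrite (regular_integralB alpha01 muX)//; last exact: (regular_cst A alpha01).
  by rewrite (integral_transfer alpha01 muX th01 mix r2) (integral_cst muX) subrr mulr0.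
have [K' K'0 hK'] := mix_centered K0 mix rpsi I0.
have [eta [re he]] := transfer_poisson alpha01 P1 th01 K'0 hK'.
by exists eta => // x Xx; rewrite he// /psi; field.
Qed.

Lemma tilted_step : exists eta t0 K1, [/\ reg eta, 0 < t0, 0 < K1 &
  forall t, `|t| <= t0 -> forall x, X x ->
    [/\ 1 / 2 <= 1 + t ^+ 2 * eta x <= 2,
     transfer A (fun y => expR (g y + t * xi y)) (fun y => 1 + t ^+ 2 * eta y) x <=
       expR (rho * t ^+ 2 / 2 + K1 * `|t| ^+ 3) * (1 + t ^+ 2 * eta x) &
     expR (rho * t ^+ 2 / 2 - K1 * `|t| ^+ 3) * (1 + t ^+ 2 * eta x) <=
     transfer A (fun y => expR (g y + t * xi y)) (fun y => 1 + t ^+ 2 * eta y) x]].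
Proof.
have [eta reta heta] := corrector.
have [Bx Bx0 [bx _]] := rxi; have [Be Be0 [be _]] := reta.
pose B := 1 + Bx + Be.
have B1 : 1 <= B by rewrite /B; lra.
have B0 : 0 < B by lra.
have bxB x : X x -> `|xi x| <= B by move=> /bx; rewrite /B; lra.
have beB x : X x -> `|eta x| <= B by move=> /be; rewrite /B; lra.
clearbody B.
have rho0 := variance_ge0.
pose e1 := expR (1 : R).
have e1_ge1 : 1 <= e1 by rewrite /e1 -expR0 ler_expR.
pose K2 := 2 * B ^+ 3 * e1 + 2 * B ^+ 2.
have K2_ge0 : 0 <= K2.
  by apply: addr_ge0; rewrite !mulr_ge0 ?exprn_ge0 ?(ltW B0)//; lra.
pose K1 := e1 + rho + 2 * K2.
have K1_ge1 : 1 <= K1 by rewrite /K1; lra.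
pose Q := (rho / 2 + K1) ^+ 2.
have Q1 : 1 <= Q by rewrite /Q exprn_ege1//; lra.
have BQ : 0 < 2 * B * Q by rewrite !mulr_gt0//; lra.
(* As [B] and [Q] are at least [1], this radius makes both [s * B] and [s * Q] at most one half. *)
exists eta, (2 * B * Q)^-1, K1; split => //; [by rewrite invr_gt0|by lra|].
move=> t; rewrite -[X in _ <= X]mul1r ler_pdivlMr// => tb x Xx.
pose s := `|t|; have s0 : 0 <= s by exact: normr_ge0.
rewrite -/s in tb *.
have t2 : t ^+ 2 = s ^+ 2 by rewrite /s real_normK// num_real.
have sB : s * B <= 1 / 2.
  have : 0 <= s * B * (Q - 1) by rewrite !mulr_ge0//; lra.
  lra.
have sQ : s * Q <= 1 / 2.
  have : 0 <= s * Q * (B - 1) by rewrite !mulr_ge0//; lra.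
  lra.
have s1 : s <= 1 / 2.
  have : 0 <= s * (B - 1) by rewrite mulr_ge0//; lra.
  lra.
have s2 : 0 <= s ^+ 2 by rewrite exprn_ge0.
have s3 : 0 <= s ^+ 3 by rewrite exprn_ge0.
have s2B : s ^+ 2 * B <= 1 / 2.
  by rewrite expr2 -mulrA; have := ler_wpM2l s0 sB; lra.
have wbnd y : X y -> 1 / 2 <= 1 + t ^+ 2 * eta y <= 2.
  move=> /beB; rewrite ler_norml t2 => /andP[h1 h2].
  have := ler_wpM2l s2 h1; have := ler_wpM2l s2 h2; move=> *; apply/andP; split; lra.
(* What remains of [expR (t * xi) * (1 + t^2 * eta)] beyond the second order in [t]. *)
pose r y := expR (t * xi y) * (1 + t ^+ 2 * eta y) -
  (t ^+ 2 * (1 / 2 * xi y ^+ 2 + eta y) + (t * xi y + 1)).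
have rb y : X y -> `|r y| <= K2 * s ^+ 3.
  move=> Xy; have bxy := bxB y Xy; have bey := beB y Xy; have /andP[w1 w2] := wbnd y Xy.
  have -> : r y = (expR (t * xi y) - 1 - t * xi y - (t * xi y) ^+ 2 / 2) * (1 + t ^+ 2 * eta y) +
      (t * xi y + (t * xi y) ^+ 2 / 2) * (t ^+ 2 * eta y) by rewrite /r; field.
  have sx : `|t * xi y| <= s * B by rewrite normrM; apply: ler_pM.
  rewrite (_ : K2 * s ^+ 3 = ((s * B) ^+ 3 * e1) * 2 + (2 * (s * B)) * (s ^+ 2 * B)); last first.
    by rewrite /K2; ring.
  apply: (le_trans (ler_normD _ _)); apply: lerD.
    rewrite normrM; apply: ler_pM => //; last by rewrite ger0_norm; lra.
    apply: (le_trans (expR_order2 _)); apply: ler_pM; rewrite ?exprn_ge0 ?expR_ge0//.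
      by rewrite lerXn2r ?nnegrE// mulr_ge0// ltW.
    by rewrite ler_expR; lra.
  rewrite normrM [X in _ * X]normrM normrX.
  apply: ler_pM; rewrite ?mulr_ge0 ?exprn_ge0//; last by rewrite ler_wpM2l.
  apply: (le_trans (ler_normD _ _)).
  have h2 : `|(t * xi y) ^+ 2 / 2| = `|t * xi y| ^+ 2 / 2.
    by rewrite normrM normrX (ger0_norm (_ : 0 <= 2^-1)).
  have sx2 : `|t * xi y| ^+ 2 <= (s * B) * 1.
    by rewrite expr2; apply: ler_pM => //; lra.
  by have := le_trans (normr_ge0 _) sx; rewrite h2; lra.
(* The first-order term vanishes because [P xi = 0]; the corrector equation turns
   [P (xi^2 / 2 + eta)] into [eta + rho / 2]. *)
have TE : transfer A (fun y => expR (g y + t * xi y)) (fun y => 1 + t ^+ 2 * eta y) x =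
    1 + t ^+ 2 * (eta x + rho / 2) + P r x.
  have -> : transfer A (fun y => expR (g y + t * xi y)) (fun y => 1 + t ^+ 2 * eta y) x =
      P (fun y => (t ^+ 2 * (1 / 2 * xi y ^+ 2 + eta y) + (t * xi y + 1)) + r y) x.
    by apply: eq_bigr => a _; rewrite /r expRD; ring.
  have h := heta x Xx.
  rewrite /P transferD !transfer_lin -/P P1// Pxi//.
  have -> : P eta x = eta x - (P (fun y => xi y ^+ 2) x - rho) / 2 by rewrite -h; ring.
  by field.
have := transfer_norm_le P1 rb Xx; rewrite TE -/P.
move: (P r x) => p; rewrite ler_norml => /andP[p1 p2].
have /andP[w1 w2] := wbnd x Xx.
have ex := beB x Xx; rewrite ler_norml in ex; have /andP[ex1 ex2] := ex.
rewrite (_ : 1 + t ^+ 2 * (eta x + rho / 2) + p =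
  1 + t ^+ 2 * eta x + t ^+ 2 * rho / 2 + p); last by field.
have pn : `|p| <= K2 * s ^+ 3 by rewrite ler_norml p1 p2.
have sBQ : s * (rho / 2 + K1) ^+ 2 <= 1 / 2 by exact: sQ.
rewrite -/s t2 in w1 w2 *.
have [ub lb] := perturbation_bounds rho0 K2_ge0 s0 s1 sB sBQ (beB x Xx) pn w1.
by split => //; apply/andP.
Qed.
End MomentGeneratingFunction.

Section MomentBounds.
Variables (R : realType) (k : nat) (A : 'M[int]_k.+2) (mu : probability (Sig k) R).
Variables (alpha K th : R) (g : Sig k -> R).
Hypothesis alpha01 : 0 < alpha < 1.
Hypothesis muX : mu (SigmaA A) = 1%E.
Hypothesis mu_inv : forall E : set (Sig k), measurable E -> mu (@shift k @^-1` E) = mu E.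
Implicit Types (psi : Sig k -> R) (x y z : Sig k) (H : R) (E : set (Sig k)).
Local Notation X := (SigmaA A).
Local Notation I := (integral_on A mu).
Local Notation reg := (regular A alpha).
Let P := transfer A (fun y => expR (g y)).
Hypothesis P1 : forall x, X x -> P (fun=> 1) x = 1.
Hypothesis th01 : 0 < th < 1.
Hypothesis K0 : 0 < K.
Hypothesis mix : forall H phi, 0 < H -> hnorm A alpha H phi -> forall n,
    hnorm A alpha (K * H * th ^+ n) (fun x => iter n P phi x - I phi).
Variables phi xi chi : Sig k -> R.
Hypothesis rxi : reg xi.
Hypothesis rchi : reg chi.
Hypothesis Pxi : forall x, X x -> P xi x = 0.
Hypothesis phiE : forall x, X x -> phi x = xi x + chi (shift x) - chi x.
Let rho := I (fun x => xi x ^+ 2).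

Let rphi : reg phi.
Proof.
apply: (@eq_regular _ _ _ _ (fun x => xi x + chi (shift x) - chi x)).
  by move=> x /set_mem Xx; rewrite phiE.
apply: (regularB alpha01) => //; apply: (regularD alpha01) => //.
exact: (regular_shift alpha01 1).
Qed.

(** By positivity of the tilted operator the one-step bounds on [w = 1 + t^2 * eta] iterate.
    Integrating turns [T^n w] into the exponential moment weighted by [w], and [1 / 2 <= w <= 2]
    removes the weight at the cost of the factors [4]. *)
Let mgf_martingale : exists t0 K1 : R, [/\ 0 < t0, 0 < K1 & forall t, `|t| <= t0 -> forall n,
  expR (n%:R * (rho * t ^+ 2 / 2 - K1 * `|t| ^+ 3)) / 4 <=
    I (fun x => expR (t * birkhoff xi n x)) <=
  4 * expR (n%:R * (rho * t ^+ 2 / 2 + K1 * `|t| ^+ 3))].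
Proof.
have [eta [t0 [K1 [reta t00 K10 step]]]] := tilted_step alpha01 muX P1 th01 K0 mix rxi Pxi.
exists t0, K1; split => // t tt0 n.
pose w x := 1 + t ^+ 2 * eta x.
have rw : reg w.
  by apply: (regularD alpha01); [exact: (regular_cst A alpha01)|exact: (regularZ alpha01)].
pose T := transfer A (fun y => expR (g y + t * xi y)).
have T0 x : X x -> 0 <= expR (g x + t * xi x) by move=> _; exact: expR_ge0.
have wb x : X x -> 1 / 2 <= w x <= 2 by move=> Xx; have [] := step t tt0 x Xx.
pose lu := rho * t ^+ 2 / 2 + K1 * `|t| ^+ 3.
pose ll := rho * t ^+ 2 / 2 - K1 * `|t| ^+ 3.
rewrite -/lu -/ll.
have ub x : X x -> iter n T w x <= expR (n%:R * lu) * w x.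
  elim: n x => [|n IH] x Xx; first by rewrite mul0r expR0 mul1r.
  rewrite iterS; apply: (@le_trans _ _ (iter 1 T (fun y => expR (n%:R * lu) * w y) x)).
    by apply: (@ler_iter_transfer _ _ _ _ _ 1).
  rewrite iter_transferZ -natr1 mulrDl mul1r expRD -mulrA ler_wpM2l ?expR_ge0//.
  by have [] := step t tt0 x Xx.
have lb x : X x -> expR (n%:R * ll) * w x <= iter n T w x.
  elim: n {ub} x => [|n IH] x Xx; first by rewrite mul0r expR0 mul1r.
  rewrite iterS; apply: (@le_trans _ _ (iter 1 T (fun y => expR (n%:R * ll) * w y) x)); last first.
    by apply: (@ler_iter_transfer _ _ _ _ _ 1).
  rewrite iter_transferZ -natr1 mulrDl mul1r expRD -mulrA ler_wpM2l ?expR_ge0//.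
  by have [] := step t tt0 x Xx.
have rE : reg (fun x => expR (t * birkhoff xi n x)).
  by apply: (regular_expR alpha01); apply: (regularZ alpha01); exact: regular_birkhoff.
have rEw : reg (fun x => expR (t * birkhoff xi n x) * w x) by exact: regularM.
have IE : I (fun x => expR (t * birkhoff xi n x) * w x) = I (iter n T w).
  rewrite -(integral_iter_transfer alpha01 muX th01 mix n rEw).
  by apply: eq_integral_on => x _; rewrite tilted_iterate.
have rT : reg (iter n T w).
  apply: (@eq_regular _ _ _ _ (iter n P (fun x => expR (t * birkhoff xi n x) * w x))).
    by move=> x _; rewrite tilted_iterate.
  exact: (iter_transfer_regular alpha01 mix).
have rc c : reg (fun=> c) by exact: (regular_cst A alpha01).
have e0 c : 0 <= expR c by exact: expR_ge0.
have u1 : I (iter n T w) <= 2 * expR (n%:R * lu).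
  rewrite -[leRHS](integral_cst (A := A) muX); apply: (regular_integral_le mu alpha01) => // x Xx.
  apply: (le_trans (ub x Xx)); rewrite mulrC ler_wpM2r//.
  by have /andP[] := wb x Xx.
have l1 : expR (n%:R * ll) / 2 <= I (iter n T w).
  rewrite -[leLHS](integral_cst (A := A) muX); apply: (regular_integral_le mu alpha01) => // x Xx.
  apply: le_trans (lb x Xx); rewrite ler_wpM2l//.
  by have /andP[] := wb x Xx; lra.
have u2 : I (fun x => expR (t * birkhoff xi n x)) <= 2 * I (iter n T w).
  rewrite -IE -(regular_integralZ alpha01 muX)//; apply: (regular_integral_le mu alpha01) => //.
    exact: (regularZ alpha01).
  move=> x Xx; rewrite mulrCA ler_peMr//; have /andP[] := wb x Xx; lra.
have l2 : I (iter n T w) <= 2 * I (fun x => expR (t * birkhoff xi n x)).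
  rewrite -IE -(regular_integralZ alpha01 muX)//; apply: (regular_integral_le mu alpha01) => //.
    exact: (regularZ alpha01).
  by move=> x Xx; rewrite mulrC ler_wpM2r//; have /andP[] := wb x Xx.
by apply/andP; split; lra.
Qed.

(** The sums of [phi] and [xi] differ by the bounded function [chi o shift^n - chi], which changes
    the moments by at most the factor [D]. *)
Theorem mgf_bounds : exists t0 K1 : R, [/\ 0 < t0, 1 <= K1 & forall t, `|t| <= t0 -> forall n,
  expR (n%:R * (rho * t ^+ 2 / 2 - K1 * `|t| ^+ 3)) / K1 <=
    I (fun x => expR (t * birkhoff phi n x)) <=
  K1 * expR (n%:R * (rho * t ^+ 2 / 2 + K1 * `|t| ^+ 3))].
Proof.
have [t0 [K1 [t00 K10 H]]] := mgf_martingale.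
have [B B0 [bchi _]] := rchi.
pose D := expR (2 * B * t0).
have D1 : 1 <= D by rewrite /D -expR0 ler_expR !mulr_ge0// ltW.
exists t0, (4 * D + K1); split => //; first by lra.
move=> t tt0 n; have /andP[lo up] := H t tt0 n.
have s0 : 0 <= `|t| ^+ 3 by rewrite exprn_ge0.
have e0 c : 0 <= expR c by exact: expR_ge0.
have rS f : reg f -> reg (fun x => expR (t * birkhoff f n x)).
  by move=> rf; apply: (regular_expR alpha01); apply: (regularZ alpha01); exact: regular_birkhoff.
have cmp x : X x -> `|t * birkhoff phi n x - t * birkhoff xi n x| <= 2 * B * t0.
  move=> Xx; rewrite (birkhoff_cobound n phiE Xx) -mulrBr normrM mulrC.
  apply: ler_pM => //; have h1 := bchi _ (SigmaA_shift n Xx); have h2 := bchi x Xx.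
  move: h1 h2; rewrite !ler_norml => /andP[? ?] /andP[? ?]; apply/andP; split; lra.
have c1 : I (fun x => expR (t * birkhoff phi n x)) <= D * I (fun x => expR (t * birkhoff xi n x)).
  rewrite -(regular_integralZ alpha01 muX); last exact: rS.
  apply: (regular_integral_le mu alpha01); [exact: rS|by apply: (regularZ alpha01); exact: rS|].
  move=> x Xx; rewrite /D -expRD ler_expR.
  by have := cmp x Xx; rewrite ler_norml lerBlDr => /andP[_].
have c2 : I (fun x => expR (t * birkhoff xi n x)) <= D * I (fun x => expR (t * birkhoff phi n x)).
  rewrite -(regular_integralZ alpha01 muX); last exact: rS.
  apply: (regular_integral_le mu alpha01); [exact: rS|by apply: (regularZ alpha01); exact: rS|].
  move=> x Xx; rewrite /D -expRD ler_expR.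
  by have := cmp x Xx; rewrite distrC ler_norml lerBlDr => /andP[_].
have I0 : 0 <= I (fun x => expR (t * birkhoff phi n x)).
  rewrite -(integral_cst (A := A) muX 0); apply: (regular_integral_le mu alpha01).
  - exact: (regular_cst A alpha01).
  - exact: rS.
  - by [].
have D0 : 0 <= 4 * D by rewrite mulr_ge0// (le_trans ler01).
have k1 : K1 <= 4 * D + K1 by rewrite lerDr.
have pp : expR (n%:R * (rho * t ^+ 2 / 2 - (4 * D + K1) * `|t| ^+ 3)) <=
    expR (n%:R * (rho * t ^+ 2 / 2 - K1 * `|t| ^+ 3)).
  by rewrite ler_expR ler_wpM2l// lerD2l lerN2 ler_wpM2r.
have qq : expR (n%:R * (rho * t ^+ 2 / 2 + K1 * `|t| ^+ 3)) <=
    expR (n%:R * (rho * t ^+ 2 / 2 + (4 * D + K1) * `|t| ^+ 3)).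
  by rewrite ler_expR ler_wpM2l// lerD2l ler_wpM2r.
exact (compare_bounds pp qq lo up c1 c2 I0 (expR_ge0 _) D1 K10).
Qed.
End MomentBounds.

Section Tails.
Variables (R : realType) (k : nat) (A : 'M[int]_k.+2) (mu : probability (Sig k) R).
Variables (alpha : R) (phi : Sig k -> R) (rho t0 K1 : R).
Hypothesis alpha01 : 0 < alpha < 1.
Hypothesis muX : mu (SigmaA A) = 1%E.
Implicit Types (x y z : Sig k) (E : set (Sig k)).
Local Notation X := (SigmaA A).
Local Notation I := (integral_on A mu).
Local Notation V := (birkhoff phi).
Hypothesis rphi : regular A alpha phi.
Hypothesis rho0 : 0 < rho.
Hypothesis t00 : 0 < t0.
Hypothesis K11 : 1 <= K1.
Hypothesis mgf : forall t, `|t| <= t0 -> forall n,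
  expR (n%:R * (rho * t ^+ 2 / 2 - K1 * `|t| ^+ 3)) / K1 <=
    I (fun x => expR (t * V n x)) <=
  K1 * expR (n%:R * (rho * t ^+ 2 / 2 + K1 * `|t| ^+ 3)).

Let K10 : 0 < K1. Proof. exact: lt_le_trans K11. Qed.

Let rE n t : regular A alpha (fun x => expR (t * V n x)).
Proof. by apply: (regular_expR alpha01); apply: (regularZ alpha01); exact: regular_birkhoff. Qed.

Lemma chernoff n E (t y : R) : determined A n E -> (forall x, E x -> y <= V n x) -> 0 <= t <= t0 ->
  pr mu E <= K1 * expR (n%:R * (rho * t ^+ 2 / 2 + K1 * t ^+ 3) - t * y).
Proof.
move=> dE yE /andP[t_ge0 tt0].
have tt : `|t| <= t0 by rewrite ger0_norm.
have /andP[_ up] := mgf tt n; rewrite ger0_norm// in up.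
have h := @determined_markov R k A mu alpha alpha01 muX n E _ (expR (t * y)) dE (rE n t).
have {}h : expR (t * y) * pr mu E <= I (fun x => expR (t * V n x)).
  apply: h => [x _|x /yE h]; first exact: expR_ge0.
  by rewrite ler_expR ler_wpM2l.
rewrite expRD expRN mulrA ler_pdivlMr ?expR_gt0// mulrC.
exact: le_trans up.
Qed.

Lemma tail_ub d : 0 < d < 1 -> exists2 c0, 0 < c0 & forall n E (y : R), (0 < n)%N ->
  determined A n E -> (forall x, E x -> y <= V n x) -> 0 <= y <= c0 * n%:R ->
  pr mu E <= K1 * expR (- ((1 - d) * (y ^+ 2 / (2 * rho * n%:R)))).
Proof.
move=> /andP[d0 d1].
(* For tilts up to [tau] the cubic term is at most the fraction [d] of the Gaussian exponent
   [y^2 / (2 * rho * n)]. *)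
pose tau := Num.min t0 (rho * d / (2 * K1)).
have tau0 : 0 < tau by rewrite lt_min t00 divr_gt0 ?mulr_gt0.
exists (rho * tau); first exact: mulr_gt0.
move=> n E y n0 dE yE /andP[y0 yc].
have nR : 0 < n%:R :> R by rewrite ltr0n.
(* The minimizer of [n * rho * t^2 / 2 - t * y]. *)
pose t := y / (rho * n%:R).
have rn : 0 < rho * n%:R by exact: mulr_gt0.
have tge0 : 0 <= t by rewrite divr_ge0// ltW.
have ttau : t <= tau by rewrite /t ler_pdivrMr//; lra.
have yE' : y = t * (rho * n%:R) by rewrite /t divfK// gt_eqF.
apply: (le_trans (chernoff dE yE (_ : 0 <= t <= t0))).
  by rewrite tge0; apply: (le_trans ttau); rewrite ge_min lexx.
rewrite ler_pM2l// ler_expR.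
have -> : y ^+ 2 / (2 * rho * n%:R) = n%:R * rho * t ^+ 2 / 2.
  by rewrite yE'; field; rewrite !gt_eqF.
have -> : t * y = 2 * (n%:R * rho * t ^+ 2 / 2) by rewrite yE'; field.
have tk : K1 * t <= rho * d / 2.
  have : t <= rho * d / (2 * K1) by apply: (le_trans ttau); rewrite ge_min lexx orbT.
  by rewrite ler_pdivlMr ?mulr_gt0//; lra.
have q0 : 0 <= n%:R * t ^+ 2 by rewrite mulr_ge0 ?sqr_ge0// ltW.
have := ler_wpM2l q0 tk; rewrite exprSr; lra.
Qed.

(* Under the measure tilted by [exp (t V)] the sum [V] concentrates near [y]: the
   two last terms bound [exp (t V)] off the window [(1 - d) y <= V <= (1 + d) y]. *)
Lemma tilting_pointwise (t s y d Q v i : R) : 0 <= s -> 0 <= t -> t * y = 2 * Q ->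
  s * y = 2 * d * Q -> 0 <= i -> ((1 - d) * y <= v -> i = 1) ->
  expR (t * v) <= expR (2 * (1 + d) * Q) * i +
    (expR (2 * d * (1 - d) * Q + (t - s) * v) + expR (- (2 * d * (1 + d) * Q) + (t + s) * v)).
Proof.
move=> s0 t0' ty sy i0 i1; have e0 (c : R) : 0 <= expR c by exact: expR_ge0.
have i0' : 0 <= expR (2 * (1 + d) * Q) * i by rewrite mulr_ge0.
have e1 := e0 (- (2 * d * (1 + d) * Q) + (t + s) * v).
have e2 := e0 (2 * d * (1 - d) * Q + (t - s) * v).
case: (ltP v ((1 - d) * y)) => h1.
  have h : expR (t * v) <= expR (2 * d * (1 - d) * Q + (t - s) * v).
    rewrite ler_expR (_ : 2 * d * (1 - d) * Q = s * ((1 - d) * y)).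
      by have := ler_wpM2l s0 (ltW h1); lra.
    by rewrite [RHS]mulrCA sy; ring.
  by lra.
case: (ltP ((1 + d) * y) v) => h2.
  have h : expR (t * v) <= expR (- (2 * d * (1 + d) * Q) + (t + s) * v).
    rewrite ler_expR (_ : 2 * d * (1 + d) * Q = s * ((1 + d) * y)).
      by have := ler_wpM2l s0 (ltW h2); lra.
    by rewrite [RHS]mulrCA sy; ring.
  by lra.
have h : expR (t * v) <= expR (2 * (1 + d) * Q).
  rewrite ler_expR (_ : 2 * (1 + d) * Q = t * ((1 + d) * y)); first exact: ler_wpM2l.
  by rewrite [RHS]mulrCA ty; ring.
by rewrite i1// mulr1; lra.
Qed.

Lemma half_le (a b : R) : 2 * a <= b -> a <= b / 2.
Proof. by lra. Qed.

Lemma quarter_split (a m p c d F : R) : a <= m -> m <= p + (c + d) -> c <= F -> d <= F ->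
  F <= a / 4 -> a / 2 <= p.
Proof. by lra. Qed.

Lemma tail_exponent (d Q : R) : 0 < d -> d <= 1 / 2 -> 0 <= Q ->
  2 * (1 + d) * Q + - ((1 + 3 * d) * Q) <= Q - Q * d ^+ 2 / 4.
Proof.
move=> d0 d1 Q0; have : Q * (d ^+ 2 / 4) <= Q * d.
  by rewrite ler_wpM2l// expr2 -mulrA ler_piMr ?(ltW d0)//; lra.
by lra.
Qed.

Lemma half_rescale (K e1 e2 e3 : R) : 0 < K -> e1 * e2 <= e3 -> e1 * ((2 * K)^-1 * e2) <= e3 / K / 2.
Proof.
move=> K0 h; have -> : e3 / K / 2 = (2 * K)^-1 * e3 by field; rewrite gt_eqF.
by rewrite mulrCA ler_wpM2l// invr_ge0 mulr_ge0// ltW.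
Qed.

(** Cramér's change of measure: the moment at tilt [t] is compared with the moments at [t - s] and
    [t + s], which bound the contribution from outside the window around [y]. What is left must come
    from [E]. *)
Lemma tail_lb d : 0 < d <= 1 / 2 -> exists c0 Q0 kap, [/\ 0 < c0, 0 < kap &
  forall n E (y : R), (0 < n)%N -> determined A n E ->
  (forall x, X x -> (1 - d) * y <= V n x -> E x) -> 0 <= y <= c0 * n%:R ->
  Q0 <= y ^+ 2 / (2 * rho * n%:R) ->
  kap * expR (- ((1 + 3 * d) * (y ^+ 2 / (2 * rho * n%:R)))) <= pr mu E].
Proof.
move=> /andP[d0 d1].
have dm : 0 <= 1 - d <= 2 by apply/andP; split; lra.
have dp : 0 <= 1 + d <= 2 by apply/andP; split; lra.
(* The tilts used reach [2 * t]. The factor [64] makes the cubic terms at tilts up to [2 * t] at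
   most [Q * d^2 / 4]. *)
pose tau := Num.min (t0 / 2) (rho * d ^+ 2 / (64 * K1)).
have d2 : 0 < d ^+ 2 by rewrite exprn_gt0.
have tau0 : 0 < tau by rewrite lt_min divr_gt0//= divr_gt0 ?mulr_gt0.
(* The main term has exponent [Q * (1 - d^2 / 4)] and both error terms [Q * (1 - 3 * d^2 / 4)]. From
   the threshold on, the gap [Q * d^2 / 2] exceeds [ln (4 * K1^2)], so each error is at most a
   quarter of the main term. *)
exists (rho * tau), (2 * ln (4 * K1 ^+ 2) / d ^+ 2), (2 * K1)^-1.
split; [exact: mulr_gt0|by rewrite invr_gt0 mulr_gt0|].
move=> n E y n0 dE yE /andP[y0 yc].
have nR : 0 < n%:R :> R by rewrite ltr0n.
pose t := y / (rho * n%:R).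
have rn : 0 < rho * n%:R by exact: mulr_gt0.
have tge0 : 0 <= t by rewrite divr_ge0// ltW.
have ttau : t <= tau by rewrite /t ler_pdivrMr//; lra.
have t2 : 2 * t <= t0.
  have : t <= t0 / 2 by apply: (le_trans ttau); rewrite ge_min lexx.
  lra.
have tk : K1 * t <= rho * d ^+ 2 / 64.
  have : t <= rho * d ^+ 2 / (64 * K1) by apply: (le_trans ttau); rewrite ge_min lexx orbT.
  by rewrite ler_pdivlMr ?mulr_gt0//; lra.
have yE' : y = t * (rho * n%:R) by rewrite /t divfK// gt_eqF.
clearbody t.
have -> : y ^+ 2 / (2 * rho * n%:R) = n%:R * rho * t ^+ 2 / 2.
  by rewrite yE'; field; rewrite !gt_eqF.
set Q := n%:R * rho * t ^+ 2 / 2 => QQ0.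
have ty : t * y = 2 * Q by rewrite yE' /Q; field.
have Q_ge0 : 0 <= Q by rewrite /Q divr_ge0// mulr_ge0 ?sqr_ge0// mulr_ge0// ltW.
have cub a : 0 <= a <= 2 -> n%:R * (K1 * (a * t) ^+ 3) <= Q * d ^+ 2 / 4.
  move=> /andP[a0 a2].
  have a3 : a ^+ 3 <= 2 ^+ 3 by rewrite lerXn2r ?nnegrE.
  have q0 : 0 <= n%:R * t ^+ 2 by rewrite mulr_ge0 ?sqr_ge0// ltW.
  have := ler_wpM2l q0 tk.
  have : 0 <= n%:R * (K1 * t ^+ 3) by rewrite !mulr_ge0 ?exprn_ge0 ?(ltW K10) ?(ltW nR).
  move=> p0 h1; have := ler_wpM2r p0 a3; rewrite /Q exprMn; move: h1; rewrite exprSr; lra.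
have E1 : expR (Q - Q * d ^+ 2 / 4) / K1 <= I (fun x => expR (t * V n x)).
  have tt0 : `|t| <= t0 by rewrite ger0_norm//; lra.
  have /andP[lo _] := mgf tt0 n; apply: le_trans lo.
  rewrite ler_pM2r ?invr_gt0// ler_expR ger0_norm//.
  have := cub 1 _; rewrite mul1r => /(_ _)h; have {}h := h ltac:(by rewrite ler01 ler1n).
  by rewrite /Q in h *; lra.
pose s := d * t.
have sy : s * y = 2 * d * Q by rewrite /s -mulrA ty; ring.
have s0 : 0 <= s by rewrite mulr_ge0// ltW.
have st : s <= t by rewrite /s ler_piMl//; lra.
have E2 : I (fun x => expR ((t - s) * V n x)) <= K1 * expR (Q * (1 - d) ^+ 2 + Q * d ^+ 2 / 4).
  have ts0 : 0 <= t - s by lra.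
  have tt0 : `|t - s| <= t0 by rewrite ger0_norm//; lra.
  have /andP[_ up] := mgf tt0 n; apply: (le_trans up).
  rewrite ler_pM2l// ler_expR ger0_norm// mulrDr.
  have -> : t - s = (1 - d) * t by rewrite /s; ring.
  apply: lerD; last exact: cub.
  by rewrite /Q le_eqVlt; apply/orP; left; apply/eqP; field.
have E3 : I (fun x => expR ((t + s) * V n x)) <= K1 * expR (Q * (1 + d) ^+ 2 + Q * d ^+ 2 / 4).
  have ts0 : 0 <= t + s by lra.
  have tt0 : `|t + s| <= t0 by rewrite ger0_norm//; lra.
  have /andP[_ up] := mgf tt0 n; apply: (le_trans up).
  rewrite ler_pM2l// ler_expR ger0_norm// mulrDr.
  have -> : t + s = (1 + d) * t by rewrite /s; ring.
  apply: lerD; last exact: cub.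
  by rewrite /Q le_eqVlt; apply/orP; left; apply/eqP; field.
clearbody Q s.
have rI := regular_indic alpha01 dE.
have rZ c f : regular A alpha f -> regular A alpha (fun x => c * f x) by exact: (regularZ alpha01).
have rD f h : regular A alpha f -> regular A alpha h -> regular A alpha (fun x => f x + h x).
  exact: (regularD alpha01).
have e0 (c : R) : 0 <= expR c by exact: expR_ge0.
have main : I (fun x => expR (t * V n x)) <= expR (2 * (1 + d) * Q) * pr mu E +
    (expR (2 * d * (1 - d) * Q) * I (fun x => expR ((t - s) * V n x)) +
     expR (- (2 * d * (1 + d) * Q)) * I (fun x => expR ((t + s) * V n x))).
  rewrite -(integral_indic_determined mu dE).
  have r1 := rZ (expR (2 * (1 + d) * Q)) _ rI.
  have r2 := rZ (expR (2 * d * (1 - d) * Q)) _ (rE n (t - s)).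
  have r3 := rZ (expR (- (2 * d * (1 + d) * Q))) _ (rE n (t + s)).
  rewrite -!(regular_integralZ alpha01 muX) //.
  rewrite -(regular_integralD mu alpha01 r2 r3) -(regular_integralD mu alpha01 r1 (rD _ _ r2 r3)).
  apply: (regular_integral_le mu alpha01) => //; first exact: rD r1 (rD _ _ r2 r3).
  move=> x Xx; rewrite -!expRD; apply: (tilting_pointwise (y := y)) => //.
  by move=> h; rewrite indicE mem_set//; exact: yE.
have F2 : expR (2 * d * (1 - d) * Q) * I (fun x => expR ((t - s) * V n x)) <=
    K1 * expR (Q * (1 - 3 * d ^+ 2 / 4)).
  apply: (le_trans (ler_wpM2l (e0 _) E2)); rewrite mulrCA -expRD.
  by rewrite ler_pM2l// ler_expR le_eqVlt; apply/orP; left; apply/eqP; field.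
have F3 : expR (- (2 * d * (1 + d) * Q)) * I (fun x => expR ((t + s) * V n x)) <=
    K1 * expR (Q * (1 - 3 * d ^+ 2 / 4)).
  apply: (le_trans (ler_wpM2l (e0 _) E3)); rewrite mulrCA -expRD.
  by rewrite ler_pM2l// ler_expR le_eqVlt; apply/orP; left; apply/eqP; field.
have F4 : K1 * expR (Q * (1 - 3 * d ^+ 2 / 4)) <= expR (Q - Q * d ^+ 2 / 4) / K1 / 4.
  have -> : Q - Q * d ^+ 2 / 4 = Q * (1 - 3 * d ^+ 2 / 4) + Q * d ^+ 2 / 2 by field.
  rewrite expRD mulrC -!mulrA ler_wpM2l//.
  rewrite !mulrA !ler_pdivlMr// (_ : K1 * 4 * K1 = 4 * K1 ^+ 2); last by ring.
  have k0 : 0 < 4 * K1 ^+ 2 by rewrite mulr_gt0// exprn_gt0.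
  rewrite -[leLHS](lnK (x := _)) ?posrE// ler_expR.
  have h : 2 * ln (4 * K1 ^+ 2) <= Q * d ^+ 2 by rewrite -ler_pdivrMr.
  by move: h; set LL := ln _; rewrite -(mulrA Q) -expr2; exact: half_le.
have F5 : expR (Q - Q * d ^+ 2 / 4) / K1 / 2 <= expR (2 * (1 + d) * Q) * pr mu E.
  by apply: (quarter_split E1 main F2 F3 F4).
rewrite -(ler_pM2l (expR_gt0 (2 * (1 + d) * Q))); apply: le_trans F5.
have h : expR (2 * (1 + d) * Q) * expR (- ((1 + 3 * d) * Q)) <= expR (Q - Q * d ^+ 2 / 4).
  by rewrite -expRD ler_expR; apply: tail_exponent.
exact: half_rescale.
Qed.
End Tails.

Lemma birkhoffN (R : realType) (k : nat) (phi : Sig k -> R) n x :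
  birkhoff (fun y => - phi y) n x = - birkhoff phi n x.
Proof. by rewrite /birkhoff sumrN. Qed.

(** * The law of the iterated logarithm *)

Section MaximalInequality.
Variables (R : realType) (k : nat) (A : 'M[int]_k.+2) (mu : probability (Sig k) R).
Variables (alpha : R) (phi : Sig k -> R) (rho t0 K1 qc D U : R) (M : nat).
Hypothesis alpha01 : 0 < alpha < 1.
Hypothesis muX : mu (SigmaA A) = 1%E.
Implicit Types (x y z : Sig k) (E F : set (Sig k)).
Local Notation X := (SigmaA A).
Local Notation I := (integral_on A mu).
Local Notation V := (birkhoff phi).
Hypothesis rphi : regular A alpha phi.
Hypothesis rho0 : 0 < rho.
Hypothesis t00 : 0 < t0.
Hypothesis K11 : 1 <= K1.
Hypothesis mgf : forall t, `|t| <= t0 -> forall n,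
  expR (n%:R * (rho * t ^+ 2 / 2 - K1 * `|t| ^+ 3)) / K1 <=
    I (fun x => expR (t * V n x)) <=
  K1 * expR (n%:R * (rho * t ^+ 2 / 2 + K1 * `|t| ^+ 3)).
Hypothesis qc0 : 0 < qc.
Hypothesis qi_lb : forall j l E F, determined A j E -> determined A l F ->
  qc * pr mu E * pr mu F <= pr mu (E `&` iter (j + M) (@shift k) @^-1` F).
Hypothesis D0 : 0 <= D.
Hypothesis dist : forall n x y, X x -> X y -> agree n x y -> `|V n x - V n y| <= D.
Hypothesis U0 : 0 <= U.
Hypothesis bnd : forall x, X x -> `|phi x| <= U.

Lemma mgf_opp t : `|t| <= t0 -> forall n,
  expR (n%:R * (rho * t ^+ 2 / 2 - K1 * `|t| ^+ 3)) / K1 <=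
    I (fun x => expR (t * birkhoff (fun y => - phi y) n x)) <=
  K1 * expR (n%:R * (rho * t ^+ 2 / 2 + K1 * `|t| ^+ 3)).
Proof.
move=> tt n; have := @mgf (- t); rewrite normrN => /(_ tt n); rewrite sqrrN.
by under eq_fun do rewrite mulNr -mulrN -birkhoffN.
Qed.

Definition exceed n (a : R) := hull A n [set y | X y /\ a <= V n y].

Lemma exceedP n (a : R) x : X x -> a <= V n x -> exceed n a x.
Proof. by move=> Xx ax; split=> //; exists x; split=> //; exact: agree_refl. Qed.

Lemma exceed_ge n (a : R) x : exceed n a x -> a - D <= V n x.
Proof.
move=> [Xx [y [[Xy ay] xy]]]; have := dist Xx Xy xy.
by rewrite ler_norml; lra.
Qed.

Definition crossing n (a : R) := [set x | exists2 j, (j < n)%N & exceed j a x].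

Lemma determined_crossing n (a : R) : determined A n (crossing n a).
Proof.
split=> [x [j _ []] //|x y Xy xy [j jn ejx]]; exists j => //.
have [_ h] := determined_hull A j [set y | X y /\ a <= V j y].
by apply: h ejx => //; exact: agree_leq (ltnW jn) xy.
Qed.

(* Decomposition according to the first [j] at which the level [a] is reached. *)
Lemma crossing_bound n (a c : R) B : measurable B ->
  (forall j, (j < n)%N -> c * pr mu (exceed j a `\` crossing j a) <=
     pr mu (B `&` (exceed j a `\` crossing j a))) ->
  c * pr mu (crossing n a) <= pr mu (B `&` crossing n a).
Proof.
move=> mB; elim: n => [|n IH] h.
  have -> : crossing 0 a = set0 by rewrite -subset0 => x [].
  by rewrite setI0 pr0 mulr0.
have mc m : measurable (crossing m a) by exact: measurable_determined (determined_crossing _ _).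
have me m : measurable (exceed m a) by exact: measurable_determined (determined_hull _ _ _).
have dE : crossing n.+1 a `\` crossing n a = exceed n a `\` crossing n a.
  apply/seteqP; split=> x [h1 h2]; split=> //.
    case: h1 => j; rewrite ltnS leq_eqVlt => /orP[/eqP->//|jn] ej.
    by exfalso; apply: h2; exists j.
  by exists n.
have cS : crossing n.+1 a `&` crossing n a = crossing n a.
  by apply/setIidPr => x [j jn ej]; exists j => //; exact: ltnW.
rewrite (prDI mu (mc n.+1) (mc n)) dE cS.
rewrite (prDI mu (measurableI _ _ mB (mc n.+1)) (mc n)) -setIA cS.
have -> : (B `&` crossing n.+1 a) `\` crossing n a = B `&` (exceed n a `\` crossing n a).
  by rewrite -dE setIDA.
rewrite mulrDr; apply: lerD; first exact: h.
by apply: IH => j jn; apply: h; exact: ltnW.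
Qed.

Lemma half_probability : exists2 c1, 0 <= c1 & \forall n \near \oo, forall i, (i <= n)%N ->
  1 / 2 <= pr mu (hull A i [set y | X y /\ - (c1 * Num.sqrt n%:R) <= V i y]).
Proof.
have K10 : 0 < K1 by exact: lt_le_trans ltr01 K11.
have l2 : 0 <= ln (2 * K1) by apply: ln_ge0; apply: le_trans K11 _; rewrite ler_peMl ?(ltW K10)// ler1n.
(* With tilt [1 / sqrt n] the Chernoff exponent of the complement is at most
   [rho / 2 + K1 - c1 = - ln (2 * K1)], which leaves probability at most one half. *)
exists (rho / 2 + K1 + ln (2 * K1)); first by rewrite !addr_ge0 ?divr_ge0// ltW.
set c1 := _ + ln _.
have : \forall n \near \oo, t0^-1 ^+ 2 <= (n%:R : R).
  exact: (cvgr_idn (R := R) (nbhs_pinfty_ge (num_real _))).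
apply: filterS => n hn i iN; set s := Num.sqrt n%:R; set E := hull _ _ _.
have tn : t0^-1 <= s by rewrite (le_trans _ (ler_wsqrtr hn))// sqrtr_sqr ler_norm.
have s0 : 0 < s by apply: lt_le_trans tn; rewrite invr_gt0.
have sN : s ^+ 2 = n%:R by rewrite sqr_sqrtr.
have dE : determined A i E by exact: determined_hull.
have dX : determined A i X by split.
have mE := measurable_determined dE; have mX := measurable_determined dX.
have p1 : pr mu X = 1 by rewrite /pr muX.
have EX : X `&` E = E by apply/setIidPr; exact: dE.1.
have := prDI mu mX mE; rewrite p1 EX.
suff : pr mu (X `\` E) <= 1 / 2 by lra.
have ub : forall x, (X `\` E) x -> c1 * s <= birkhoff (fun y => - phi y) i x.
  move=> x [Xx nE]; rewrite birkhoffN leNgt; apply/negP => lt; apply: nE.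
  by split=> //; exists x; split; [split=> //; rewrite lerNl ltW|exact: agree_refl].
have st : 0 <= s^-1 <= t0 by rewrite invr_ge0 ltW//= invf_ple.
have := chernoff alpha01 muX (regularN alpha01 rphi) mgf_opp (determinedD dX dE) ub st.
move=> h; apply: (le_trans h).
have cs : s^-1 * (c1 * s) = c1 by rewrite mulrCA mulVf ?mulr1// gt_eqF.
have i2 : i%:R * s^-1 ^+ 2 <= 1.
  by rewrite exprVn sN ler_pdivrMr ?mul1r ?ler_nat// -sN exprn_gt0.
have i3 : i%:R * s^-1 ^+ 3 <= 1.
  rewrite exprS mulrCA mulr_ile1// ?mulr_ge0 ?exprn_ge0 ?invr_ge0 ?(ltW s0)//.
  rewrite invf_le1// -[1]sqrtr1 ler_wsqrtr// ler1n.
  by rewrite -(ltr0n R) -sN exprn_gt0.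
rewrite cs mulrC -ler_pdivlMr// -ler_ln ?posrE ?expR_gt0 ?divr_gt0//.
have -> : ln (1 / 2 / K1) = - ln (2 * K1) by rewrite mul1r -invfM lnV ?posrE ?mulr_gt0.
rewrite expRK /c1 mulrDr.
have : rho / 2 * (i%:R * s^-1 ^+ 2) <= rho / 2 by rewrite ler_piMr ?divr_ge0// ltW.
have : K1 * (i%:R * s^-1 ^+ 3) <= K1 by rewrite ler_piMr// ltW.
by set b := ln _; lra.
Qed.

(* Ottaviani's argument: after the first crossing of [a], with probability at least
   one half the remaining sum does not drop by more than [O(sqrt n)]. *)
Theorem maximal_inequality : exists c2 kap, [/\ 0 <= c2, 0 < kap & \forall n \near \oo, forall a : R,
  pr mu (crossing n a) <= kap * pr mu (exceed (n + M) (a - c2 * Num.sqrt n%:R))].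
Proof.
have [c1 c10 Hhalf] := half_probability.
(* The two [D] come from the hulls in the crossing event and in [G], and [M * U] from the gap
   between them; [qc] is the loss of independence and [1 / 2] the probability of [G]. *)
exists (c1 + D + M%:R * U + D), (qc / 2)^-1.
have MU : 0 <= M%:R * U by rewrite mulr_ge0.
split; [by rewrite !addr_ge0|by rewrite invr_gt0 divr_gt0|].
near=> n => a.
have n1 : (1 <= n)%N by near: n; exists 1%N.
set s := Num.sqrt n%:R.
have s1 : 1 <= s by rewrite -[1]sqrtr1 ler_wsqrtr// ler1n.
set b := a - _ * s.
rewrite mulrC ler_pdivlMr ?divr_gt0// mulrC.
have dB : determined A (n + M) (exceed (n + M) b) by exact: determined_hull.
have mB := measurable_determined dB.
have mc := measurable_determined (determined_crossing n a).
apply: le_trans (le_pr mu (measurableI _ _ mB mc) mB _); last exact: subIsetl.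
apply: crossing_bound => // j jn.
set T := exceed j a `\` crossing j a.
have dT : determined A j T by apply: determinedD; [exact: determined_hull|exact: determined_crossing].
set G := hull A (n - j) [set y | X y /\ - (c1 * s) <= V (n - j) y].
have pG : 1 / 2 <= pr mu G by apply: (near Hhalf n) => //; exact: leq_subr.
have dG : determined A (n - j) G by exact: determined_hull.
have := qi_lb dT dG.
have le1 : qc / 2 * pr mu T <= qc * pr mu T * pr mu G.
  by have := ler_wpM2l (mulr_ge0 (ltW qc0) (pr_ge0 mu T)) pG; lra.
move=> h; apply: (le_trans le1); apply: (le_trans h).
have mT := measurable_determined dT.
apply: le_pr.
- by apply: measurableI => //; apply: measurable_iter_shift; exact: measurable_determined dG.
- exact: measurableI.
move=> x [Tx Gx]; split=> //.
have Xx : X x by exact: dT.1.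
apply: exceedP => //.
have -> : (n + M = j + (M + (n - j)))%N by rewrite addnCA subnKC 1?addnC// ltnW.
rewrite birkhoffD birkhoffD -iterD.
have vj : a - D <= V j x by apply: exceed_ge; case: Tx.
have XS i : X (iter i (@shift k) x) by exact: SigmaA_shift.
have vM := birkhoff_norm M bnd (XS j).
have vG : - (c1 * s) - D <= V (n - j) (iter (M + j) (@shift k) x).
  rewrite addnC; case: Gx => Xz [y [[Xy yv] zy]].
  by have := dist Xz Xy zy; rewrite ler_norml; lra.
move: vM; rewrite ler_norml => /andP[vM _].
have DMD : D + M%:R * U + D <= (D + M%:R * U + D) * s by rewrite ler_peMr// !addr_ge0.
by rewrite /b; lra.
Unshelve. all: by end_near.
Qed.
End MaximalInequality.

(** * Growth of logarithms and the Borel-Cantelli lemma *)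

Section Asymptotics.
Variable R : realType.
Implicit Types (y c d B : R).

Lemma near_nat (P : R -> Prop) : (\forall y \near +oo, P y) -> \forall n \near \oo, P n%:R.
Proof. exact: (cvgr_idn (R := R)). Qed.

Lemma near_pinfty_ge B : \forall y \near +oo, B <= y.
Proof. exact: nbhs_pinfty_ge (num_real _). Qed.

Lemma near_comp (f : R -> R) (P : R -> Prop) : (forall B, \forall y \near +oo, B <= f y) ->
  (\forall y \near +oo, P y) -> \forall y \near +oo, P (f y).
Proof.
move=> fB [B [_ hB]]; apply: filterS (fB (B + 1)) => y By; apply: hB.
by apply: lt_le_trans By; rewrite ltrDl.
Qed.

Lemma near_ln_ge B : \forall y \near +oo, B <= ln y.
Proof.
apply: filterS (near_pinfty_ge (expR B)) => y By.
by rewrite -[B]expRK ler_ln ?posrE ?expR_gt0//; apply: lt_le_trans By; exact: expR_gt0.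
Qed.

Lemma near_sqrt_ge B : \forall y \near +oo, B <= Num.sqrt y.
Proof.
apply: filterS (near_pinfty_ge (B ^+ 2)) => y By.
by rewrite (le_trans (ler_norm _))// -sqrtr_sqr ler_wsqrtr.
Qed.

Lemma near_lnln_ge B : \forall y \near +oo, B <= ln (ln y).
Proof. exact: near_comp near_ln_ge (near_ln_ge B). Qed.

Lemma ln_le_sub1 y : 0 < y -> ln y <= y - 1.
Proof. by move=> y0; have := expR_ge1Dx (ln y); rewrite lnK ?posrE//; lra. Qed.

Lemma ln_le_sqrt y : 0 < y -> ln y <= 2 * Num.sqrt y.
Proof.
move=> y0; have s0 : 0 < Num.sqrt y by rewrite sqrtr_gt0.
have := ln_le_sub1 s0; rewrite -[in ln y](sqr_sqrtr (ltW y0)) expr2 lnM ?posrE//; lra.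
Qed.

Lemma near_ln_small c : 0 < c -> \forall y \near +oo, ln y <= c * y.
Proof.
move=> c0; apply: filterS2 (near_pinfty_ge 1) (near_sqrt_ge (2 / c)) => y y1 h.
have y0 : 0 < y by exact: lt_le_trans y1.
apply: (le_trans (ln_le_sqrt y0)); rewrite -[in leRHS](sqr_sqrtr (ltW y0)) expr2 mulrA.
by rewrite ler_wpM2r ?sqrtr_ge0// -ler_pdivrMl// mulrC.
Qed.

Lemma near_ln_sqrt c B : 0 < c -> \forall y \near +oo, c * ln y + B <= Num.sqrt y.
Proof.
move=> c0; near=> y.
have y1 : 1 <= y by near: y; exact: near_pinfty_ge.
have y0 : 0 < y by exact: lt_le_trans y1.
have s0 : 0 < Num.sqrt y by rewrite sqrtr_gt0.
have ly : ln y = 2 * ln (Num.sqrt y).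
  by rewrite -[in LHS](sqr_sqrtr (ltW y0)) expr2 lnM ?posrE//; lra.
have h1 : ln (Num.sqrt y) * (4 * c) <= Num.sqrt y.
  rewrite -ler_pdivlMr ?mulr_gt0// mulrC; near: y; apply: (near_comp near_sqrt_ge (near_ln_small _)).
  by rewrite invr_gt0 mulr_gt0.
have h2 : 2 * B <= Num.sqrt y by near: y; exact: near_sqrt_ge.
by rewrite ly; lra.
Unshelve. all: by end_near.
Qed.

Lemma near_lnln_scale c d : 0 < c -> 0 < d ->
  \forall y \near +oo, ln (ln (c * y)) <= (1 + d) * ln (ln y).
Proof.
move=> c0 d0; near=> y.
have y1 : 1 <= y by near: y; exact: near_pinfty_ge.
have y0 : 0 < y by exact: lt_le_trans y1.
have l1 : 1 - ln c <= ln y by near: y; exact: near_ln_ge.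
have l2 : ln c <= ln y by near: y; exact: near_ln_ge.
have l3 : 1 <= ln y by near: y; exact: near_ln_ge.
have l4 : ln 2 <= d * ln (ln y).
  by rewrite -ler_pdivrMl//; near: y; exact: near_lnln_ge.
have : ln (ln (c * y)) <= ln (2 * ln y).
  by rewrite ler_ln ?posrE ?lnM ?posrE//; lra.
have l0 : 0 < ln y by lra.
by rewrite [ln (2 * _)]lnM ?posrE//; lra.
Unshelve. all: by end_near.
Qed.

End Asymptotics.

Section BorelCantelli.
Variables (R : realType) (k : nat) (mu : probability (Sig k) R).
Implicit Types (E : nat -> set (Sig k)) (g : nat -> R).

(* Domination by the increments of a nonnegative [g] bounds the partial sums. *)
Lemma telescoping_borel_cantelli E g : (forall n, measurable (E n)) ->
  (forall n, 0 <= g n) -> (\forall n \near \oo, pr mu (E n.+1) <= g n - g n.+1) ->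
  {ae mu, forall x, \forall n \near \oo, ~ E n x}.
Proof.
move=> mE g0 [N _ h].
have bound L : \sum_(n < L) pr mu (E n) <= N.+1%:R + g N.
  have h1 m : (m <= N.+1)%N -> \sum_(n < m) pr mu (E n) <= m%:R.
    move=> _; apply: le_trans (_ : \sum_(n < m) 1 <= _); first by apply: ler_sum => i _; exact: pr_le1.
    by rewrite sumr_const card_ord.
  have h2 j : \sum_(n < j + N.+1) pr mu (E n) <= N.+1%:R + g N - g (j + N)%N.
    elim: j => [|j IH]; first by rewrite !add0n addrK; exact: h1.
    have hj : pr mu (E (j + N).+1) <= g (j + N)%N - g (j + N).+1 by exact: h (leq_addl _ _).
    by move: IH; rewrite !addSn big_ord_recr/= !addnS; lra.
  have [LN|LN] := leqP L N.+1.
    apply: (le_trans (h1 _ LN)); rewrite (@le_trans _ _ N.+1%:R) ?ler_nat ?lerDl//.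
  rewrite -(subnK (ltnW LN)); apply: (le_trans (h2 _)).
  by rewrite lerBlDr lerDl.
have fin : (\sum_(0 <= n <oo) mu (E n) < +oo)%E.
  apply: (@le_lt_trans _ _ (N.+1%:R + g N)%:E); last exact: ltry.
  apply: lime_le; first by apply: is_cvg_nneseries => *; exact: measure_ge0.
  apply: nearW => L; rewrite big_mkord.
  under eq_bigr do rewrite prE//.
  by rewrite sumEFin lee_fin.
have z := lim_sup_set_cvg0 mE fin.
exists (lim_sup_set E); split => //.
  apply: bigcapT_measurable => n; apply: bigcup_measurable => i _; exact: mE.
move=> x /= nx n _; apply: contrapT => hn; apply: nx.
exists n => // m /= nm Em; apply: hn; exists m => //=.
Qed.

Lemma ln_natS n : (0 < n)%N -> ln n%:R <= ln n.+1%:R - n.+1%:R^-1 :> R.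
Proof.
move=> n0; have nR : 0 < n%:R :> R by rewrite ltr0n.
have n1R : 0 < n.+1%:R :> R by rewrite ltr0n.
have := @ln_le_sub1 R (n%:R / n.+1%:R) (divr_gt0 nR n1R).
rewrite ln_div ?posrE//.
have -> : n%:R / n.+1%:R - 1 = - n.+1%:R^-1 :> R by rewrite -natr1; field; rewrite natr1 gt_eqF.
by rewrite lerBlDr addrC.
Qed.

(** Dominates the term [n^-(1 + e)] by an increment of [n^-e / e], the form that
    [telescoping_borel_cantelli] asks for. *)
Lemma p_series_telescope (e : R) n : 0 < e -> (0 < n)%N ->
  expR (- ((1 + e) * ln n.+1%:R)) <=
    e^-1 * expR (- (e * ln n%:R)) - e^-1 * expR (- (e * ln n.+1%:R)).
Proof.
move=> e0 n0; have nR : 0 < n%:R :> R by rewrite ltr0n.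
have n1R : 0 < n.+1%:R :> R by rewrite ltr0n.
rewrite -mulrBr ler_pdivlMl//.
have h := ln_natS n0.
have -> : - (e * ln n%:R) = - (e * ln n.+1%:R) + e * (ln n.+1%:R - ln n%:R) by ring.
rewrite [- ((1 + e) * _)](_ : _ = - (e * ln n.+1%:R) + - ln n.+1%:R); last by ring.
set a := ln n.+1%:R in h *; set b := ln n%:R in h *; set i := n.+1%:R^-1 in h *.
have ia : expR (- a) = i by rewrite expRN lnK ?posrE.
rewrite !expRD ia mulrCA -[X in _ - X]mulr1 -mulrBr ler_pM2l ?expR_gt0//.
have := expR_ge1Dx (e * (a - b)).
have : e * i <= e * (a - b) by rewrite ler_pM2l// lerBrDr addrC -lerBrDr.
clearbody a b i; lra.
Qed.

(** The same for the series of [1 / (n * (ln n)^2)], dominated by increments of [1 / ln n]. *)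
Lemma log_series_telescope n : (1 < n)%N ->
  expR (- (ln n.+1%:R + 2 * ln (ln n.+1%:R))) <= (ln n%:R)^-1 - (ln n.+1%:R)^-1 :> R.
Proof.
move=> n1; have nR : 0 < n%:R :> R by rewrite ltr0n ltnW.
have n1R : 0 < n.+1%:R :> R by rewrite ltr0n.
have l0 : 0 < ln n%:R :> R by rewrite ln_gt0 ?ltr1n.
have l1 : 0 < ln n.+1%:R :> R by rewrite ln_gt0 ?ltr1n// ltnW.
have h := ln_natS (ltnW n1).
have hl : ln n%:R <= ln n.+1%:R :> R by apply: (le_trans h); rewrite gerBl invr_ge0.
rewrite expRN expRD lnK ?posrE// expRM_natl lnK ?posrE//.
have -> : (ln n%:R)^-1 - (ln n.+1%:R)^-1 = (ln n.+1%:R - ln n%:R) / (ln n%:R * ln n.+1%:R) :> R.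
  by field; rewrite !gt_eqF.
rewrite invfM ler_pM ?invr_ge0 ?exprn_ge0 ?(ltW l1)//.
- by rewrite lerBrDr addrC -lerBrDr.
- by rewrite lef_pV2 ?posrE ?mulr_gt0 ?exprn_gt0// expr2 ler_pM2r.
Qed.
End BorelCantelli.

Section UpperLil.
Variables (R : realType) (k : nat) (A : 'M[int]_k.+2) (mu : probability (Sig k) R).
Variables (alpha : R) (phi : Sig k -> R) (rho t0 K1 qc D U : R) (M : nat).
Hypothesis alpha01 : 0 < alpha < 1.
Hypothesis muX : mu (SigmaA A) = 1%E.
Implicit Types (x y z : Sig k) (E F : set (Sig k)).
Local Notation X := (SigmaA A).
Local Notation I := (integral_on A mu).
Local Notation V := (birkhoff phi).
Hypothesis rphi : regular A alpha phi.
Hypothesis rho0 : 0 < rho.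
Hypothesis t00 : 0 < t0.
Hypothesis K11 : 1 <= K1.
Hypothesis mgf : forall t, `|t| <= t0 -> forall n,
  expR (n%:R * (rho * t ^+ 2 / 2 - K1 * `|t| ^+ 3)) / K1 <=
    I (fun x => expR (t * V n x)) <=
  K1 * expR (n%:R * (rho * t ^+ 2 / 2 + K1 * `|t| ^+ 3)).
Hypothesis qc0 : 0 < qc.
Hypothesis qi_lb : forall j l E F, determined A j E -> determined A l F ->
  qc * pr mu E * pr mu F <= pr mu (E `&` iter (j + M) (@shift k) @^-1` F).
Hypothesis D0 : 0 <= D.
Hypothesis dist : forall n x y, X x -> X y -> agree n x y -> `|V n x - V n y| <= D.
Hypothesis U0 : 0 <= U.
Hypothesis bnd : forall x, X x -> `|phi x| <= U.

Definition lil_scale (w : R) := Num.sqrt (2 * rho * (w * ln (ln w))).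

Lemma lil_scale_split (w : R) : 0 <= w ->
  lil_scale w = Num.sqrt w * Num.sqrt (2 * rho * ln (ln w)).
Proof. by move=> w0; rewrite /lil_scale -sqrtrM// mulrCA. Qed.

Lemma le_lil_scale (w w' : R) : w <= w' -> 1 <= ln w -> lil_scale w <= lil_scale w'.
Proof.
(* [ln] vanishes on nonpositive reals, so [1 <= ln w] forces [w] to be positive. *)
move=> ww lw; have w0 : 0 < w by rewrite ltNge; apply/negP => /ln0 e; rewrite e ler10 in lw.
have lw' : ln w <= ln w' by rewrite ler_ln ?posrE//; exact: lt_le_trans ww.
have l0 : 0 < ln w by lra.
rewrite ler_wsqrtr// ler_wpM2l ?mulr_ge0 ?(ltW rho0)// ler_pM ?(ltW w0)// ?ln_ge0//.
by rewrite ler_ln ?posrE//; exact: lt_le_trans lw'.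
Qed.

(** The factor [1 - d] is lost in [tail_ub] and [expR (- (2 * d))] through the length of a block;
    the exponent stays above [1], so the blocks give a summable series. *)
Lemma upper_exponent (e d : R) : 0 < e <= 1 -> d = e / 12 ->
  1 + e / 2 <= (1 - d) * (1 + e / 2) ^+ 2 * expR (- (2 * d)).
Proof.
move=> /andP[e0 e1] de; have := expR_ge1Dx (- (2 * d)) => h.
have d1 : 0 <= (1 - d) * (1 + e / 2) ^+ 2 by rewrite mulr_ge0 ?sqr_ge0//; lra.
apply: le_trans (ler_wpM2l d1 h).
have h1 : 1 - e / 4 <= (1 - d) * (1 - 2 * d).
  have dd : 0 <= d * d by rewrite -expr2 sqr_ge0.
  by rewrite mulrBr mulrBl; lra.
have h2 := ler_wpM2l (sqr_ge0 (1 + e / 2)) h1.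
have ee : 0 <= e * (1 - e) by rewrite mulr_ge0 ?(ltW e0) ?subr_ge0.
have h3 : (1 + e / 2) <= (1 + e / 2) ^+ 2 * (1 - e / 4).
  rewrite expr2 -subr_ge0 (_ : _ - _ = (1 + e / 2) * ((1 + e / 2) * (1 - e / 4) - 1)); last by ring.
  by rewrite mulr_ge0//; lra.
by apply: (le_trans h3); apply: (le_trans h2); rewrite mulrA [_ * (1 - d)]mulrC.
Qed.

Let blk (d : R) (j : nat) := expR (d * j%:R).

Lemma near_blk (d : R) (P : R -> Prop) : 0 < d -> (\forall w \near +oo, P w) ->
  \forall j \near \oo, P (blk d j).
Proof.
move=> d0 hP; suff h : \forall y \near +oo, P (expR (d * y)).
  exact: (@near_nat R (fun y : R => P (expR (d * y))) h).
apply: (@near_comp R (fun y : R => expR (d * y)) P _ hP) => B.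
apply: filterS (near_pinfty_ge (B / d)) => y; rewrite ler_pdivrMr// mulrC => h.
by apply: le_trans h _; have := expR_ge1Dx (d * y); lra.
Qed.

(** The loss [c2 * sqrt n + D] of the maximal inequality and the hull costs only half of [e], since
    [lil_scale w] exceeds [sqrt w] by an unbounded factor. *)
Lemma crossing_bound_block (e d c2 kap c0 w : R) n : 0 < e <= 1 -> d = e / 12 ->
  0 <= c2 -> 0 <= kap -> 0 < c0 ->
  (forall n E (y : R), (0 < n)%N -> determined A n E -> (forall x, E x -> y <= V n x) ->
    0 <= y <= c0 * n%:R -> pr mu E <= K1 * expR (- ((1 - d) * (y ^+ 2 / (2 * rho * n%:R))))) ->
  (forall a : R, pr mu (crossing A phi n a) <=
      kap * pr mu (exceed A phi (n + M) (a - c2 * Num.sqrt n%:R))) ->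
  1 <= w -> M.+1%:R / d <= w -> 1 <= ln (ln w) ->
  ((c2 * expR d + D) / (e / 2)) ^+ 2 / (2 * rho) <= ln (ln w) ->
  ln (ln w) <= (c0 / 2) ^+ 2 / (2 * rho) * w -> w <= n%:R -> n%:R <= expR d * w + 1 ->
  pr mu (crossing A phi n ((1 + e) * lil_scale w)) <=
    kap * (K1 * expR (- ((1 + e / 2) * ln (ln w)))).
Proof.
move=> /[dup] e01 /andP[e0 e1] de c20 kap0 c00 Htail Hmax w1 wM lam1 lamB lamw wn nw.
have w0 : 0 < w by exact: lt_le_trans w1.
have d0 : 0 < d by rewrite de divr_gt0.
have d1 : d < 1 by rewrite de; lra.
have ed1 : 1 + d <= expR d := expR_ge1Dx d.
have e2d : expR (2 * d) = expR d * expR d by rewrite -expRD; congr expR; ring.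
have lnE : lil_scale w = Num.sqrt w * Num.sqrt (2 * rho * ln (ln w)) by rewrite lil_scale_split// ltW.
set lam := ln (ln w) in lam1 lamB lamw lnE *; clearbody lam.
set s := lil_scale w in lnE *; clearbody s.
have lam0 : 0 < lam by exact: lt_le_trans lam1.
have rho2 : 0 < 2 * rho by rewrite mulr_gt0.
have s0 : 0 <= s by rewrite lnE mulr_ge0 ?sqrtr_ge0.
have s2 : s ^+ 2 = w * (2 * rho * lam).
  by rewrite lnE exprMn !sqr_sqrtr ?(ltW w0) ?(ltW (mulr_gt0 rho2 lam0)).
have sw1 : 1 <= Num.sqrt w by rewrite -[1]sqrtr1 ler_wsqrtr.
have nR : 0 < n%:R :> R by exact: lt_le_trans wn.
have n0 : (0 < n)%N by rewrite -(ltr0n R).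
have NR : 0 < (n + M)%:R :> R by rewrite ltr0n addn_gt0 n0.
have Nw : (n + M)%:R <= expR (2 * d) * w.
  have h1 : M.+1%:R <= w * d by rewrite -ler_pdivrMr.
  have h2 : w * d <= expR d * w * (expR d - 1).
    rewrite [expR d * w]mulrC -mulrA ler_pM2l//.
    by apply: le_trans (_ : 1 * d <= _); [rewrite mul1r|rewrite ler_pM//; lra].
  by rewrite natrD e2d; rewrite -natr1 in h1; lra.
have sn : c2 * Num.sqrt n%:R + D <= e / 2 * s.
  have h1 : Num.sqrt n%:R <= expR d * Num.sqrt w.
    have -> : expR d * Num.sqrt w = Num.sqrt (expR (2 * d) * w).
      by rewrite sqrtrM ?expR_ge0// e2d -expr2 sqrtr_sqr ger0_norm ?expR_ge0.
    by rewrite ler_wsqrtr// (le_trans _ Nw)// ler_nat leq_addr.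
  have h2 : (c2 * expR d + D) / (e / 2) <= Num.sqrt (2 * rho * lam).
    apply: (le_trans (ler_norm _)); rewrite -sqrtr_sqr ler_wsqrtr//.
    by rewrite -ler_pdivrMl// mulrC.
  have h3 : c2 * expR d + D <= e / 2 * Num.sqrt (2 * rho * lam).
    by rewrite [leRHS]mulrC -ler_pdivrMr ?divr_gt0.
  have h4 := ler_wpM2r (sqrtr_ge0 w) h3.
  have h5 := ler_wpM2l c20 h1.
  have h6 : D <= D * Num.sqrt w by rewrite ler_peMr.
  by rewrite lnE; lra.
have yc : (1 + e / 2) * s <= c0 * (n + M)%:R.
  have h1 : s <= c0 / 2 * w.
    rewrite -[leRHS]ger0_norm ?mulr_ge0 ?divr_ge0 ?(ltW c00) ?(ltW w0)//.
    rewrite -ler_sqr ?nnegrE// -normrX ger0_norm ?sqr_ge0// s2 exprMn expr2 [leRHS]mulrCA.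
    have lw : lam <= c0 / 2 * (c0 / 2) * w / (2 * rho) by rewrite mulrAC -expr2.
    by rewrite ler_pM2l// mulrC -ler_pdivlMr.
  have h2 : (1 + e / 2) * s <= 2 * s by rewrite ler_wpM2r//; lra.
  have h3 : c0 * w <= c0 * (n + M)%:R.
    by rewrite ler_pM2l// (le_trans wn)// ler_nat leq_addr.
  by lra.
apply: (le_trans (Hmax _)); rewrite ler_wpM2l//.
have y0 : 0 <= (1 + e / 2) * s by rewrite mulr_ge0//; lra.
apply: (@le_trans _ _ (K1 * expR (- ((1 - d) * (((1 + e / 2) * s) ^+ 2 / (2 * rho * (n + M)%:R)))))).
  apply: Htail; rewrite ?addn_gt0 ?n0 ?y0 ?yc//; first exact: determined_hull.
  by move=> x /(exceed_ge dist); lra.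
rewrite ler_pM2l ?(lt_le_trans ltr01 K11)// ler_expR lerN2 exprMn s2.
set N := (n + M)%:R in NR Nw *; clearbody N.
have -> : (1 + e / 2) ^+ 2 * (w * (2 * rho * lam)) / (2 * rho * N) =
    (1 + e / 2) ^+ 2 * lam * (w / N) by field; rewrite !gt_eqF.
have wN : expR (- (2 * d)) <= w / N.
  by rewrite ler_pdivlMr// expRN ler_pdivrMl ?expR_gt0.
have cf : 0 <= (1 - d) * ((1 + e / 2) ^+ 2 * lam).
  by rewrite !mulr_ge0 ?sqr_ge0 ?(ltW lam0)//; lra.
have h1 := ler_wpM2l cf wN.
have h2 := ler_wpM2r (ltW lam0) (upper_exponent e01 de).
rewrite [leRHS]mulrA; apply: le_trans h1; apply: (le_trans h2).
by rewrite le_eqVlt; apply/orP; left; apply/eqP; ring.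
Qed.

Lemma near_lnln_small (c : R) : 0 < c -> \forall y \near +oo, ln (ln y) <= c * y.
Proof.
move=> c0; apply: filterS2 (near_comp (@near_ln_ge R) (near_ln_small ltr01)) (near_ln_small c0) => y.
by rewrite mul1r => h1 h2; exact: le_trans h2.
Qed.

Lemma near_succ (P : nat -> Prop) : (\forall n \near \oo, P n) -> \forall n \near \oo, P n.+1.
Proof. by case=> N _ h; exists N => // n Nn; apply: h; exact: leqW. Qed.

(* The blocks are the intervals between consecutive powers of [expR (eps / 12)]. *)
Lemma crossing_block eps : 0 < eps <= 1 ->
  {ae mu, forall x, \forall j \near \oo,
    ~ crossing A phi (Num.truncn (expR (eps / 12) * blk (eps / 12) j)).+1
        ((1 + eps) * lil_scale (blk (eps / 12) j)) x}.
Proof.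
move=> /[dup] eps01 /andP[e0 e1]; set d := eps / 12.
have d0 : 0 < d by rewrite divr_gt0.
have d1 : d < 1 by rewrite /d; lra.
have ed0 := expR_gt0 d.
have ed1 : 1 + d <= expR d := expR_ge1Dx d.
have [c2 [kap [c20 kap0 Hmax]]] :=
  maximal_inequality alpha01 muX rphi rho0 t00 K11 mgf qc0 qi_lb D0 dist U0 bnd.
have [c0 c00 Htail] : exists2 c0, 0 < c0 & forall n E (y : R), (0 < n)%N ->
    determined A n E -> (forall x, E x -> y <= V n x) -> 0 <= y <= c0 * n%:R ->
    pr mu E <= K1 * expR (- ((1 - d) * (y ^+ 2 / (2 * rho * n%:R)))).
  by apply: (tail_ub alpha01 muX rphi rho0 t00 K11 mgf); rewrite d0.
have K10 : 0 < K1 by exact: lt_le_trans ltr01 K11.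
pose n j := (Num.truncn (expR d * blk d j)).+1.
(* Since [ln (ln (blk d j)) = ln d + ln j], the bounds on the blocks form a series of powers
   [j^-(1 + eps / 2)]. *)
pose g j := kap * K1 * expR (- ((1 + eps / 2) * ln d)) *
   ((eps / 2)^-1 * expR (- (eps / 2 * ln j%:R))).
have C0 : 0 <= kap * K1 * expR (- ((1 + eps / 2) * ln d)) by rewrite !mulr_ge0 ?expR_ge0// ltW.
apply: (telescoping_borel_cantelli (g := g)).
- by move=> j; apply: measurable_determined; exact: determined_crossing.
- by move=> j; rewrite mulr_ge0// mulr_ge0 ?expR_ge0// invr_ge0 divr_ge0// ltW.
have key : \forall j \near \oo, pr mu (crossing A phi (n j) ((1 + eps) * lil_scale (blk d j))) <=
    kap * K1 * expR (- ((1 + eps / 2) * ln (ln (blk d j)))).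
  case: (Hmax) => N0 _ HN0; near=> j; rewrite -mulrA.
  have nE : (n j)%:R <= expR d * blk d j + 1.
    by rewrite /n -natr1 lerD2r truncn_le// mulr_ge0 ?expR_ge0.
  have bn : blk d j <= (n j)%:R.
    rewrite /n (le_trans _ (ltW (truncnS_gt _)))// ler_peMl ?expR_ge0//.
    by apply: le_trans ed1; rewrite lerDl ltW.
  apply: (crossing_bound_block (c2 := c2) (c0 := c0)) => //; rewrite -/d.
  - exact: ltW.
  - apply: HN0 => /=; rewrite -(ler_nat R); apply: le_trans bn.
    by near: j; apply: near_blk d0 (near_pinfty_ge _).
  - by near: j; apply: near_blk d0 (near_pinfty_ge 1).
  - by near: j; apply: near_blk d0 (near_pinfty_ge _).
  - by near: j; apply: near_blk d0 (near_lnln_ge 1).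
  - by near: j; apply: near_blk d0 (near_lnln_ge _).
  - near: j; apply: near_blk d0 (near_lnln_small _).
    by rewrite divr_gt0 ?exprn_gt0 ?divr_gt0 ?mulr_gt0.
apply: filterS2 (near_succ key) (nbhs_infty_ge 1) => j hj j1; apply: (le_trans hj).
rewrite /g -mulrBr -[leRHS]mulrA ler_pM2l ?mulr_gt0// /blk expRK.
have j1R : 0 < j.+1%:R :> R by rewrite ltr0n.
rewrite lnM ?posrE// mulrDr opprD expRD ler_pM2l ?expR_gt0//.
by apply: p_series_telescope => //; rewrite divr_gt0.
Unshelve. all: by end_near.
Qed.

Theorem lil_upper eps : 0 < eps <= 1 ->
  {ae mu, forall x, X x -> \forall m \near \oo, V m x <= (1 + eps) * lil_scale m%:R}.
Proof.
move=> eps01; have := crossing_block eps01; apply: filterS => x [N _ hN] Xx.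
have /andP[e0 e1] := eps01; set d := eps / 12 in hN.
have d0 : 0 < d by rewrite divr_gt0.
near=> m.
have l1 : 1 <= ln m%:R :> R by near: m; exact: near_nat (near_ln_ge 1).
have lN : d * (N%:R + d^-1) + d <= ln m%:R :> R by near: m; exact: near_nat (near_ln_ge _).
have l0 : 0 <= ln m%:R :> R by exact: le_trans l1.
have m0 : 0 < m%:R :> R by rewrite ltNge; apply/negP => /ln0 e; rewrite e ler10 in l1.
pose j := Num.truncn (ln m%:R / d).
have j1 : d * j%:R <= ln m%:R by rewrite mulrC -ler_pdivlMr// truncn_le// divr_ge0// ltW.
have j2 : ln m%:R < d * j%:R + d.
  rewrite -[X in _ + X]mulr1 -mulrDr natr1 mulrC -ltr_pdivrMr//; exact: truncnS_gt.
have Nj : N%:R + d^-1 <= j%:R.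
  by rewrite -(ler_pM2l d0); move: j2 lN; lra.
have NjN : (N <= j)%N by rewrite -(ler_nat R); apply: le_trans Nj; rewrite lerDl invr_ge0 ltW.
have jd : 1 <= d * j%:R.
  rewrite -ler_pdivrMl// mulr1.
  by apply: le_trans Nj; rewrite lerDr.
rewrite leNgt; apply/negP => Vm; apply: (hN j NjN).
exists m; last first.
  apply: exceedP => //; apply: le_trans (ltW Vm); rewrite ler_wpM2l ?addr_ge0 ?(ltW e0)//.
  apply: le_lil_scale; last by rewrite /blk expRK.
  by rewrite -[leRHS](@lnK R) ?posrE// ler_expR.
rewrite -(ltr_nat R); apply: lt_trans (truncnS_gt _).
by rewrite -expRD -[ltLHS](@lnK R) ?posrE// ltr_expR addrC.
Unshelve. all: by end_near.
Qed.

End UpperLil.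

Section LowerLil.
Variables (R : realType) (k : nat) (A : 'M[int]_k.+2) (mu : probability (Sig k) R).
Variables (alpha : R) (phi : Sig k -> R) (rho t0 K1 qc D U : R) (M : nat).
Hypothesis alpha01 : 0 < alpha < 1.
Hypothesis muX : mu (SigmaA A) = 1%E.
Hypothesis mu_inv : forall E : set (Sig k), measurable E -> mu (@shift k @^-1` E) = mu E.
Implicit Types (x y z : Sig k) (E F : set (Sig k)).
Local Notation X := (SigmaA A).
Local Notation I := (integral_on A mu).
Local Notation V := (birkhoff phi).
Hypothesis rphi : regular A alpha phi.
Hypothesis rho0 : 0 < rho.
Hypothesis t00 : 0 < t0.
Hypothesis K11 : 1 <= K1.
Hypothesis mgf : forall t, `|t| <= t0 -> forall n,
  expR (n%:R * (rho * t ^+ 2 / 2 - K1 * `|t| ^+ 3)) / K1 <=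
    I (fun x => expR (t * V n x)) <=
  K1 * expR (n%:R * (rho * t ^+ 2 / 2 + K1 * `|t| ^+ 3)).
Hypothesis qc0 : 0 < qc.
Hypothesis qi_lb : forall j l E F, determined A j E -> determined A l F ->
  qc * pr mu E * pr mu F <= pr mu (E `&` iter (j + M) (@shift k) @^-1` F).
Hypothesis D0 : 0 <= D.
Hypothesis dist : forall n x y, X x -> X y -> agree n x y -> `|V n x - V n y| <= D.
Hypothesis U0 : 0 <= U.
Hypothesis bnd : forall x, X x -> `|phi x| <= U.

(** Relative to the scale at [w], the initial stretch costs [2 * d], the product
    [(1 - d)^2 * (1 - 2 * d)] at most [4 * d] and the distortion [d]; [8 * d] covers them all. *)
Lemma lower_numeric (d w l lk n2 Dd : R) : 0 < d <= 1 / 8 -> 0 <= w -> 0 <= lk -> 0 <= n2 ->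
  lk <= l -> l <= (1 + d) * lk -> n2 <= d ^+ 2 * w -> Dd <= d * Num.sqrt (2 * rho * (w * l)) ->
  (1 - 8 * d) * Num.sqrt (2 * rho * (w * l)) <=
  - (2 * Num.sqrt (2 * rho * (n2 * l))) +
    (1 - d) * ((1 - 2 * d) * Num.sqrt (2 * rho * ((w - n2) * lk))) - Dd.
Proof.
move=> /andP[d0 d1] w0 lk0 n20 lkl ll nw DS.
have l0 : 0 <= l by exact: le_trans lkl.
have r2 : 0 <= 2 * rho by rewrite mulr_ge0 ?(ltW rho0).
set S := Num.sqrt (2 * rho * (w * l)) in DS *.
have S0 : 0 <= S by exact: sqrtr_ge0.
have h1 : Num.sqrt (2 * rho * (n2 * l)) <= d * S.
  have -> : d * S = Num.sqrt (d ^+ 2 * (2 * rho * (w * l))).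
    by rewrite sqrtrM ?sqr_ge0// sqrtr_sqr ger0_norm// ltW.
  rewrite ler_wsqrtr// [leRHS]mulrCA ler_wpM2l// mulrA ler_wpM2r//.
have h2 : (1 - d) * S <= Num.sqrt (2 * rho * ((w - n2) * lk)).
  have d10 : 0 <= 1 - d by lra.
  have -> : (1 - d) * S = Num.sqrt ((1 - d) ^+ 2 * (2 * rho * (w * l))).
    by rewrite sqrtrM ?sqr_ge0// sqrtr_sqr ger0_norm.
  rewrite ler_wsqrtr// [leLHS]mulrCA ler_wpM2l//.
  have e1 : (1 - d) * w <= w - n2.
    have : d * (d * w) <= 1 * (d * w) by rewrite ler_wpM2r ?mulr_ge0 ?(ltW d0)//; lra.
    by move: nw; rewrite expr2 -mulrA; lra.
  have e2 : (1 - d) * l <= lk.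
    have : (1 - d) * l <= (1 - d) * ((1 + d) * lk) by rewrite ler_wpM2l.
    have : 0 <= d * (d * lk) by rewrite !mulr_ge0// ltW.
    by lra.
  by rewrite expr2 mulrACA ler_pM// mulr_ge0.
have c0 : 0 <= (1 - d) * (1 - 2 * d) by rewrite mulr_ge0//; lra.
have h3 := ler_wpM2l c0 h2.
have dS : 0 <= d * S by rewrite mulr_ge0// ltW.
have d2S : 0 <= d * d * S by rewrite mulr_ge0// mulr_ge0// ltW.
have d3S : d * d * d * S <= d * d * S by rewrite -!mulrA ler_piMl ?mulrA//; lra.
by lra.
Qed.

(** A second Borel-Cantelli lemma under lower quasi-independence: the probability that none of the
    events from [N] to [L] occurs is at most the product of [1 - qc * c / j], hence at most
    [(N / L)^(qc * c)]. *)
Lemma spaced_events_io (n d : nat -> nat) (E : nat -> set (Sig k)) (c : R) j0 : 0 < c ->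
  (forall j, determined A (d j) (E j)) ->
  (forall j, (j0 <= j)%N -> (n j + M + d j = n j.+1)%N) ->
  (forall j, (j0 <= j)%N -> c / j%:R <= pr mu (E j)) ->
  {ae mu, forall x, X x -> forall N, exists j, (N <= j)%N /\ E j (iter (n j + M) (@shift k) x)}.
Proof.
move=> c0 dE nd cE.
pose H N L := [set x | X x /\ forall j, (N <= j < L)%N -> ~ E j (iter (n j + M) (@shift k) x)].
pose N0 := maxn j0 1.
have dH N i : (N0 <= N)%N -> determined A (n (N + i)%N) (H N (N + i)%N).
  move=> N0N; elim: i => [|i IH].
    rewrite addn0; split=> [x []//|x y Xy _ _]; split=> // j /andP[h1 h2].
    by move: (leq_ltn_trans h1 h2); rewrite ltnn.
  have Nj : (j0 <= N + i)%N by rewrite (leq_trans _ (leq_addr _ _))// (leq_trans _ N0N)// leq_maxl.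
  have -> : H N (N + i.+1)%N = H N (N + i)%N `\`
      (X `&` iter (n (N + i)%N + M)%N (@shift k) @^-1` E (N + i)%N).
    apply/seteqP; split=> x.
      move=> [Xx h]; split; first by split=> // j /andP[h1 h2]; apply: h; rewrite h1 addnS ltnW.
      by move=> [_]; apply: h; rewrite leq_addr addnS leqnn.
    move=> [[Xx h] h']; split=> // j /andP[h1]; rewrite addnS ltnS leq_eqVlt => /orP[/eqP->|h2].
      by move=> Ej; apply: h'.
    by apply: h; rewrite h1.
  apply: determinedD.
    by rewrite addnS -nd// -addnA; apply: determined_leq IH; exact: leq_addr.
  by rewrite addnS -nd//; exact: determined_shift.
have cc : 0 < qc * c by exact: mulr_gt0.
have step N i : (N0 <= N)%N ->
    pr mu (H N (N + i)%N) <= expR (qc * c * (ln N%:R - ln (N + i)%:R)).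
  move=> N0N; have N1 : (0 < N)%N by apply: leq_trans N0N; exact: leq_maxr.
  elim: i => [|i IH].
    have := dH N 0 N0N; rewrite addn0 subrr mulr0 expR0 => h.
    by apply: pr_le1; exact: measurable_determined h.
  have Nj : (j0 <= N + i)%N by rewrite (leq_trans _ (leq_addr _ _))// (leq_trans _ N0N)// leq_maxl.
  have dHi := dH N i N0N.
  have mH := measurable_determined dHi.
  have mS : measurable (iter (n (N + i)%N + M)%N (@shift k) @^-1` E (N + i)%N).
    by apply: measurable_iter_shift; exact: measurable_determined (dE _).
  have HS : H N (N + i.+1)%N = H N (N + i)%N `\` iter (n (N + i)%N + M)%N (@shift k) @^-1` E (N + i)%N.
    apply/seteqP; split=> x.
      move=> [Xx h]; split; first by split=> // j /andP[h1 h2]; apply: h; rewrite h1 addnS ltnW.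
      by apply: h; rewrite leq_addr addnS leqnn.
    move=> [[Xx h] h']; split=> // j /andP[h1]; rewrite addnS ltnS leq_eqVlt => /orP[/eqP->//|h2].
    by apply: h; rewrite h1.
  have := prDI mu mH mS; rewrite -HS.
  have := qi_lb dHi (dE (N + i)%N).
  have p0 := pr_ge0 mu (H N (N + i)%N).
  have := ler_wpM2l (mulr_ge0 (ltW qc0) p0) (cE _ Nj).
  set p := pr mu (H N (N + i)%N) in p0 IH *; set q := pr mu (_ `&` _); set p' := pr mu (H _ _).
  set r := pr mu (E _) => h1 h2 h3.
  have R0 : 0 < (N + i)%:R :> R by rewrite ltr0n addn_gt0 N1.
  have h4 : p' <= p * (1 - qc * c / (N + i)%:R) by rewrite mulrBr; lra.
  apply: (le_trans h4); apply: (le_trans (ler_wpM2l p0 (expR_ge1Dx _))).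
  apply: (@le_trans _ _ (expR (qc * c * (ln N%:R - ln (N + i)%:R)) * expR (- (qc * c / (N + i)%:R)))).
    by rewrite ler_wpM2r ?expR_ge0.
  rewrite -expRD ler_expR addnS.
  have h5 : ln (N + i).+1%:R <= ln (N + i)%:R + (N + i)%:R^-1 :> R.
    have := @ln_le_sub1 R ((N + i).+1%:R / (N + i)%:R) (divr_gt0 (ltr0Sn _ _) R0).
    rewrite ln_div ?posrE ?ltr0Sn// -natr1 mulrDl divff ?gt_eqF// mul1r addrAC subrr add0r.
    by rewrite lerBlDr [_^-1 + _]addrC.
  have := ler_wpM2l (ltW cc) h5.
  by rewrite mulrBr mulrBr mulrDr; lra.
have null N : (N0 <= N)%N -> mu.-negligible (\bigcap_i H N (N + i)%N).
  move=> N0N; have N1 : (0 < N)%N by apply: leq_trans N0N; exact: leq_maxr.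
  have mH i : measurable (H N (N + i)%N) by exact: measurable_determined (dH N i N0N).
  have mB : measurable (\bigcap_i H N (N + i)%N) by exact: bigcapT_measurable.
  exists (\bigcap_i H N (N + i)%N); split => //.
  rewrite prE//; congr EFin; apply/eqP; rewrite eq_le pr_ge0 andbT.
  apply/ler_addgt0Pl => e e0; rewrite addr0.
  have := near_nat (near_ln_ge (ln N%:R - ln e / (qc * c))) => -[i _ hi].
  have hi' : ln N%:R - ln e / (qc * c) <= ln (N + i)%:R :> R by apply: hi => /=; exact: leq_addl.
  apply: le_trans (_ : pr mu (H N (N + i)%N) <= _).
    by apply: le_pr => // x; apply.
  apply: (le_trans (step N i N0N)); rewrite -[leRHS](@lnK R) ?posrE// ler_expR.
  rewrite mulrC -ler_pdivlMr//; lra.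
have all : mu.-negligible (\bigcup_N \bigcap_i H (N0 + N)%N (N0 + N + i)%N).
  by apply: negligible_bigcup => N; apply: null; exact: leq_addr.
apply: negligibleS all => x /= nx.
apply: contrapT => nH; apply: nx => Xx N; apply: contrapT => hN; apply: nH.
exists N => // i _; split=> // j /andP[h1 h2] Ej; apply: hN; exists j; split=> //.
by apply: leq_trans h1; exact: leq_addl.
Qed.

(** The upper law for [- phi] with [eps = 1]: it keeps the sum over the initial stretch of a block
    from being too negative. *)
Lemma lil_below : {ae mu, forall x, X x -> \forall m \near \oo, - V m x <= 2 * lil_scale rho m%:R}.
Proof.
have b' x : X x -> `|- phi x| <= U by rewrite normrN; exact: bnd.
have d' n x y : X x -> X y -> agree n x y ->
    `|birkhoff (fun y => - phi y) n x - birkhoff (fun y => - phi y) n y| <= D.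
  by move=> Xx Xy xy; rewrite !birkhoffN opprK addrC distrC dist.
have e1 : 0 < (1 : R) <= 1 by rewrite ltr01 lexx.
have := lil_upper alpha01 muX (regularN alpha01 rphi) rho0 t00 K11 (mgf_opp mgf) qc0 qi_lb D0 d' U0 b' e1.
apply: filterS => x h Xx; apply: filterS (h Xx) => m.
by rewrite birkhoffN.
Qed.

(* Along [n_j = q^j] with [q] large, the increments [V_(n_(j+1)) - V_(n_j + M)] are
   quasi independent and carry almost all of [V_(n_(j+1))]. *)
Theorem lil_lower eps : 0 < eps <= 1 -> {ae mu, forall x, X x -> forall N, exists m, (N <= m)%N /\
  (1 - eps) * lil_scale rho m%:R <= V m x}.
Proof.
move=> /andP[e0 e1]; pose d := eps / 8.
have d0 : 0 < d by rewrite divr_gt0.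
have d8 : d <= 1 / 8 by rewrite /d; lra.
have d01 : 0 < d <= 1 / 8 by rewrite d0.
have d02 : 0 < d <= 1 / 2 by rewrite d0/=; lra.
have ed : 1 - eps = 1 - 8 * d by rewrite /d; field.
clearbody d.
have d20 : 0 < d ^+ 2 by rewrite exprn_gt0.
(* [q >= 2 / d^2] makes the initial stretch [n_j + M], at most [2 * n_j], shorter than
   [d^2 * n_(j+1)]; [q >= expR 1] gives [ln q >= 1]. *)
pose q := (Num.truncn (2 / d ^+ 2 + expR 1)).+3.
have qR : 2 / d ^+ 2 + expR 1 <= q%:R.
  apply: le_trans (ltW (truncnS_gt _)) _; rewrite ler_nat /q; exact: leqW (leqnSn _).
have qd : 2 <= d ^+ 2 * q%:R.
  by rewrite mulrC -ler_pdivrMr//; apply: le_trans qR; rewrite lerDl expR_ge0.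
have lq : 1 <= ln q%:R :> R.
  rewrite -[leLHS]expRK ler_ln ?posrE ?expR_gt0// ?ltr0Sn//.
  by apply: le_trans qR; rewrite lerDr divr_ge0// ltW.
have q3 : (3 <= q)%N by [].
clearbody q.
have q0 : (0 < q)%N by exact: leq_trans q3.
have qj j : (j < q ^ j)%N by apply: ltn_expl; exact: leq_trans q3.
pose n j := (q ^ j)%N; pose dd j := (n j.+1 - (n j + M))%N.
have [c0 [Q0 [kap [c00 kap0 Htail]]]] := tail_lb alpha01 muX rphi rho0 t00 K11 mgf d02.
(* Here [ln j] replaces [ln (ln n_(j+1)) = ln ((j + 1) * ln q)], to which it is asymptotically
   equal. *)
pose y j : R := (1 - 2 * d) * Num.sqrt (2 * rho * ((dd j)%:R * ln j%:R)).
pose E j := exceed A phi (dd j) ((1 - d) * y j).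
have nM j : (M <= j)%N -> (n j + M + j <= n j.+1)%N.
  move=> Mj; have := qj j; rewrite /n expnS; set a := (q ^ j)%N => ja.
  apply: (@leq_trans (3 * a)); last by rewrite leq_mul2r q3 orbT.
  by rewrite !mulSn mul0n addn0 addnA; apply: leq_add; [apply: leq_add => //; apply: leq_trans Mj _|]; exact: ltnW.
have ddE j : (M <= j)%N -> (n j + M + dd j = n j.+1)%N.
  by move=> Mj; rewrite subnKC// (leq_trans (leq_addr _ _) (nM j Mj)).
have ddj j : (M <= j)%N -> (j <= dd j)%N.
  by move=> Mj; rewrite -(leq_add2l (n j + M)) ddE// nM.
have rho2 : 0 < 2 * rho by rewrite mulr_gt0.
(* This product is the exponent of [1 / j] in the lower tail bound; being at most [1], it makes the
   series of probabilities diverge. *)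
have cub : (1 + 3 * d) * (1 - 2 * d) ^+ 2 <= 1.
  have : 0 <= d * d * (1 - 8 * d) by rewrite mulr_ge0 ?mulr_ge0 ?(ltW d0)//; lra.
  by rewrite expr2; lra.
have cc : 0 < c0 ^+ 2 / (2 * rho) by rewrite divr_gt0 ?exprn_gt0.
have : \forall j \near \oo, kap / j%:R <= pr mu (E j).
  near=> j.
  have Mj : (M <= j)%N by near: j; exists M.
  have lj : 1 <= ln j%:R :> R by near: j; exact: near_nat (near_ln_ge 1).
  have lQ : Q0 / (1 - 2 * d) ^+ 2 <= ln j%:R :> R by near: j; exact: near_nat (near_ln_ge _).
  have lc : ln j%:R <= c0 ^+ 2 / (2 * rho) * j%:R by near: j; exact: near_nat (near_ln_small cc).
  have j0 : 0 < j%:R :> R by rewrite ltNge; apply/negP => /ln0 e; rewrite e ler10 in lj.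
  have l0 : 0 <= ln j%:R :> R by exact: le_trans lj.
  have jd : j%:R <= (dd j)%:R :> R by rewrite ler_nat ddj.
  have dj0 : 0 < (dd j)%:R :> R by exact: lt_le_trans jd.
  have s0 : 0 <= 2 * rho * ((dd j)%:R * ln j%:R) by rewrite mulr_ge0 ?(ltW rho2)// mulr_ge0 ?(ltW dj0).
  have d2 : 0 < 1 - 2 * d by lra.
  have d22 : 0 < (1 - 2 * d) ^+ 2 by rewrite exprn_gt0.
  have yE : y j ^+ 2 / (2 * rho * (dd j)%:R) = (1 - 2 * d) ^+ 2 * ln j%:R.
    rewrite /y exprMn sqr_sqrtr//; move: (dd j)%:R dj0 => a a0.
    by field; rewrite !gt_eqF.
  have y0 : 0 <= y j by rewrite mulr_ge0 ?sqrtr_ge0// ltW.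
  have yc : y j <= c0 * (dd j)%:R.
    apply: (@le_trans _ _ (1 * Num.sqrt (2 * rho * ((dd j)%:R * ln j%:R)))).
      by rewrite ler_wpM2r ?sqrtr_ge0//; lra.
    have -> : c0 * (dd j)%:R = Num.sqrt ((c0 * (dd j)%:R) ^+ 2).
      by rewrite sqrtr_sqr ger0_norm// mulr_ge0// ltW.
    have h : 2 * rho * ln j%:R <= c0 ^+ 2 * (dd j)%:R.
      rewrite mulrC -ler_pdivlMr//; apply: (le_trans lc).
      by rewrite mulrAC ler_pM2r ?invr_gt0// ler_pM2l ?exprn_gt0.
    rewrite mul1r ler_wsqrtr// mulrCA exprMn [(dd j)%:R ^+ 2]expr2 mulrA [leRHS]mulrC.
    by rewrite -!mulrA ler_pM2l// mulrA [leRHS]mulrC.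
  have dE : determined A (dd j) (E j) by exact: determined_hull.
  have := Htail (dd j) (E j) (y j) _ dE _ _ _; rewrite yE.
  have -> : kap / j%:R = kap * expR (- ln j%:R) by rewrite expRN lnK.
  move=> h; apply: le_trans (h _ _ _ _).
  - rewrite ler_pM2l// ler_expR lerN2 mulrA.
    by apply: le_trans (ler_wpM2r l0 cub) _; rewrite mul1r.
  - by rewrite -(ltr0n R).
  - by move=> x Xx yx; exact: exceedP.
  - by rewrite y0.
  - by rewrite mulrC -ler_pdivrMr.
move=> -[j0 _ hj0].
have dE j : determined A (dd j) (E j) by exact: determined_hull.
have := spaced_events_io (n := n) (j0 := maxn M j0) kap0 dE _ _.
move=> /(_ _ _)io; have {}io := io
   (fun j h => ddE j (leq_trans (leq_maxl _ _) h)) (fun j h => hj0 j (leq_trans (leq_maxr _ _) h)).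
apply: filterS2 lil_below io => x hb hio Xx N.
have [N1 _ hN1] := hb Xx.
have [J _ hJ] : \forall j \near \oo, [/\ (M <= j)%N, (N <= j)%N, (N1 <= j)%N, 1 <= ln j%:R :> R &
    ln (2 * ln q%:R) <= d * ln j%:R /\ (D / d) ^+ 2 / (2 * rho) <= j%:R].
  near=> j; split; [by near: j; exists M|by near: j; exists N|by near: j; exists N1| |split].
  - by near: j; exact: near_nat (near_ln_ge 1).
  - by rewrite -ler_pdivrMl//; near: j; exact: near_nat (near_ln_ge _).
  - by near: j; exact: near_nat (near_pinfty_ge _).
have [j [Jj Ej]] := hio Xx J.
have [Mj Nj N1j lj [lqd jD]] := hJ j Jj.
have nj : (j < n j)%N := qj j.
have jn1 : (j < n j.+1)%N by apply: leq_trans (qj j.+1).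
exists (n j.+1); split; first by apply: leq_trans Nj _; exact: ltnW.
rewrite -(ddE j Mj) birkhoffD ed.
have b1 : - V (n j + M) x <= 2 * lil_scale rho (n j + M)%:R.
  by apply: hN1 => /=; apply: leq_trans N1j _; apply: leq_trans (ltnW nj) (leq_addr _ _).
have b2 : (1 - d) * y j - D <= V (dd j) (iter (n j + M) (@shift k) x) := exceed_ge dist Ej.
rewrite ddE//.
have jR : 0 < j%:R :> R by rewrite ltNge; apply/negP => /ln0 e; rewrite e ler10 in lj.
have wE : (n j.+1)%:R = q%:R ^+ j.+1 :> R by rewrite natrX.
have q0R : 0 < q%:R :> R by rewrite ltr0n.
have lw : ln (n j.+1)%:R = j.+1%:R * ln q%:R :> R by rewrite wE lnXn// mulr_natl.
have lw0 : 0 < ln (n j.+1)%:R :> R by rewrite lw mulr_gt0 ?ltr0Sn//; lra.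
have n2w : (n j + M)%:R <= (n j.+1)%:R :> R by rewrite ler_nat -ddE// leq_addr.
have l2 : 1 <= ln (n j + M)%:R :> R.
  apply: (le_trans lj); rewrite ler_ln ?posrE// ?ltr0n ?ler_nat.
    by apply: leq_trans (ltnW nj) (leq_addr _ _).
  by rewrite addn_gt0 expn_gt0 q0.
have s2 : lil_scale rho (n j + M)%:R <= Num.sqrt (2 * rho * ((n j + M)%:R * ln (ln (n j.+1)%:R))).
  rewrite /lil_scale ler_wsqrtr// ler_wpM2l ?(ltW rho2)// ler_wpM2l//.
  have l20 : 0 < ln (n j + M)%:R :> R by exact: lt_le_trans l2.
  rewrite ler_ln ?posrE// ler_ln ?posrE ?ltr0n//.
    by rewrite addn_gt0 expn_gt0 q0.
  by rewrite expn_gt0 q0.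
have lkl : ln j%:R <= ln (ln (n j.+1)%:R) :> R.
  rewrite ler_ln ?posrE// lw; apply: le_trans (_ : j.+1%:R * 1 <= _).
    by rewrite mulr1 ler_nat.
  by rewrite ler_pM2l ?ltr0Sn.
have ll : ln (ln (n j.+1)%:R) <= (1 + d) * ln j%:R.
  have h : ln (n j.+1)%:R <= 2 * ln q%:R * j%:R :> R.
    rewrite lw mulrAC ler_wpM2r ?(le_trans ler01)// -natr1 mulr_natl mulr2n lerD2l.
    by rewrite ler1n -(ltr0n R).
  have l2q : 0 < 2 * ln q%:R :> R by rewrite mulr_gt0// (lt_le_trans ltr01).
  apply: (@le_trans _ _ (ln (2 * ln q%:R * j%:R))).
    by rewrite ler_ln ?posrE// mulr_gt0.
  by rewrite lnM ?posrE//; lra.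
have nd : (n j + M)%:R <= d ^+ 2 * (n j.+1)%:R.
  apply: (@le_trans _ _ (2 * (n j)%:R)).
    by rewrite mulr_natl mulr2n -natrD ler_nat leq_add2l; apply: leq_trans Mj (ltnW nj).
  by rewrite /n expnS natrM mulrA ler_wpM2r.
have DS : D <= d * Num.sqrt (2 * rho * ((n j.+1)%:R * ln (ln (n j.+1)%:R))).
  rewrite mulrC -ler_pdivrMr//; apply: (le_trans (ler_norm _)); rewrite -sqrtr_sqr ler_wsqrtr//.
  apply: (@le_trans _ _ (2 * rho * j%:R)); first by rewrite [leRHS]mulrC -ler_pdivrMr.
  rewrite ler_pM2l// -[leLHS]mulr1 ler_pM//; last exact: le_trans lkl.
  by rewrite ler_nat ltnW.
have := lower_numeric d01 (ler0n _ _) (le_trans ler01 lj) (ler0n _ _) lkl ll nd DS.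
have -> : (n j.+1)%:R - (n j + M)%:R = (dd j)%:R :> R by rewrite -ddE// natrD [X in X - _]addrC addrK.
rewrite -/(y j) -/(lil_scale rho (n j.+1)%:R) => h.
lra.
Unshelve. all: by end_near.
Qed.
End LowerLil.

(** * Recurrence *)

Section PsiNumerics.
Variable R : realType.
Variables h rho : R.
Hypothesis h0 : 0 < h.
Hypothesis rho0 : 0 < rho.
Implicit Types (y w d s : R).

Lemma logc_ge0 y : 0 <= logc y.
Proof. by rewrite /logc; case: ifPn => //; rewrite -ltNge => /ltW/ln_ge0. Qed.

Lemma logcE y : 1 <= y -> logc y = ln y.
Proof.
rewrite /logc le_eqVlt => /orP[/eqP<-|y1]; first by rewrite lexx ln1.
by rewrite leNgt y1.
Qed.

Lemma le_logc y w : y <= w -> logc y <= logc w.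
Proof.
move=> yw; rewrite {1}/logc; case: ifPn => [_|]; first exact: logc_ge0.
rewrite -ltNge => y1; rewrite logcE ?(le_trans (ltW y1))// ler_ln ?posrE//.
  exact: lt_trans y1.
by apply: lt_le_trans yw; exact: lt_trans y1.
Qed.

Lemma powR_3half : h `^ (3%:R / 2%:R) = h * Num.sqrt h.
Proof.
have -> : 3%:R / 2%:R = 1 + 2^-1 :> R by field.
by rewrite powRD ?(gt_eqF h0) ?implybT// powRr1 ?ltW// powR12_sqrt// ltW.
Qed.

(** The power [3 / 2] of [h] in [psi_fun] is what makes [h * psi] equal to [y] plus [s] times the
    iterated-logarithm scale at the depth [y / h]. *)
Lemma psi_scaled s y w : h * (y / h + s / (h `^ (3%:R / 2%:R)) * Num.sqrt (2 * rho * y * w)) =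
  y + s * Num.sqrt (2 * rho * (y / h * w)).
Proof.
have hh : h * (y / h) = y by rewrite mulrC divfK// gt_eqF.
have -> : 2 * rho * y * w = h * (2 * rho * (y / h * w)) by rewrite -{1}hh; ring.
rewrite powR_3half sqrtrM ?ltW// mulrDr hh; congr (_ + _).
have s0 : Num.sqrt h != 0 by rewrite gt_eqF// sqrtr_gt0.
by set S := Num.sqrt (2 * rho * _); field; rewrite s0 gt_eqF.
Qed.

Lemma near_natln (P : R -> Prop) : (\forall y \near +oo, P y) -> \forall n \near \oo, P (ln n%:R).
Proof.
by move=> hP; apply: (@near_nat R (fun y => P (ln y))); exact: (@near_comp R (@ln R) P (@near_ln_ge R)).
Qed.

Lemma near_psi_ge (s B : R) : 0 <= s -> \forall n \near \oo, B <= (psi_fun h rho s n)%:R.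
Proof.
move=> s0; near=> n.
have l1 : (B + 1) * h <= ln n%:R by near: n; exact: near_natln (near_pinfty_ge _).
have n1 : 1 <= n%:R :> R by rewrite ler1n; near: n; exists 1%N.
rewrite /psi_fun; apply: ltW; rewrite -(ltrD2r 1) natr1; apply: le_lt_trans (truncnS_gt _).
rewrite logcE//; apply: (@le_trans _ _ (ln n%:R / h)); first by rewrite ler_pdivlMr.
by rewrite lerDl mulr_ge0 ?sqrtr_ge0// divr_ge0// powR_ge0.
Unshelve. all: by end_near.
Qed.

(** The first part keeps the two occurrences of the cylinder disjoint. The second makes the return
    probabilities comparable to [1 / (n * (ln n)^2)]: of the surplus [e], one half pays for the
    fluctuation of [V] and the other for [2 * ln (ln n)], while [h] pays for the floor. *)
Lemma psi_upper_numeric e : 0 < e <= 1 -> \forall n \near \oo,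
  (psi_fun h rho (1 + e) n <= n)%N /\
  (1 + e / 4) * lil_scale rho (psi_fun h rho (1 + e) n)%:R - (psi_fun h rho (1 + e) n)%:R * h <=
  h - (ln n%:R + 2 * ln (ln n%:R)).
Proof.
move=> /andP[e0 e1]; pose d := e / 8; have d0 : 0 < d by rewrite divr_gt0.
have dE : d = e / 8 by [].
clearbody d.
have c0 : 0 < (1 + d) / h by rewrite divr_gt0// addr_gt0.
have c0' : 0 < ((1 + d) / h)^-1 by rewrite invr_gt0.
have d4 : 0 < (d / 2) ^+ 2 / (2 * rho / h) by rewrite !divr_gt0 ?exprn_gt0 ?divr_gt0 ?mulr_gt0.
have k0 : 0 < 4 / (e * Num.sqrt (2 * rho / h)).
  by rewrite divr_gt0// mulr_gt0// sqrtr_gt0 divr_gt0// mulr_gt0.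
near=> n; set m := psi_fun h rho (1 + e) n.
have L1 : 1 <= ln n%:R :> R by near: n; exact: near_natln (near_pinfty_ge _).
have ll1 : 1 <= ln (ln (ln n%:R)) :> R by near: n; exact: near_natln (near_lnln_ge _).
have ll0 : 1 <= ln (ln n%:R) :> R by near: n; exact: near_natln (near_ln_ge _).
have lls : ln (ln (ln n%:R)) <= (d / 2) ^+ 2 / (2 * rho / h) * ln n%:R :> R.
  by near: n; exact: near_natln (near_lnln_small d4).
have lsc : ln (ln ((1 + d) / h * ln n%:R)) <= (1 + d) * ln (ln (ln n%:R)) :> R.
  by near: n; exact: near_natln (near_lnln_scale c0 d0).
have lsq : 4 / (e * Num.sqrt (2 * rho / h)) * ln (ln n%:R) + 0 <= Num.sqrt (ln n%:R) :> R.
  by near: n; exact: near_natln (near_ln_sqrt 0 k0).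
have mB : expR 1 <= m%:R :> R.
  by rewrite /m; near: n; exact: near_psi_ge (addr_ge0 ler01 (ltW e0)).
have Ln : ln n%:R <= ((1 + d) / h)^-1 * n%:R :> R.
  by near: n; exact: near_nat (near_ln_small c0').
have n1 : 1 <= n%:R :> R by rewrite ler1n; near: n; exists 1%N.
set L := ln n%:R in L1 ll1 ll0 lls lsc lsq Ln *.
have mE : m = Num.truncn (L / h + (1 + e) / (h `^ (3%:R / 2%:R)) * Num.sqrt (2 * rho * L * ln (ln L))).
  by rewrite /m /psi_fun (logcE n1) -/L (logcE L1) (logcE ll0).
clearbody m L; set Z := _ + _ in mE.
have hZ : h * Z = L + (1 + e) * Num.sqrt (2 * rho * (L / h * ln (ln L))) by rewrite psi_scaled.
set ll := ln (ln L) in ll1 lls lsc hZ mE *.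
set T := Num.sqrt (2 * rho * (L / h * ll)) in hZ *.
have L0 : 0 < L by exact: lt_le_trans L1.
have l0 : 0 < ll by exact: lt_le_trans ll1.
have r2 : 0 < 2 * rho by rewrite mulr_gt0.
have T0 : 0 <= T by exact: sqrtr_ge0.
have TL : (1 + e) * T <= d * L.
  have : T <= d / 2 * L.
    have -> : d / 2 * L = Num.sqrt ((d / 2 * L) ^+ 2).
      by rewrite sqrtr_sqr ger0_norm// mulr_ge0 ?(ltW L0)// divr_ge0// ltW.
    rewrite ler_wsqrtr//.
    have h1 : ll * (2 * rho / h) <= (d / 2) ^+ 2 * L.
      by rewrite -ler_pdivlMr ?divr_gt0// mulrAC.
    have -> : 2 * rho * (L / h * ll) = L * (ll * (2 * rho / h)) by ring.
    have -> : (d / 2 * L) ^+ 2 = L * ((d / 2) ^+ 2 * L) by ring.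
    by rewrite ler_pM2l.
  have h2 : (1 + e) * T <= 2 * T by rewrite ler_wpM2r//; lra.
  by move=> h3; lra.
have mZ : m%:R <= Z.
  by rewrite mE truncn_le// -(pmulr_rge0 _ h0) hZ addr_ge0 ?(ltW L0)// mulr_ge0// addr_ge0 ?(ltW e0).
have Zm : Z < m%:R + 1 by rewrite mE natr1 truncnS_gt.
have hm : h * m%:R <= (1 + d) * L.
  have := ler_wpM2l (ltW h0) mZ; rewrite hZ; lra.
have mw : m%:R <= (1 + d) / h * L by rewrite mulrAC ler_pdivlMr// mulrC.
split.
  rewrite -(ler_nat R); apply: (le_trans mw).
  by rewrite -ler_pdivlMl.
have lm : 1 <= ln m%:R :> R.
  by rewrite -[leLHS]expRK ler_ln ?posrE ?expR_gt0//; apply: lt_le_trans mB; exact: expR_gt0.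
have sm : lil_scale rho m%:R <= (1 + d) * T.
  apply: (le_trans (le_lil_scale rho0 mw lm)).
  have -> : (1 + d) * T = Num.sqrt ((1 + d) ^+ 2 * (2 * rho * (L / h * ll))).
    by rewrite sqrtrM ?sqr_ge0// sqrtr_sqr ger0_norm// addr_ge0// ltW.
  rewrite ler_wsqrtr//.
  rewrite [leRHS]mulrCA ler_pM2l// expr2.
  have -> : (1 + d) * (1 + d) * (L / h * ll) = (1 + d) / h * L * ((1 + d) * ll) by ring.
  by rewrite ler_wpM2l// mulr_ge0 ?(ltW c0) ?(ltW L0).
have TLL : 2 * ln L <= e / 2 * T.
  set S0 := Num.sqrt (2 * rho / h) in lsq.
  have S00 : 0 < S0 by rewrite sqrtr_gt0 divr_gt0.
  have ST : S0 * Num.sqrt L <= T.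
    rewrite -sqrtrM ?divr_ge0 ?(ltW r2) ?(ltW h0)// ler_wsqrtr//.
    have -> : 2 * rho * (L / h * ll) = 2 * rho / h * L * ll by ring.
    by rewrite ler_peMr// mulr_ge0 ?(ltW L0)// divr_ge0 ?(ltW r2) ?(ltW h0).
  have h1 : 4 * ln L <= e * S0 * Num.sqrt L.
    rewrite [leRHS]mulrC -ler_pdivrMr ?mulr_gt0//.
    by apply: le_trans lsq; rewrite addr0 mulrAC.
  have h2 := ler_wpM2l (ltW e0) ST.
  by rewrite mulrA in h2; lra.
have s1 : (1 + e / 4) * lil_scale rho m%:R <= (1 + e / 2) * T.
  have h1 : (1 + e / 4) * lil_scale rho m%:R <= (1 + e / 4) * ((1 + d) * T).
    by rewrite ler_wpM2l// addr_ge0// divr_ge0// ltW.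
  apply: (le_trans h1); rewrite mulrA ler_wpM2r//.
  have h2 : 0 <= e * (1 - e) by rewrite mulr_ge0 ?(ltW e0) ?subr_ge0.
  by rewrite dE; lra.
have := ltW Zm; rewrite -(ler_pM2l h0) hZ mulrDr mulr1 [h * m%:R]mulrC.
by lra.
Unshelve. all: by end_near.
Qed.

Lemma lil_scale_small c : 0 < c -> \forall w \near +oo, lil_scale rho w <= c * w.
Proof.
move=> c0; have d0 : 0 < c ^+ 2 / (2 * rho) by rewrite divr_gt0 ?exprn_gt0 ?mulr_gt0.
near=> w.
have w1 : 1 <= w by near: w; exact: near_pinfty_ge.
have lw : ln (ln w) <= c ^+ 2 / (2 * rho) * w by near: w; exact: near_lnln_small d0.
have w0 : 0 < w by exact: lt_le_trans w1.
have -> : c * w = Num.sqrt ((c * w) ^+ 2).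
  by rewrite sqrtr_sqr ger0_norm// mulr_ge0 ?(ltW c0) ?(ltW w0).
rewrite ler_wsqrtr//.
have h1 : ln (ln w) * (2 * rho) <= c ^+ 2 * w by rewrite -ler_pdivlMr ?mulr_gt0// mulrAC.
have -> : 2 * rho * (w * ln (ln w)) = w * (ln (ln w) * (2 * rho)) by ring.
have -> : (c * w) ^+ 2 = w * (c ^+ 2 * w) by ring.
by rewrite ler_pM2l.
Unshelve. all: by end_near.
Qed.

(** For such [n] one has [ln n <= m * h - (1 - e / 2) * lil_scale rho m], and the correction in
    [psi_fun] is at most [(1 - e) * (1 + e / 2) <= 1 - e / 2] times the scale at [m]. Monotonicity
    of [logc] also covers small [n]. *)
Lemma psi_lower_numeric (e : R) : 0 < e <= 1 / 2 -> \forall m \near \oo, forall n : nat,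
  n%:R <= expR (m%:R * h - (1 - e / 2) * lil_scale rho m%:R) ->
  (psi_fun h rho (1 - e) n <= m)%N.
Proof.
move=> /andP[e0 e1]; have d0 : 0 < e / 2 by rewrite divr_gt0.
have h2 : 0 < h / 2 by rewrite divr_gt0.
near=> m.
have sm : lil_scale rho m%:R <= h / 2 * m%:R.
  by near: m; exact: near_nat (lil_scale_small h2).
have mB : expR 1 / (h / 2) <= m%:R by near: m; exact: near_nat (near_pinfty_ge _).
have lsc : ln (ln (h * m%:R)) <= (1 + e / 2) * ln (ln m%:R).
  by near: m; exact: near_nat (near_lnln_scale h0 d0).
have ll0 : 0 <= ln (ln m%:R) :> R by near: m; exact: near_nat (near_lnln_ge _).
move=> n; set s := lil_scale rho m%:R in sm *; set Y := _ - _ => nY.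
have s0 : 0 <= s by exact: sqrtr_ge0.
have YU : Y <= h * m%:R.
  by rewrite /Y mulrC gerBl mulr_ge0//; lra.
have YL : expR 1 <= Y.
  have h1 : expR 1 <= h / 2 * m%:R by rewrite mulrC -ler_pdivrMr.
  have h3 : (1 - e / 2) * s <= 1 * s by rewrite ler_wpM2r//; lra.
  by rewrite /Y; move: (expR 1) h1 => z h1; lra.
have YE : Y = m%:R * h - (1 - e / 2) * s by [].
clearbody Y; have m0 : 0 <= m%:R :> R by [].
have Y0 : 0 < Y by apply: lt_le_trans YL; exact: expR_gt0.
have Y1 : 1 <= Y by apply: le_trans YL; rewrite -[leLHS]expR0 ler_expR.
have lY : 1 <= ln Y by rewrite -[leLHS]expRK ler_ln ?posrE ?expR_gt0.
set L := logc (n%:R : R).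
have LY : L <= Y.
  apply: (le_trans (le_logc nY)); rewrite logcE ?expRK//.
  by rewrite -[leLHS]expR0 ler_expR ltW.
have L0 : 0 <= L by exact: logc_ge0.
have l3 : logc (logc L) <= (1 + e / 2) * ln (ln m%:R).
  apply: (le_trans (le_logc (le_logc LY))); rewrite (logcE Y1) (logcE lY).
  apply: le_trans lsc; have lY0 : 0 < ln Y by exact: lt_le_trans lY.
  have hm : 0 < h * m%:R by exact: lt_le_trans YU.
  have lYm : ln Y <= ln (h * m%:R) by rewrite ler_ln ?posrE.
  by rewrite ler_ln ?posrE//; exact: lt_le_trans lYm.
rewrite /psi_fun -/L; set Z := _ + _.
have hZ : h * Z = L + (1 - e) * Num.sqrt (2 * rho * (L / h * logc (logc L))) by rewrite psi_scaled.
have e10 : 0 <= 1 - e by lra.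
have Z0 : 0 <= Z by rewrite -(pmulr_rge0 _ h0) hZ addr_ge0// mulr_ge0 ?sqrtr_ge0.
rewrite -(ler_nat R); apply: (@le_trans _ _ Z); first by rewrite truncn_le.
rewrite -(ler_pM2l h0) hZ.
have sq : Num.sqrt (2 * rho * (L / h * logc (logc L))) <= (1 + e / 2) * s.
  have -> : (1 + e / 2) * s = Num.sqrt ((1 + e / 2) ^+ 2 * (2 * rho * (m%:R * ln (ln m%:R)))).
    by rewrite sqrtrM ?sqr_ge0// sqrtr_sqr ger0_norm// addr_ge0// ltW.
  rewrite ler_wsqrtr// [leRHS]mulrCA ler_wpM2l ?mulr_ge0 ?(ltW rho0)//.
  have -> : (1 + e / 2) ^+ 2 * (m%:R * ln (ln m%:R)) =
      ((1 + e / 2) * m%:R) * ((1 + e / 2) * ln (ln m%:R)) by ring.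
  rewrite ler_pM ?logc_ge0 ?divr_ge0 ?(ltW h0)// ler_pdivrMr//.
  apply: (le_trans LY); apply: (le_trans YU);
  by rewrite -mulrA [m%:R * h]mulrC ler_peMl ?mulr_ge0 ?(ltW h0)// lerDl ltW.
have h3 := ler_wpM2l e10 sq.
have ee : 0 <= e * e * s by rewrite mulr_ge0// mulr_ge0// ltW.
rewrite [h * m%:R]mulrC; lra.
Unshelve. all: by end_near.
Qed.

End PsiNumerics.

Section Recurrence.
Variables (R : realType) (k : nat) (A : 'M[int]_k.+2) (mu : probability (Sig k) R).
Variables (phi : Sig k -> R) (rho h C Cq qc D : R) (M : nat).
Hypothesis muX : mu (SigmaA A) = 1%E.
Hypothesis mu_inv : forall E : set (Sig k), measurable E -> mu (@shift k @^-1` E) = mu E.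
Implicit Types (x y z : Sig k) (E F : set (Sig k)).
Local Notation X := (SigmaA A).
Local Notation V := (birkhoff phi).
Hypothesis h0 : 0 < h.
Hypothesis rho0 : 0 < rho.
Hypothesis C0 : 0 < C.
Hypothesis Cq0 : 0 < Cq.
Hypothesis qc0 : 0 < qc.
Hypothesis ball_ub : forall n x, X x -> pr mu (ball_seq A n x) <= C * expR (V n x - n%:R * h).
Hypothesis ball_lb : forall n x, X x -> expR (V n x - n%:R * h) <= C * pr mu (ball_seq A n x).
Hypothesis qi_ub : forall j l E F, determined A j E -> determined A l F ->
  pr mu (E `&` iter j (@shift k) @^-1` F) <= Cq * pr mu E * pr mu F.
Hypothesis qi_lb : forall j l E F, determined A j E -> determined A l F ->
  qc * pr mu E * pr mu F <= pr mu (E `&` iter (j + M) (@shift k) @^-1` F).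
Hypothesis dist : forall n x y, X x -> X y -> agree n x y -> `|V n x - V n y| <= D.

Let mX : measurable X := measurable_SigmaA A.
Let prX : pr mu X = 1.
Proof. by rewrite /pr muX. Qed.

(** Total probability: a bound on the conditional probability of [E] in every [n]-cylinder that it
    meets bounds its probability. *)
Lemma pr_partition_le n E (c : R) : measurable E -> E `<=` X ->
  (forall x, E x -> pr mu (E `&` ball_seq A n x) <= c * pr mu (ball_seq A n x)) -> 0 <= c ->
  pr mu E <= c.
Proof.
move=> mE EX h1 c0; rewrite (pr_partition (A := A) mu n mE EX).
apply: le_trans (_ : \sum_(w : n.-tuple (alph k)) c * pr mu (X `&` cylA A w) <= _); last first.
  by rewrite -mulr_sumr -(pr_partition mu n mX (@subset_refl _ X)) prX mulr1.
apply: ler_sum => w _; have [->|] := eqVneq (E `&` cylA A w) set0.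
  by rewrite pr0 mulr_ge0// pr_ge0.
move=> /set0P[x [Ex wx]]; have -> : X `&` cylA A w = cylA A w by apply/setIidPr => y [].
by rewrite (ball_seqE wx); exact: h1.
Qed.

(* The [hull] makes the condition on [V m] depend on the first [m] coordinates only,
   at the price of the distortion constant [D]. *)
Definition low_return n m (b : R) := [set x | [/\ X x, agree m (iter n (@shift k) x) x &
  hull A m [set y | X y /\ V m y <= b] x]].

Lemma determined_low_return n m (b : R) : determined A (n + m) (low_return n m b).
Proof.
split=> [x []//|x y Xy xy [Xx ag hx]]; split=> //.
  move=> l lm; rewrite iter_shiftE -(xy l) ?ltn_addl// -(ag l lm) iter_shiftE xy//.
  by rewrite ltn_add2l.
have [_ hh] := determined_hull A m [set y | X y /\ V m y <= b]; apply: hh hx => //.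
by apply: agree_leq xy; exact: leq_addl.
Qed.

(** Inside one [m]-cylinder a return is a second visit to that fixed cylinder, which
    quasi-independence controls because [m <= n]; the bound on [V m] makes the cylinder small. *)
Lemma low_return_le n m (b : R) : (m <= n)%N ->
  pr mu (low_return n m b) <= Cq * C * expR (b + D - m%:R * h).
Proof.
move=> mn; have dS := determined_low_return n m b.
apply: (pr_partition_le (n := m)); [exact: measurable_determined dS|exact: dS.1| |]; last first.
  by rewrite !mulr_ge0 ?expR_ge0 ?(ltW C0) ?(ltW Cq0).
move=> x [Xx ag hx]; set B := ball_seq A m x.
have dB : determined A m B by exact: determined_ball.
have mB := measurable_determined dB.
apply: (@le_trans _ _ (pr mu (B `&` iter n (@shift k) @^-1` B))).
  apply: le_pr.
  - by apply: measurableI => //; exact: measurable_determined dS.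
  - by apply: measurableI => //; exact: measurable_iter_shift.
  move=> y [[Xy agy _] [_ xy]]; split=> //; split; first exact: SigmaA_shift.
  by apply: agree_trans xy _; exact: agree_sym.
have := qi_ub (determined_leq mn dB) dB => h1; apply: (le_trans h1).
rewrite ler_wpM2r ?pr_ge0// -mulrA ler_wpM2l ?(ltW Cq0)//.
apply: (le_trans (ball_ub m Xx)); rewrite ler_pM2l// ler_expR lerD2r.
case: hx => _ [y [[Xy yb] xy]]; have := dist Xx Xy xy; rewrite ler_norml; lra.
Qed.

Definition no_return E p L := [set x | E x /\
  forall i, (0 < i <= L)%N -> ~ E (iter (i * p) (@shift k) x)].

(** Trials at spacing [m + M] inspect windows of [m] letters separated by gaps of [M], so each one
    fails with conditional probability at most [1 - qc * pr mu E]. *)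
Lemma no_return_le E m L : determined A m E ->
  determined A (L * (m + M) + m) (no_return E (m + M) L) /\
  pr mu (no_return E (m + M) L) <= pr mu E * expR (- (qc * pr mu E * L%:R)).
Proof.
move=> dE; elim: L => [|L [dQ IH]].
  have -> : no_return E (m + M) 0 = E.
    by apply/seteqP; split=> [x []//|x Ex]; split=> // -[].
  by rewrite mulr0 oppr0 expR0 mulr1.
have SL : (L.+1 * (m + M) = L * (m + M) + m + M)%N by rewrite mulSn addnC addnA.
have QE : no_return E (m + M) L.+1 =
    no_return E (m + M) L `\` iter (L * (m + M) + m + M) (@shift k) @^-1` E.
  apply/seteqP; split=> x.
    move=> [Ex nE]; split; last by rewrite /= -SL; apply: nE; rewrite ltnS leqnn.
    by split=> // i /andP[i0 iL]; apply: nE; rewrite i0 leqW.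
  move=> [[Ex nE] nS]; split=> // i /andP[i0]; rewrite leq_eqVlt => /orP[/eqP->|iL].
    by rewrite SL.
  by apply: nE; rewrite i0.
have mQ := measurable_determined dQ.
have mS : measurable (iter (L * (m + M) + m + M) (@shift k) @^-1` E).
  by apply: measurable_iter_shift; exact: measurable_determined dE.
split.
  have -> : no_return E (m + M) L.+1 = no_return E (m + M) L `\`
      (X `&` iter (L * (m + M) + m + M) (@shift k) @^-1` E).
    rewrite QE; apply/seteqP; split=> x [Qx nS]; split=> //; first by case.
    by move=> Sx; apply: nS; split=> //; exact: dQ.1.
  rewrite SL; apply: determinedD; last exact: determined_shift.
  by apply: determined_leq dQ; rewrite -addnA leq_addr.
have h1 := qi_lb dQ dE; have := prDI mu mQ mS; rewrite -QE => h2.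
set p := pr mu E in IH h1 *; set q := pr mu (no_return E (m + M) L) in IH h1 h2.
set q' := pr mu (no_return _ _ _) in h2 *.
have q0 : 0 <= q by exact: pr_ge0.
have h3 : q' <= q * (1 - qc * p) by rewrite mulrBr; lra.
apply: (le_trans h3); apply: (le_trans (ler_wpM2l q0 (expR_ge1Dx _))).
apply: (@le_trans _ _ (p * expR (- (qc * p * L%:R)) * expR (- (qc * p)))).
  by rewrite ler_wpM2r ?expR_ge0.
by rewrite -mulrA -expRD -opprD -[X in _ + X]mulr1 -mulrDr natr1.
Qed.

Definition high_no_return m L (b : R) := [set x | [/\ X x,
  hull A m [set y | X y /\ b <= V m y] x &
  forall i, (0 < i <= L)%N -> ~ agree m (iter (i * (m + M)) (@shift k) x) x]].

Lemma determined_high_no_return m L (b : R) :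
  determined A (L * (m + M) + m) (high_no_return m L b).
Proof.
split=> [x []//|x y Xy xy [Xx hx nr]]; split=> //.
  have [_ hh] := determined_hull A m [set y | X y /\ b <= V m y]; apply: hh hx => //.
  by apply: agree_leq xy; exact: leq_addl.
move=> i /andP[i0 iL] ag; apply: (nr i); first by rewrite i0.
move=> l lm; rewrite iter_shiftE xy; last first.
  by rewrite -addnS leq_add// leq_mul2r iL orbT.
by rewrite (xy l) ?ltn_addl// -(ag l lm) iter_shiftE.
Qed.

(** Within an [m]-cylinder [B] the event says that all trials miss [B]; the measure of [B] is
    bounded below because [V m >= b - D] on it. *)
Lemma high_no_return_le m L (b : R) :
  pr mu (high_no_return m L b) <= expR (- (qc * (C^-1 * expR (b - D - m%:R * h)) * L%:R)).
Proof.
have dS := determined_high_no_return m L b.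
apply: (pr_partition_le (n := m)); [exact: measurable_determined dS|exact: dS.1| |exact: expR_ge0].
move=> x [Xx hx nr]; set B := ball_seq A m x.
have dB : determined A m B by exact: determined_ball.
have [dN prN] := no_return_le L dB.
apply: (@le_trans _ _ (pr mu (no_return B (m + M) L))).
  apply: le_pr; [|exact: measurable_determined dN|].
    by apply: measurableI; [exact: measurable_determined dS|exact: measurable_determined dB].
  move=> y [[Xy _ nry] By]; split=> // i iL [_ ag]; apply: (nry i iL).
  by apply: agree_trans (agree_sym ag) _; case: By.
apply: (le_trans prN); rewrite mulrC ler_wpM2r ?pr_ge0// ler_expR lerN2 ler_wpM2r// ler_pM2l//.
rewrite ler_pdivrMl//; apply: le_trans (ball_lb m Xx); rewrite ler_expR lerD2r.
case: hx => _ [y [[Xy yb] xy]]; have := dist Xx Xy xy; rewrite ler_norml; lra.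
Qed.

Hypothesis lil_ub : forall e : R, 0 < e <= 1 ->
  {ae mu, forall x, X x -> \forall m \near \oo, V m x <= (1 + e) * lil_scale rho m%:R}.
Hypothesis lil_lb : forall e : R, 0 < e <= 1 -> {ae mu, forall x, X x -> forall N,
  exists m, (N <= m)%N /\ (1 - e) * lil_scale rho m%:R <= V m x}.

(** By the upper law every sufficiently late return is a low return, and low returns are
    summable. *)
Lemma ae_rare_recurrence (e : R) : 0 < e <= 1 ->
  {ae mu, forall x, ~ recurrence_set A (psi_fun h rho (1 + e)) x}.
Proof.
move=> e01; have /andP[e0 e1] := e01.
have e4 : 0 < e / 4 <= 1 by rewrite divr_gt0//=; lra.
pose psi := psi_fun h rho (1 + e).
pose b n : R := (1 + e / 4) * lil_scale rho (psi n)%:R.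
have ub : \forall n \near \oo, pr mu (low_return n (psi n) (b n)) <=
    Cq * C * expR (D + h) * expR (- (ln n%:R + 2 * ln (ln n%:R))).
  apply: filterS (psi_upper_numeric h0 rho0 e01) => n [pn hn].
  apply: (le_trans (low_return_le (b n) pn)).
  rewrite -[leRHS]mulrA -expRD ler_pM2l ?mulr_gt0// ler_expR /b /psi.
  by move: hn; set u := ln _ + _; set v := _ * lil_scale _ _; set w := _ * h; lra.
have bc : {ae mu, forall x, \forall n \near \oo, ~ low_return n (psi n) (b n) x}.
  have CC : 0 < Cq * C * expR (D + h) by rewrite !mulr_gt0 ?expR_gt0.
  apply: (telescoping_borel_cantelli
      (g := fun n => Cq * C * expR (D + h) * (ln n%:R)^-1)).
  - by move=> n; exact: measurable_determined (determined_low_return _ _ _).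
  - case=> [|n]; first by rewrite ln0// invr0 mulr0.
    by rewrite mulr_ge0 ?(ltW CC)// invr_ge0 ln_ge0// ler1n.
  apply: filterS2 (near_succ ub) (nbhs_infty_ge 2) => n hn n2.
  apply: (le_trans hn); rewrite -mulrBr ler_pM2l//.
  exact: log_series_telescope.
apply: filterS2 bc (lil_ub e4) => x bcx ubx [Xx rec].
have [N1 _ h1] := bcx; have [N2 _ h2] := ubx Xx.
have [N3 _ h3] : \forall n \near \oo, (N2 <= psi n)%N.
  have e10 : 0 <= 1 + e by rewrite addr_ge0// ltW.
  by apply: filterS (near_psi_ge rho h0 N2%:R e10) => n; rewrite ler_nat.
have [n [Nn ag]] := rec (maxn N1 N3).
move: Nn; rewrite geq_max => /andP[n1 n3].
apply: (h1 n n1); split=> //; split=> //; exists x; split; last exact: agree_refl.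
by split=> //; apply: h2; exact: h3.
Qed.

(** The logarithm of the last time at which [psi_lower_numeric] still applies; [trials] counts the
    multiples of [m + M] up to that time. *)
Let low (e : R) (m : nat) := m%:R * h - (1 - e / 2) * lil_scale rho m%:R.
Let trials (e : R) (m : nat) := Num.truncn (expR (low e m) / (m + M)%:R).

(** The cylinder measure is of order [expR ((1 - e / 4) * s - m * h)] and the horizon
    [expR (m * h - (1 - e / 2) * s)]. Their product [expR (e / 4 * s)] exceeds every power of [m],
    so failure has probability at most [m^-2]. *)
Lemma trials_numeric (e : R) : 0 < e <= 1 / 2 -> 0 <= D -> \forall m \near \oo,
  2 * ln m%:R <= qc * (C^-1 * expR ((1 - e / 4) * lil_scale rho m%:R - D - m%:R * h)) *
    (trials e m)%:R.
Proof.
move=> /andP[e0 e1] D0; pose kp := qc * C^-1 * expR (- D).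
have kp0 : 0 < kp by rewrite !mulr_gt0 ?invr_gt0 ?expR_gt0.
have r2 : 0 < 2 * rho by rewrite mulr_gt0.
have S0 : 0 < Num.sqrt (2 * rho) by rewrite sqrtr_gt0.
have c0 : 0 < 16 / (e * Num.sqrt (2 * rho)) by rewrite divr_gt0// mulr_gt0.
near=> m.
have m1 : 1 <= m%:R :> R by near: m; exact: near_nat (near_pinfty_ge _).
have Mm : M%:R <= m%:R :> R by near: m; exact: near_nat (near_pinfty_ge _).
have sm : lil_scale rho m%:R <= h * m%:R by near: m; exact: near_nat (lil_scale_small rho0 h0).
have ll1 : 1 <= ln (ln m%:R) :> R by near: m; exact: near_nat (near_lnln_ge _).
have lsq : 16 / (e * Num.sqrt (2 * rho)) * ln m%:R + 0 <= Num.sqrt m%:R :> R.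
  by near: m; exact: near_nat (near_ln_sqrt 0 c0).
have mB : (2 + qc / C) / (kp / 2) <= m%:R :> R by near: m; exact: near_nat (near_pinfty_ge _).
set s := lil_scale rho m%:R in sm *; set p := C^-1 * _; set L := trials e m.
have s0 : 0 <= s by exact: sqrtr_ge0.
have m0 : 0 < m%:R :> R by exact: lt_le_trans m1.
have mM0 : 0 < (m + M)%:R :> R by rewrite natrD ltr_pwDl.
have s4 : 4 * ln m%:R <= e / 4 * s.
  have h1 : Num.sqrt (2 * rho) * Num.sqrt m%:R <= s.
    rewrite -sqrtrM ?(ltW r2)// ler_wsqrtr// ler_wpM2l ?(ltW r2)// ler_peMr// ltW.
  have h2 : 16 * ln m%:R <= e * Num.sqrt (2 * rho) * Num.sqrt m%:R.
    rewrite [leRHS]mulrC -ler_pdivrMr ?mulr_gt0//.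
    by apply: le_trans lsq; rewrite addr0 mulrAC.
  have := ler_wpM2l (ltW e0) h1; rewrite mulrA => h3.
  by move: h2 h3; set u := e * _ * _; set v := ln _; clearbody u v s; lra.
have p1 : p <= C^-1.
  rewrite /p ler_piMr ?invr_ge0 ?(ltW C0)// -[leRHS]expR0 ler_expR.
  have : (1 - e / 4) * s <= 1 * s by rewrite ler_wpM2r//; lra.
  by rewrite [m%:R * h]mulrC; lra.
have p0 : 0 < p by rewrite mulr_gt0 ?invr_gt0 ?expR_gt0.
have pY : qc * p * expR (low e m) = kp * expR (e / 4 * s).
  rewrite /p /kp /low -!mulrA; congr (_ * (_ * _)); rewrite -!expRD; congr expR.
  by rewrite -/s; field.
have Lge : expR (low e m) / (m + M)%:R - 1 <= L%:R.
  by rewrite lerBlDr natr1 ltW// truncnS_gt.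
have h1 := ler_wpM2l (ltW (mulr_gt0 qc0 p0)) Lge.
have h2 : kp / 2 * m%:R ^+ 3 <= qc * p * (expR (low e m) / (m + M)%:R).
  rewrite mulrA pY ler_pdivlMr//.
  (* Of the four powers, one is lost to the spacing [m + M] and a second absorbs the constants. *)
  have e4 : m%:R ^+ 4 <= expR (e / 4 * s).
    by apply: le_trans (_ : expR (4 * ln m%:R) <= _); rewrite ?ler_expR// expRM_natl lnK ?posrE.
  have h3 := ler_wpM2l (ltW kp0) e4; apply: le_trans h3.
  have h4 : (m + M)%:R <= 2 * m%:R :> R by rewrite natrD; lra.
  have kq : 0 <= kp / 2 * m%:R ^+ 3 by rewrite mulr_ge0 ?exprn_ge0 ?divr_ge0// ltW.
  apply: (le_trans (ler_wpM2l kq h4)).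
  by rewrite le_eqVlt; apply/orP; left; apply/eqP; field.
have qp : qc * p <= qc / C by rewrite ler_pM2l.
have h5 : (2 + qc / C) * m%:R ^+ 2 <= kp / 2 * m%:R ^+ 3.
  rewrite [m%:R ^+ 3]exprS mulrA ler_pM2r ?exprn_gt0//.
  by rewrite [leRHS]mulrC -ler_pdivrMr ?divr_gt0.
have qC : 0 <= qc / C by rewrite divr_ge0 ?(ltW qc0) ?(ltW C0).
have lm : ln m%:R <= m%:R :> R by have := ln_le_sub1 m0; lra.
have mm : m%:R <= m%:R ^+ 2 :> R by rewrite expr2 ler_peMr// ltW.
have h6 : (2 + qc / C) * m%:R <= (2 + qc / C) * m%:R ^+ 2.
  by rewrite ler_wpM2l// addr_ge0.
have h7 : qc / C <= qc / C * m%:R by rewrite ler_peMr.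
rewrite mulrBr mulr1 in h1; rewrite mulrDl in h6.
move: (ln m%:R) lm (qc * p) h1 qp h2 => l lm z h1 qp h2; lra.
Unshelve. all: by end_near.
Qed.

Lemma ae_frequent_recurrence (e : R) : 0 < e <= 1 / 2 -> 0 <= D ->
  {ae mu, forall x, X x -> recurrence_set A (psi_fun h rho (1 - e)) x}.
Proof.
move=> e01 D0; have /andP[e0 e1] := e01.
have e4 : 0 < e / 4 <= 1 by rewrite divr_gt0//=; lra.
pose b (m : nat) : R := (1 - e / 4) * lil_scale rho m%:R.
have bc : {ae mu, forall x, \forall m \near \oo, ~ high_no_return m (trials e m) (b m) x}.
  apply: (telescoping_borel_cantelli (g := fun n => 1^-1 * expR (- (1 * ln n%:R)))).
  - by move=> n; exact: measurable_determined (determined_high_no_return _ _ _).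
  - by move=> n; rewrite mulr_ge0 ?expR_ge0// invr_ge0.
  apply: filterS2 (near_succ (trials_numeric e01 D0)) (nbhs_infty_ge 1) => n hn n1.
  apply: (le_trans (high_no_return_le _ _ _)); apply: le_trans (p_series_telescope ltr01 n1).
  by rewrite ler_expR lerN2.
apply: filterS2 bc (lil_lb e4) => x bcx lbx Xx; split=> // N.
have [N1 _ h1] := bcx; have [N2 _ h2] := psi_lower_numeric h0 rho0 e01.
have [m [Nm Vm]] := lbx Xx (maxn (maxn N 1) (maxn N1 N2)).
move: Nm; rewrite !geq_max => /andP[/andP[mN m1] /andP[mN1 mN2]].
have [i [iL ag]] : exists i, (0 < i <= trials e m)%N /\ agree m (iter (i * (m + M)) (@shift k) x) x.
  apply: contrapT => ni; apply: (h1 m mN1); split=> //.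
    by split=> //; exists x; split=> //; exact: agree_refl.
  by move=> i iL ag; apply: ni; exists i.
exists (i * (m + M))%N; split.
  by apply: (leq_trans mN); case/andP: iL => i0 _; rewrite (leq_trans (leq_addr M m))// leq_pmull.
apply: agree_leq ag; apply: (h2 m mN2).
have /andP[_ iT] := iL.
have mM0 : 0 < (m + M)%:R :> R by rewrite ltr0n addn_gt0 m1.
apply: (@le_trans _ _ ((trials e m)%:R * (m + M)%:R)).
  by rewrite -natrM ler_nat leq_mul2r iT orbT.
by rewrite -ler_pdivlMr// truncn_le// divr_ge0 ?expR_ge0.
Qed.

End Recurrence.

Lemma measurable_recurrence_set (k : nat) (A : 'M[int]_k.+2) (psi : nat -> nat) : measurable (recurrence_set A psi).
Proof.
have -> : recurrence_set A psi = \bigcap_N \bigcup_(n in [set n | (N <= n)%N])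
    (SigmaA A `&` [set x | agree (psi n) (iter n (@shift k) x) x]).
  apply/seteqP; split=> x.
    by move=> [Xx hr] N _; have [n [Nn ag]] := hr N; exists n.
  move=> hr; split; first by have [n _ []] := hr 0%N Logic.I.
  by move=> N; have [n Nn [_ ag]] := hr N Logic.I; exists n.
apply: bigcapT_measurable => N; apply: bigcup_measurable => n _.
apply: (@measurable_determined _ A (n + psi n)); split=> [x []//|x y Xy xy [Xx ag]]; split=> //.
move=> l lm; rewrite iter_shiftE -(xy l) ?ltn_addl// -(ag l lm) iter_shiftE xy//.
by rewrite ltn_add2l.
Qed.

Lemma limn_linear (R : realType) (a : nat -> R) (c : R) :
  (forall d, 0 < d -> exists B, forall n, `|a n - n%:R * c| <= n%:R * d + B) ->
  limn (fun n => n%:R^-1 * a n) = c.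
Proof.
move=> h; apply/cvg_lim => //; apply/cvgrPdist_le => e e0.
have e2 : 0 < e / 2 by rewrite divr_gt0.
have [B hB] := h _ e2; near=> n.
have n0 : 0 < n%:R :> R by rewrite ltr0n; near: n; exists 1%N.
have nB : B / (e / 2) <= n%:R by near: n; exact: near_nat (near_pinfty_ge _).
have -> : c - n%:R^-1 * a n = n%:R^-1 * (n%:R * c - a n).
  by rewrite mulrBr mulrA mulVf ?mul1r// gt_eqF.
rewrite normrM gtr0_norm ?invr_gt0// distrC ler_pdivrMl//.
apply: (le_trans (hB n)); move: nB; rewrite ler_pdivrMr//; lra.
Unshelve. all: by end_near.
Qed.

(** * Entropy and variance of the Gibbs measure *)

Section Identification.
Variables (R : realType) (k : nat) (A : 'M[int]_k.+2) (mu : probability (Sig k) R).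
Variables (alpha C : R) (u : Sig k -> R) (Hu : R) (M : nat).
Hypothesis alpha01 : 0 < alpha < 1.
Hypothesis muX : mu (SigmaA A) = 1%E.
Hypothesis mu_inv : forall E : set (Sig k), measurable E -> mu (@shift k @^-1` E) = mu E.
Hypothesis conn : connecting A M.
Hypothesis Hu0 : 0 < Hu.
Hypothesis u_hol : hnorm A alpha Hu u.
Hypothesis C_gt1 : 1 < C.
Hypothesis gibbs : forall x n, SigmaA A x ->
  C^-1 <= pr mu (ball_seq A n x) / expR (birkhoff u n x) <= C.
Implicit Types (phi psi xi chi : Sig k -> R) (x y z : Sig k) (E : set (Sig k)).
Local Notation X := (SigmaA A).
Local Notation I := (integral_on A mu).
Local Notation reg := (regular A alpha).
Let C0 : 0 < C := lt_trans ltr01 C_gt1.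
Let ru : reg u.
Proof. by exists Hu. Qed.

Lemma regular_integral_sum (T : Type) (s : seq T) (F : T -> Sig k -> R) :
  (forall i, reg (F i)) ->
  reg (fun x => \sum_(i <- s) F i x) /\ I (fun x => \sum_(i <- s) F i x) = \sum_(i <- s) I (F i).
Proof.
move=> rF; elim: s => [|i s [rs Is]].
  have e : (fun x : Sig k => \sum_(i <- [::]) F i x) = (fun=> 0) by apply/funext => x; rewrite big_nil.
  by rewrite e big_nil integral_cst//; split=> //; exact: regular_cst alpha01 0.
have e : (fun x => \sum_(j <- i :: s) F j x) = (fun x => F i x + \sum_(j <- s) F j x).
  by apply/funext => x; rewrite big_cons.
rewrite e big_cons -Is; split; first exact: (regularD alpha01).
exact: (regular_integralD mu alpha01).
Qed.

Lemma determined_cyl n (w : n.-tuple (alph k)) : determined A n (cylA A w).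
Proof.
split=> [x []//|x y Xy xy [wx Xx]]; split=> // l.
by rewrite -xy//; exact: wx.
Qed.

Lemma cylA_admissible n (w : n.-tuple (alph k)) x : cylA A w x -> admissible_word A w.
Proof.
move=> [wx Xx]; apply/forallP => i; apply/forallP => j; apply/implyP => /eqP ij.
by rewrite -!wx ij; apply/eqP.
Qed.

(** The sum is the integral of [ln (mu [x_1..x_n])], which by the Gibbs property stays within [ln C]
    of the Birkhoff sum of [u]; the pressure is already contained in [u]. *)
Lemma entropy_sum_le n : `|(\sum_(w : n.-tuple (alph k) | admissible_word A w)
  fine (mu (cylA A w)) * ln (fine (mu (cylA A w)))) - n%:R * I u| <= ln C.
Proof.
rewrite big_rmcond; last first.
  move=> w nw; have -> : cylA A w = set0.
    by rewrite -subset0 => x /cylA_admissible; apply/negP.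
  by rewrite measure0/= mul0r.
pose q x := \sum_(w <- index_enum {:n.-tuple (alph k)}) ln (pr mu (cylA A w)) * \1_(cylA A w) x : R.
have rF (w : n.-tuple (alph k)) : reg (fun x => ln (pr mu (cylA A w)) * \1_(cylA A w) x).
  have h := regular_indic alpha01 (determined_cyl w).
  by apply: (regularZ alpha01); exact: h.
have [rq Iq] := regular_integral_sum (index_enum {:n.-tuple (alph k)}) rF.
have IqE : I q = \sum_(w : n.-tuple (alph k)) pr mu (cylA A w) * ln (pr mu (cylA A w)).
  rewrite /q Iq; apply: eq_bigr => w _; rewrite (regular_integralZ alpha01 muX); last first.
    by have hi := regular_indic alpha01 (determined_cyl w); exact: hi.
  by rewrite (integral_indic_determined mu (determined_cyl w)) mulrC.
rewrite -/(pr mu _) -IqE -(regular_integral_birkhoff alpha01 muX mu_inv n ru).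
have rb : reg (birkhoff u n) by exact: (regular_birkhoff alpha01).
rewrite -(regular_integralB alpha01 muX rq rb).
have rd := regularB alpha01 rq rb.
have bd x : X x -> `|q x - birkhoff u n x| <= ln C.
  move=> Xx; pose w := [tuple x (nat_of_ord l) | l < n].
  have wx : cylA A w x by rewrite /w cylA_tuple; exact: ball_self.
  have -> : q x = ln (pr mu (ball_seq A n x)).
    rewrite /q (bigD1 w)//= big1 ?addr0.
      by rewrite indicE mem_set// mulr1 /w cylA_tuple.
    move=> w' ww'; rewrite indicE memNset ?mulr0// => -[w'x _].
    by move/eqP: ww'; apply; apply: eq_from_tnth => l; rewrite tnth_mktuple w'x.
  have /andP[lo up] := gibbs n Xx.
  have p0 : 0 < pr mu (ball_seq A n x).
    by move: lo; rewrite ler_pdivlMr ?expR_gt0//; apply: lt_le_trans; rewrite mulr_gt0 ?invr_gt0 ?expR_gt0.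
  have -> : ln (pr mu (ball_seq A n x)) - birkhoff u n x =
      ln (pr mu (ball_seq A n x) / expR (birkhoff u n x)).
    by rewrite ln_div ?posrE ?expR_gt0// expRK.
  have r0 : 0 < pr mu (ball_seq A n x) / expR (birkhoff u n x) by rewrite divr_gt0 ?expR_gt0.
  rewrite ler_norml -lnV ?posrE// !ler_ln ?posrE ?invr_gt0//.
  by rewrite lo up.
have rc : reg (fun=> ln C) by exact: regular_cst.
have rcn : reg (fun=> - ln C) by exact: regular_cst.
rewrite ler_norml; apply/andP; split.
  rewrite -[leLHS](integral_cst muX); apply: (regular_integral_le mu alpha01 rcn rd).
  by move=> x /bd; rewrite ler_norml => /andP[].
rewrite -[leRHS](integral_cst muX); apply: (regular_integral_le mu alpha01 rd rc).
by move=> x /bd; rewrite ler_norml => /andP[].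
Qed.

Lemma entropy_gibbs : entropy A mu = - I u.
Proof.
rewrite /entropy; under eq_fun do rewrite -mulrN.
apply: limn_linear => d d0; exists (ln C) => n.
rewrite mulrN opprK addrC -normrN opprD opprK addrC.
by apply: (le_trans (entropy_sum_le n)); rewrite lerDr mulr_ge0// ltW.
Qed.

Let Gadd n m x : birkhoff u (n + m) x = birkhoff u n x + birkhoff u m (iter n (@shift k) x).
Proof. exact: birkhoffD. Qed.
Let Gbnd n x : X x -> `|birkhoff u n x| <= n%:R * Hu.
Proof. by apply: birkhoff_norm; exact: u_hol.1. Qed.

(* A cylinder loses a uniform fraction of its measure when one more letter, [M]
   steps further, is prescribed: the other letters have positive conditional
   measure bounded below. *)
Lemma entropy_gt0 : I u < 0.
Proof.
pose qc := qi_const Hu C M.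
have qc0 : 0 < qc by exact: qi_const_gt0.
pose d := C^-1 * expR (- Hu).
have d0 : 0 < d by rewrite mulr_gt0 ?invr_gt0 ?expR_gt0.
have c0 : 0 < qc * d by exact: mulr_gt0.
have letter (a : alph k) : exists E, [/\ determined A 1 E, d <= pr mu E & forall x, E x -> x 0%N = a].
  have [y0 Xy0] := SigmaA_nonempty muX.
  have [z [Xz za _]] := conn a Xy0.
  exists (ball_seq A 1 z); split; [exact: determined_ball| |by move=> x [_ zx]; rewrite -zx].
  rewrite /d ler_pdivrMl//; apply: le_trans (gibbs_lb C_gt1 gibbs 1 Xz).
  by rewrite ler_expR; have := Gbnd 1 Xz; rewrite mul1r ler_norml => /andP[].
have decay x j : X x -> pr mu (ball_seq A (j * M.+1) x) <= expR (- (qc * d * j%:R)).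
  move=> Xx; elim: j => [|j IH].
    by rewrite mul0n mulr0 oppr0 expR0; apply: pr_le1; exact: measurable_ball.
  set n := (j * M.+1)%N in IH *.
  have nE : (j.+1 * M.+1 = (n + M).+1)%N by rewrite mulSn addSn addnC.
  (* The alphabet has at least two letters, so some letter differs from [x (n + M)]. *)
  pose a : alph k := if x (n + M)%N == ord0 then ord_max else ord0.
  have ax : a != x (n + M)%N by rewrite /a; case: ifPn => [/eqP->|]; rewrite // eq_sym.
  have [E [dE pE Ea]] := letter a.
  have dB := determined_ball A n x.
  have mB := measurable_determined dB.
  have mS : measurable (iter (n + M) (@shift k) @^-1` E).
    by apply: measurable_iter_shift; exact: measurable_determined dE.
  have sub : pr mu (ball_seq A (j.+1 * M.+1) x) <=
      pr mu (ball_seq A n x `\` iter (n + M) (@shift k) @^-1` E).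
    apply: le_pr; [exact: measurable_ball|exact: measurableD|].
    move=> y [Xy xy]; rewrite nE in xy; split.
      by split=> //; apply: agree_leq xy; rewrite leqW// leq_addr.
    move=> /= /Ea; rewrite iter_shiftE addn0 -(xy (n + M)%N)// => e.
    by move: ax; rewrite e eqxx.
  have h1 := quasi_indep_lb conn Gadd Gbnd C_gt1 gibbs dB dE.
  have h2 := prDI mu mB mS; apply: (le_trans sub).
  set p := pr mu (ball_seq A n x) in IH h1 h2 *; set q' := pr mu (_ `\` _) in h2 *.
  have p0 : 0 <= p by exact: pr_ge0.
  have h3 : q' <= p * (1 - qc * d).
    have := ler_wpM2l (mulr_ge0 (ltW qc0) p0) pE; rewrite mulrBr -/qc in h1 *; lra.
  apply: (le_trans h3); apply: (le_trans (ler_wpM2l p0 (expR_ge1Dx _))).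
  apply: (@le_trans _ _ (expR (- (qc * d * j%:R)) * expR (- (qc * d)))).
    by rewrite ler_wpM2r ?expR_ge0.
  by rewrite -expRD -opprD -[X in _ + X]mulr1 -mulrDr natr1.
(* By the Gibbs property exponentially small cylinders force [S_n u] below a decreasing linear
   function of [j]; integration rules out [I u >= 0]. *)
have bound j : (j * M.+1)%:R * I u <= ln C - qc * d * j%:R.
  rewrite -(regular_integral_birkhoff alpha01 muX mu_inv _ ru).
  have rb : reg (birkhoff u (j * M.+1)) by exact: (regular_birkhoff alpha01).
  have rc : reg (fun=> ln C - qc * d * j%:R) by exact: regular_cst.
  rewrite -[leRHS](integral_cst muX); apply: (regular_integral_le mu alpha01 rb rc) => x Xx.
  rewrite -ler_expR expRD lnK ?posrE//.
  by apply: (le_trans (gibbs_lb C_gt1 gibbs _ Xx)); rewrite ler_pM2l// decay.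
rewrite ltNge; apply/negP => Iu.
have [N _ hN] := near_nat (near_pinfty_ge ((ln C + 1) / (qc * d))).
have := hN N (leqnn N); rewrite ler_pdivrMr// => h1.
have := bound N; have : 0 <= (N * M.+1)%:R * I u by rewrite mulr_ge0.
by lra.
Qed.

Section Variance.
Variables xi chi : Sig k -> R.
Hypothesis rxi : reg xi.
Hypothesis rchi : reg chi.
Let rho := I (fun x => xi x ^+ 2).
Hypothesis xi_sq : forall n, I (fun x => birkhoff xi n x ^+ 2) = n%:R * rho.
Hypothesis uE : forall x, X x -> u x - I u = xi x + chi (shift x) - chi x.

(** Young's inequality, from the squares of [d * a + b] and [d * a - b]; [b] will be the bounded
    coboundary term of the Birkhoff sum. *)
Lemma square_perturbation (d S a b : R) : 0 < d <= 1 -> `|b| <= S ->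
  `|(a + b) ^+ 2 - a ^+ 2| <= d * a ^+ 2 + 2 / d * S ^+ 2.
Proof.
move=> /andP[d0 d1] bS.
have b2 : b ^+ 2 <= S ^+ 2 by rewrite -[b ^+ 2]real_normK ?num_real// lerXn2r ?nnegrE ?(le_trans _ bS).
have dd : 1 <= d^-1 by rewrite invf_ge1.
have sb : b ^+ 2 <= d^-1 * S ^+ 2.
  by apply: (le_trans b2); rewrite ler_peMl// sqr_ge0.
have sd : d^-1 * b ^+ 2 <= d^-1 * S ^+ 2 by rewrite ler_wpM2l// invr_ge0 ltW.
have h1 : 0 <= d^-1 * (d * a + b) ^+ 2 by rewrite mulr_ge0 ?sqr_ge0// invr_ge0 ltW.
have h2 : 0 <= d^-1 * (d * a - b) ^+ 2 by rewrite mulr_ge0 ?sqr_ge0// invr_ge0 ltW.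
have e1 : d^-1 * (d * a + b) ^+ 2 = d * a ^+ 2 + 2 * (a * b) + d^-1 * b ^+ 2 by field; rewrite gt_eqF.
have e2 : d^-1 * (d * a - b) ^+ 2 = d * a ^+ 2 - 2 * (a * b) + d^-1 * b ^+ 2 by field; rewrite gt_eqF.
have e3 : (a + b) ^+ 2 - a ^+ 2 = 2 * (a * b) + b ^+ 2 by ring.
have b0 : 0 <= b ^+ 2 by exact: sqr_ge0.
rewrite e3 -mulrA; rewrite {}e1 in h1; rewrite {}e2 in h2.
move: (a * b) (d * a ^+ 2) (d^-1 * b ^+ 2) (d^-1 * S ^+ 2) h1 h2 sb sd => ab aa bb ss h1 h2 sb sd.
by rewrite ler_norml; apply/andP; split; lra.
Qed.

Lemma asymp_variance_martingale (f : Sig k -> R) (c : R) : (forall x, f x = u x + c) ->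
  asymp_variance A f mu = rho.
Proof.
move=> fE; rewrite /asymp_variance; apply: limn_linear => d d0.
have If : I f = I u + c.
  have rc : reg (fun=> c) by exact: regular_cst.
  have -> : f = (fun x => u x + c) by apply/funext.
  by rewrite (regular_integralD mu alpha01 ru rc) integral_cst.
have rho0 : 0 <= rho.
  have rs : reg (fun x => xi x ^+ 2) by exact: (regularX alpha01).
  rewrite -[leLHS](integral_cst muX); apply: (regular_integral_le mu alpha01 _ rs); first exact: regular_cst.
  by move=> x _; exact: sqr_ge0.
have [S S0 [chiS _]] := rchi.
(* With this weight the cross term costs at most [n * d] after integration, as [e * rho <= d]. *)
pose e := Num.min 1 (d / (rho + 1)).
have e0 : 0 < e by rewrite lt_min ltr01 divr_gt0// ltr_wpDl.
have e1 : e <= 1 by rewrite ge_min lexx.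
have er : e * rho <= d.
  have : e <= d / (rho + 1) by rewrite ge_min lexx orbT.
  rewrite ler_pdivlMr ?ltr_wpDl// mulrDr mulr1; lra.
exists (2 / e * (2 * S) ^+ 2) => n.
have rb : reg (birkhoff xi n) by exact: (regular_birkhoff alpha01).
have rb2 : reg (fun x => birkhoff xi n x ^+ 2) by exact: (regularX alpha01).
pose b x := chi (iter n (@shift k) x) - chi x.
have rbb : reg b by apply: (regularB alpha01) => //; exact: (regular_shift alpha01).
have fb x : X x -> birkhoff f n x - n%:R * I f = birkhoff xi n x + b x.
  move=> Xx; rewrite /b addrA.
  have <- := birkhoff_cobound n (psi := fun x => u x - I u) uE Xx.
  have -> : birkhoff f n x = birkhoff u n x + n%:R * c.
    rewrite /birkhoff; under eq_bigr do rewrite fE.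
    by rewrite big_split/= sumr_const card_ord mulr_natl.
  have -> : birkhoff (fun x => u x - I u) n x = birkhoff u n x - n%:R * I u.
    by rewrite /birkhoff sumrB sumr_const card_ord mulr_natl.
  by rewrite If; ring.
have -> : I (fun x => (birkhoff f n x - n%:R * I f) ^+ 2) =
    I (fun x => (birkhoff xi n x + b x) ^+ 2).
  by apply: eq_integral_on => x; rewrite inE => Xx; rewrite fb.
have r1 : reg (fun x => (birkhoff xi n x + b x) ^+ 2).
  by apply: (regularX alpha01); exact: (regularD alpha01).
rewrite -xi_sq -(regular_integralB alpha01 muX r1 rb2).
have bS x : X x -> `|b x| <= 2 * S.
  move=> Xx; apply: (le_trans (ler_normB _ _)); rewrite mulr_natl mulr2n lerD ?chiS//.
  exact: SigmaA_shift.
have e01 : 0 < e <= 1 by rewrite e0.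
have pt x (Xx : X x) := square_perturbation (birkhoff xi n x) e01 (bS x Xx).
set cc := 2 / e * _ in pt *.
have ub : e * (n%:R * rho) + cc <= n%:R * d + cc by rewrite lerD2r mulrCA ler_wpM2l.
have ubE : I (fun x => e * birkhoff xi n x ^+ 2 + cc) = e * (n%:R * rho) + cc.
  have rz := regularZ alpha01 e rb2.
  have rc : reg (fun=> cc) by exact: regular_cst.
  by rewrite (regular_integralD mu alpha01 rz rc) (regular_integralZ alpha01 muX)// integral_cst// xi_sq.
have ru2 : reg (fun x => e * birkhoff xi n x ^+ 2 + cc).
  by apply: (regularD alpha01); [exact: (regularZ alpha01)|exact: regular_cst].
have rd := regularB alpha01 r1 rb2.
apply: le_trans ub; rewrite -ubE ler_norml -(regular_integralN alpha01 muX ru2).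
apply/andP; split; apply: (regular_integral_le mu alpha01) => //; first exact: (regularN alpha01).
  by move=> x /pt; rewrite ler_norml => /andP[].
by move=> x /pt; rewrite ler_norml => /andP[].
Qed.

(** If [mu(xi^2) = 0], then [xi] vanishes on [SigmaA], being continuous while every cylinder has
    positive measure. Then [f] is cohomologous to a constant through [chi]. *)
Lemma martingale_variance_gt0 (f : Sig k -> R) (c : R) : (forall x, f x = u x + c) ->
  ~ cohomologous_to_constant A f -> 0 < rho.
Proof.
move=> fE nc; have rs : reg (fun x => xi x ^+ 2) by exact: (regularX alpha01).
have rho0 : 0 <= rho.
  rewrite -[leLHS](integral_cst muX); apply: (regular_integral_le mu alpha01 _ rs); first exact: regular_cst.
  by move=> x _; exact: sqr_ge0.
rewrite lt_neqAle rho0 andbT; apply/eqP => /esym rhoE; apply: nc.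
have [Hx Hx0 [_ xih]] := rxi.
have xi0 x : X x -> xi x = 0.
  move=> Xx; apply/eqP; apply: contrapT => /negP nz.
  have e0 : 0 < `|xi x| / 2 by rewrite divr_gt0// normr_gt0.
  have [j hj] := geometric_small alpha01 Hx e0.
  pose B := ball_seq A j x.
  have p0 : 0 < pr mu B by exact: (pr_ball_gt0 C_gt1 gibbs).
  have := determined_markov alpha01 muX (t := (`|xi x| / 2) ^+ 2) (determined_ball A j x) rs.
  rewrite -/rho rhoE => h; suff : (`|xi x| / 2) ^+ 2 * pr mu B <= 0.
    by rewrite leNgt mulr_gt0// exprn_gt0.
  apply: h => [y _|y [Xy xy]]; first exact: sqr_ge0.
  rewrite -[xi y ^+ 2]real_normK ?num_real// lerXn2r ?nnegrE ?(ltW e0)//.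
  have := le_trans (xih j x y Xx Xy xy) (hj j (leqnn j)).
  by have := lerB_dist (xi x) (xi y); lra.
exists chi, (I u + c); split.
  move=> x Xx e e0; have [S S0 [_ chih]] := rchi.
  have e2 : 0 < e / 2 by rewrite divr_gt0.
  have [j hj] := geometric_small alpha01 S e2.
  exists j => y Xy xy; apply: (le_lt_trans (chih j x y Xx Xy xy)).
  by apply: (le_lt_trans (hj j (leqnn j))); lra.
move=> x Xx; rewrite fE; have := uE Xx; rewrite xi0// add0r => <-; ring.
Qed.
End Variance.
End Identification.

(** * Assembly of the estimates *)

Lemma le_psi_fun (R : realType) (h rho s s' : R) n : s <= s' ->
  (psi_fun h rho s n <= psi_fun h rho s' n)%N.
Proof.
move=> ss; apply: le_truncn; rewrite lerD2l ler_wpM2r ?sqrtr_ge0// ler_wpM2r//.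
by rewrite invr_ge0 powR_ge0.
Qed.

Lemma recurrence_set_subset (k : nat) (A : 'M[int]_k.+2) (psi psi' : nat -> nat) :
  (forall n, (psi n <= psi' n)%N) -> recurrence_set A psi' `<=` recurrence_set A psi.
Proof.
move=> le x [Xx h]; split=> // N; have [n [Nn ag]] := h N; exists n; split=> //.
exact: agree_leq ag.
Qed.

Lemma holder_hnorm (R : realType) (k : nat) (A : 'M[int]_k.+2) (alpha b : R) (f : Sig k -> R) :
  0 < alpha < 1 -> (exists x, SigmaA A x) ->
  (forall x y n, SigmaA A x -> SigmaA A y -> agree n x y -> `|f x - f y| <= b * alpha ^+ n) ->
  exists H, hnorm A alpha H f.
Proof.
move=> /andP[a0 _] [x0 Xx0] hf; exists (b + `|f x0|); split=> [x Xx|n x y Xx Xy xy].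
  have a00 : agree 0 x x0 by [].
  have := hf x x0 0%N Xx Xx0 a00.
  rewrite expr0 mulr1 => h; rewrite -lerBlDr; exact: le_trans (lerB_dist _ _) h.
by apply: (le_trans (hf x y n Xx Xy xy)); rewrite ler_wpM2r ?exprn_ge0 ?(ltW a0)// lerDl.
Qed.

Lemma gibbs_recurrence (R : realType) (k : nat) (A : 'M[int]_k.+2) (f : Sig k -> R)
    (mu : probability (Sig k) R) (e : R) :
  zero_one_matrix A -> primitive_matrix A -> holder A f -> ~ cohomologous_to_constant A f ->
  gibbs_measure A f mu -> 0 < e <= 1 / 2 ->
  {ae mu, forall x, ~ recurrence_set A
    (psi_fun (entropy A mu) (asymp_variance A f mu) (1 + e)) x} /\
  {ae mu, forall x, SigmaA A x -> recurrence_set A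
    (psi_fun (entropy A mu) (asymp_variance A f mu) (1 - e)) x}.
Proof.
move=> zo prim [b [alpha [b0 [alpha01 hf]]]] ncob [muX mu_inv _ [C [C_gt1 gibbs0]]] e01.
have e02 : 0 < e <= 1 by case/andP: e01 => -> /=; lra.
have [M conn] := primitive_connecting zo prim.
(* Subtracting the pressure absorbs the factor [expR (- n * P(f))] of the Gibbs property into the
   Birkhoff sum. *)
pose Pp := pressure A f; pose u x := f x - Pp.
have C0 : 0 < C by exact: lt_trans C_gt1.
have bu n x : birkhoff u n x = - (n%:R * Pp) + birkhoff f n x.
  by rewrite /birkhoff /u sumrB sumr_const card_ord mulr_natl addrC.
have gibbs x n : SigmaA A x ->
    C^-1 <= pr mu (ball_seq A n x) / expR (birkhoff u n x) <= C.
  by move=> Xx; rewrite bu -cylA_tuple; exact: gibbs0.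
have [Hu Hu0 u_hol] : regular A alpha u.
  have [H hH] := holder_hnorm alpha01 (SigmaA_nonempty muX) hf.
  by apply: (regularB alpha01); [exact: hnorm_regular hH|exact: regular_cst].
have ru : regular A alpha u by exists Hu.
have [v [rv P1]] := normalized_potential alpha01 muX conn Hu0 u_hol C_gt1 gibbs.
have [K [th [K0 th01 mix]]] := gibbs_mixing alpha01 muX mu_inv conn u_hol C_gt1 gibbs rv P1.
pose Iu := integral_on A mu u; pose phi x := u x - Iu.
have rcI : regular A alpha (fun=> Iu) by exact: regular_cst.
have rphi : regular A alpha phi by exact: (regularB alpha01 ru rcI).
have Iphi : integral_on A mu phi = 0.
  by rewrite /phi (regular_integralB alpha01 muX ru rcI) integral_cst// subrr.
have [xi [chi [rxi rchi Pxi phiE]]] :=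
  gibbs_martingale_decomposition alpha01 P1 th01 K0 mix rphi Iphi.
have [t0 [K1 [t00 K11 mgf]]] := mgf_bounds alpha01 muX P1 th01 K0 mix rxi rchi Pxi phiE.
pose rho := integral_on A mu (fun x => xi x ^+ 2).
have xisq n := integral_birkhoff_sq alpha01 muX P1 th01 mix n rxi Pxi.
have fE x : f x = u x + Pp by rewrite /u subrK.
have varE : asymp_variance A f mu = rho.
  exact: (asymp_variance_martingale alpha01 muX Hu0 u_hol rxi rchi xisq phiE fE).
have rho0 : 0 < rho.
  exact: (martingale_variance_gt0 alpha01 muX C_gt1 gibbs rxi rchi phiE fE ncob).
have hE : entropy A mu = - Iu.
  exact: (entropy_gibbs alpha01 muX mu_inv Hu0 u_hol C_gt1 gibbs).
have h0 : 0 < - Iu.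
  rewrite oppr_gt0.
  exact: (entropy_gt0 alpha01 muX mu_inv conn Hu0 u_hol C_gt1 gibbs).
have Gadd n m x : birkhoff u (n + m) x = birkhoff u n x + birkhoff u m (iter n (@shift k) x).
  exact: birkhoffD.
have Gbnd n x : SigmaA A x -> `|birkhoff u n x| <= n%:R * Hu.
  by apply: birkhoff_norm; exact: u_hol.1.
have bphi n x : birkhoff phi n x - n%:R * - Iu = birkhoff u n x.
  by rewrite /birkhoff /phi sumrB sumr_const card_ord mulrN opprK mulr_natl subrK.
have qc0 : 0 < qi_const Hu C M by exact: qi_const_gt0.
have qlb j l E F (dE : determined A j E) (dF : determined A l F) :=
  quasi_indep_lb conn Gadd Gbnd C_gt1 gibbs dE dF.
have qub j l E F (dE : determined A j E) (dF : determined A l F) :=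
  quasi_indep_ub Gadd C_gt1 gibbs dE dF.
have D0 : 0 <= 2 * ln C by rewrite mulr_ge0// ln_ge0// ltW.
have dist n x y : SigmaA A x -> SigmaA A y -> agree n x y ->
    `|birkhoff phi n x - birkhoff phi n y| <= 2 * ln C.
  move=> Xx Xy xy; have := distortion_ln C_gt1 gibbs Xx Xy xy.
  by rewrite -!bphi opprB addrA subrK.
have [U U0 [phiU _]] := rphi.
have up d (d01 : 0 < d <= 1) := lil_upper alpha01 muX rphi rho0 t00 K11 mgf qc0 qlb D0 dist
  (ltW U0) phiU d01.
have lo d (d01 : 0 < d <= 1) := lil_lower alpha01 muX rphi rho0 t00 K11 mgf qc0 qlb D0 dist
  (ltW U0) phiU d01.
have bub n x : SigmaA A x ->
    pr mu (ball_seq A n x) <= C * expR (birkhoff phi n x - n%:R * - Iu).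
  by move=> Xx; rewrite bphi; exact: (gibbs_ub gibbs).
have blb n x : SigmaA A x ->
    expR (birkhoff phi n x - n%:R * - Iu) <= C * pr mu (ball_seq A n x).
  by move=> Xx; rewrite bphi; exact: (gibbs_lb C_gt1 gibbs).
rewrite hE varE; split.
  have C3 : 0 < C ^+ 3 by rewrite exprn_gt0.
  exact: (ae_rare_recurrence muX h0 rho0 C0 C3 bub qub dist up e02).
exact: (ae_frequent_recurrence muX h0 rho0 C0 qc0 blb qlb dist lo e01 D0).
Qed.

Theorem theorem2p4 (R : realType) (k : nat) (A : 'M[int]_k.+2)
  (f : Sig k -> R) (mu : probability (Sig k) R) :
  zero_one_matrix A -> primitive_matrix A ->
  holder A f -> ~ cohomologous_to_constant A f ->
  gibbs_measure A f mu ->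
  forall eps : R, 0 < eps ->
    mu (recurrence_set A (psi_fun (entropy A mu) (asymp_variance A f mu)
                                  (1 + eps))) = 0%E /\
    mu (recurrence_set A (psi_fun (entropy A mu) (asymp_variance A f mu)
                                  (1 - eps))) = 1%E.
Proof.
move=> zo prim hol ncob gm eps eps0; have [muX _ _ _] := gm.
(* Shrinking [eps] only enlarges the upper recurrence set and diminishes the lower one, so the case
   [e <= 1 / 2] suffices. *)
pose e : R := Num.min eps (1 / 2).
have e01 : 0 < e <= 1 / 2 by rewrite lt_min eps0 ge_min lexx orbT divr_gt0.
have ee : e <= eps by rewrite ge_min lexx.
have [rare freq] := gibbs_recurrence zo prim hol ncob gm e01.
set h := entropy A mu in rare freq *; set rho := asymp_variance A f mu in rare freq *.
split.
  apply: measure_negligible; first exact: measurable_recurrence_set.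
  apply: negligibleS rare => x Rx /= nR; apply: nR; apply: recurrence_set_subset Rx => n.
  by apply: le_psi_fun; rewrite lerD2l.
set S := recurrence_set _ _.
have mS : measurable S by exact: measurable_recurrence_set.
have mX := measurable_SigmaA A.
have null : mu (SigmaA A `\` S) = 0%E.
  apply: measure_negligible; first exact: measurableD.
  apply: negligibleS freq => x [Xx nS] hx; apply: nS; have := hx Xx.
  apply: recurrence_set_subset => n; apply: le_psi_fun.
  by rewrite lerD2l lerN2.
have SX : SigmaA A `&` S = S by apply/setIidPr => x [].
have := prDI mu mX mS; rewrite SX /pr null muX/= add0r => p1.
by rewrite prE// /pr -p1.
Qed.
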